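(* Let $n\in\mathbb{N}$ and $\ell\in\{0,1,\dots,2n\}$. There exist polynomials $\nu^{\mathsf C}_{n,0,\ell},\nu^{\mathsf C}_{n,1,\ell},\dots,\nu^{\mathsf C}_{n,n,\ell}\in\mathbb{Z}[Z]$ such that for every prime $p$ and every full-dimensional lattice polytope $P\subset\mathbb{R}^{2n}$ the function $\mathscr{E}_{n,p,\ell,P}$ is a Hecke eigenfunction with $$T_n^{\mathsf C}(p,0)\,\mathscr{E}_{n,p,\ell,P}=\nu^{\mathsf C}_{n,0,\ell}(p)\,\mathscr{E}_{n,p,\ell,P},\qquad T_n^{\mathsf C}(p^2,k)\,\mathscr{E}_{n,p,\ell,P}=\nu^{\mathsf C}_{n,k,\ell}(p)\,\mathscr{E}_{n,p,\ell,P}\quad (1\le k\le n).$$ In particular these polynomials are independent of $P$, and if $c_\ell(E(P))\neq 0$ then $\nu^{\mathsf C}_{n,0,\ell}(p)=c_\ell(T_n^{\mathsf C}(p,0)E(P))/c_\ell(E(P))$ and $\nu^{\mathsf C}_{n,k,\ell}(p)=c_\ell(T_n^{\mathsf C}(p^2,k)E(P))/c_\ell(E(P))$ for $1\le k\le n$. Moreover, the parameters associated to these eigenvalues are $(a_0,a_1,\dots,a_n)=(p^\ell,p,p^2,\dots,p^{n-1},p^{n-\ell})$; that is, $\nu^{\mathsf C}_{n,0,\ell}(p)$ and $\nu^{\mathsf C}_{n,k,\ell}(p)$ ($1\le k\le n$) are the values of the Satake images $\Omega(T_n^{\mathsf C}(p,0))$ and $\Omega(T_n^{\mathsf C}(p^2,k))$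 at $x_0=p^\ell$, $x_i=p^i$ for $1\le i\le n-1$, $x_n=p^{n-\ell}$.
   Context: Groups. Let $J=\begin{pmatrix}0&I_n\\-I_n&0\end{pmatrix}$ and, for a ring $K$, $\mathrm{GSp}_{2n}(K)=\{A\in\mathrm{GL}_{2n}(K): AJA^{\mathrm t}=\mu(A)J\text{ for some }\mu(A)\in K^\times\}$. For a prime $p$ put $G_n=\mathrm{GSp}_{2n}(\mathbb{Q}_p)$, $\Gamma_n=\mathrm{GSp}_{2n}(\mathbb{Z}_p)$, $G_n^+=\mathrm{GSp}_{2n}(\mathbb{Q}_p)\cap\mathrm{Mat}_{2n}(\mathbb{Z}_p)$. Ehrhart polynomials. A lattice polytope $P\subset\mathbb{R}^{2n}$ is the convex hull of finitely many points of $\mathbb{Z}^{2n}$. For a lattice $\Lambda$ with $\mathbb{Z}^{2n}\subseteq\Lambda\subseteq\mathbb{Q}^{2n}$, the Ehrhart polynomial $E^\Lambda(P)=\sum_{\ell=0}^{2n}c_\ell^\Lambda(P)T^\ell\in\mathbb{Q}[T]$ is the polynomial whose value at each $m\in\mathbb{N}$ is $\#(mP\cap\Lambda)$. For a polynomial $F$, $c_\ell(F)$ is its coefficient of $T^\ell$. Write $E(P)=E^{\mathbb{Z}^{2n}}(P)$. A $\mathbb{Z}_p$-lattice $\Lambda$ with $\mathbb{Z}_p^{2n}\subseteq\Lambda\subseteq\mathbb{Q}_p^{2n}$ is identified with the lattice $\Lambda\cap\mathbb{Z}[1/p]^{2n}$, which contains $\mathbb{Z}^{2n}$, so that $E^\Lambda(P)$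 is defined. For $g\in\mathrm{GL}_{2n}(\mathbb{Q}_p)$, $\Lambda_g$ is the $\mathbb{Z}_p$-lattice generated by the rows of $g$; for $g\in G_n^+$ one has $\mathbb{Z}_p^{2n}\subseteq\Lambda_{g^{-1}}$, and one writes $E(g\cdot P)=E^{\Lambda_{g^{-1}}}(P)$ (vectors are row vectors and $g$ acts by $v\mapsto vg$). This depends only on the coset $g\Gamma_n$. Hecke action. Let $D_0=\mathrm{diag}(1,\dots,1,p,\dots,p)$ ($n$ ones, $n$ entries $p$) and, for $1\le k\le n$, $D_k=\mathrm{diag}(\underbrace{1,\dots,1}_{n-k},\underbrace{p,\dots,p}_{k},\underbrace{p^2,\dots,p^2}_{n-k},\underbrace{p,\dots,p}_{k})$. Let $\mathscr{D}^{\mathsf C}_{n,k}=\Gamma_nD_k\Gamma_n/\Gamma_n$. The elements $T_n^{\mathsf C}(p,0)=\Gamma_nD_0\Gamma_n$ and $T_n^{\mathsf C}(p^2,k)=\Gamma_nD_k\Gamma_n$ ($1\le k\le n$) generate the spherical Hecke algebra $\mathcal{H}^{\mathsf C}_p$ of the pair $(G_n^+,\Gamma_n)$. They act by $$T_n^{\mathsf C}(p,0)E(P)=\sum_{h\in\mathscr{D}^{\mathsf C}_{n,0}}E(h\cdot P),\qquad T_n^{\mathsf C}(p^2,k)E(P)=\sum_{h\in\mathscr{D}^{\mathsf C}_{n,k}}E(h\cdot P),$$ and, correspondingly, on $E^{\Lambda_{g^{-1}}}(P)=E(g\cdot P)$ for $g\in G_n^+$ by $\sum_h E(h\cdot(g\cdot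 P))=\sum_h E^{\Lambda_{(gh)^{-1}}}(P)$, with $h$ over the same index sets. Define $$\mathscr{E}_{n,p,\ell,P}:G_n^+/\Gamma_n\to\mathbb{C},\quad g\Gamma_n\mapsto c_\ell\big(E^{\Lambda_{g^{-1}}}(P)\big),\qquad (T\mathscr{E}_{n,p,\ell,P})(g\Gamma_n)=c_\ell\big(T E^{\Lambda_{g^{-1}}}(P)\big).$$ Satake map. $\Omega$ is the Satake isomorphism from $\mathcal{H}_p^{\mathsf C}$ to Weyl-group invariants in $\mathbb{C}[x_0^{\pm1},\dots,x_n^{\pm1}]$, in Andrianov's normalization: if $\Gamma_ng\Gamma_n=\bigsqcup_i\Gamma_nM_i$ with $M_i=\begin{pmatrix}p^{\delta_i}(D_i^{\mathrm t})^{-1}&B_i\\0&D_i\end{pmatrix}$ and $D_i$ upper triangular with diagonal $(p^{d_{i1}},\dots,p^{d_{in}})$, then $\Omega(\Gamma_ng\Gamma_n)=\sum_ix_0^{\delta_i}\prod_{j=1}^n(p^{-j}x_j)^{d_{ij}}$. A homomorphism $\lambda:\mathcal{H}_p^{\mathsf C}\to\mathbb{C}$ has parameters $(a_0,\dots,a_n)$ if $\lambda(T)$ is the value of $\Omega(T)$ at $x_i=a_i$ ($0\le i\le n$). *)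

(* Defs.v *)
From HB Require Import structures.
From mathcomp Require Import all_boot all_order all_algebra complex.
From mathcomp Require Import boolp classical_sets functions cardinality fsbigop.
From mathcomp Require Import reals.

Set Implicit Arguments.
Unset Strict Implicit.
Unset Printing Implicit Defensive.

Import Order.TTheory GRing.Theory Num.Theory.
Local Open Scope classical_set_scope.
Local Open Scope card_scope.
Local Open Scope ring_scope.

(** The ring Z_p is the inverse limit of the rings Z / p^k: the k-th component
    of a p-adic integer is the canonical representative in [0, p^k[ of its
    residue modulo p^k (the range condition is part of the equation below). *)
Definition padic_coherent (p : nat) : {pred nat -> int} :=
  fun x => `[< forall k, x k = (x k.+1 %% (p ^ k)%N%:Z)%Z >].

Record padic_int (p : nat) (pp : prime p) := PadicInt {
  padic_val : nat -> int;
  padic_valP : padic_val \in padic_coherent p }.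

Section PadicIntRing.
Context {p : nat} {pp : prime p}.
Local Notation Zp := (padic_int pp).

HB.instance Definition _ := [isSub for @padic_val p pp].
HB.instance Definition _ := [Choice of Zp by <:].

Local Notation q k := ((p ^ k)%N%:Z).

Fact padic_coh (x : Zp) k : padic_val x k = (padic_val x k.+1 %% q k)%Z.
Proof. by move/asboolP: (padic_valP x). Qed.

Fact padic_red (x : Zp) k : (padic_val x k %% q k)%Z = padic_val x k.
Proof. by rewrite padic_coh modz_mod. Qed.

Fact padic_modSl (a : int) k : ((a %% q k.+1)%Z = a %[mod q k])%Z.
Proof.
rewrite {2}(divz_eq a (q k.+1)) expnS PoszM mulrA.
by rewrite modzMDl.
Qed.

Fact padic_mk_subproof (f : nat -> int) :
  (forall k, (f k = f k.+1 %[mod q k])%Z) ->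
  (fun k => f k %% q k)%Z \in padic_coherent p.
Proof. by move=> fP; apply/asboolP => k; rewrite padic_modSl. Qed.

Definition padic_mk f (fP : forall k, (f k = f k.+1 %[mod q k])%Z) : Zp :=
  PadicInt pp (padic_mk_subproof fP).

Fact padic_ext (x y : Zp) : (forall k, padic_val x k = padic_val y k) -> x = y.
Proof. by move=> xy; apply/val_inj/funext. Qed.

Fact padic_cohm (x : Zp) k : (padic_val x k = padic_val x k.+1 %[mod q k])%Z.
Proof. by rewrite padic_red -padic_coh. Qed.

Fact padic_cst_subproof (a : int) k : (a = a %[mod q k])%Z.
Proof. by []. Qed.

Fact padic_add_subproof (x y : Zp) k :
  (padic_val x k + padic_val y k
     = padic_val x k.+1 + padic_val y k.+1 %[mod q k])%Z.
Proof. by rewrite -modzDm padic_cohm (padic_cohm y) modzDm. Qed.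

Fact padic_opp_subproof (x : Zp) k :
  (- padic_val x k = - padic_val x k.+1 %[mod q k])%Z.
Proof. by rewrite -modzNm padic_cohm modzNm. Qed.

Fact padic_mul_subproof (x y : Zp) k :
  (padic_val x k * padic_val y k
     = padic_val x k.+1 * padic_val y k.+1 %[mod q k])%Z.
Proof. by rewrite -modzMm padic_cohm (padic_cohm y) modzMm. Qed.

Definition padic_cst (a : int) : Zp := padic_mk (padic_cst_subproof a).
Definition padic_add (x y : Zp) : Zp := padic_mk (padic_add_subproof x y).
Definition padic_opp (x : Zp) : Zp := padic_mk (padic_opp_subproof x).
Definition padic_mul (x y : Zp) : Zp := padic_mk (padic_mul_subproof x y).

Fact padic_addA : associative padic_add.
Proof. by move=> x y z; apply: padic_ext => k /=; rewrite modzDmr modzDml addrA. Qed.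

Fact padic_addC : commutative padic_add.
Proof. by move=> x y; apply: padic_ext => k /=; rewrite addrC. Qed.

Fact padic_add0 : left_id (padic_cst 0) padic_add.
Proof. by move=> x; apply: padic_ext => k /=; rewrite modzDml add0r padic_red. Qed.

Fact padic_addN : left_inverse (padic_cst 0) padic_opp padic_add.
Proof. by move=> x; apply: padic_ext => k /=; rewrite modzDml addNr. Qed.

HB.instance Definition _ :=
  GRing.isZmodule.Build Zp padic_addA padic_addC padic_add0 padic_addN.

Fact padic_mulA : associative padic_mul.
Proof. by move=> x y z; apply: padic_ext => k /=; rewrite modzMmr modzMml mulrA. Qed.

Fact padic_mulC : commutative padic_mul.
Proof. by move=> x y; apply: padic_ext => k /=; rewrite mulrC. Qed.

Fact padic_mul1 : left_id (padic_cst 1) padic_mul.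
Proof. by move=> x; apply: padic_ext => k /=; rewrite modzMml mul1r padic_red. Qed.

Fact padic_mulDl : left_distributive padic_mul padic_add.
Proof.
move=> x y z; apply: padic_ext => k /=.
by rewrite modzMml modzDm mulrDl.
Qed.

Fact padic_one_neq0 : padic_cst 1 != padic_cst 0.
Proof.
apply/eqP => /(congr1 (fun x => padic_val x 1)) /=.
by rewrite expn1 mod0z modz_small //= ltz_nat prime_gt1.
Qed.

HB.instance Definition _ := GRing.Zmodule_isComNzRing.Build Zp
  padic_mulA padic_mulC padic_mul1 padic_mulDl padic_one_neq0.

Definition padic_unit : {pred Zp} := fun x => `[< exists y, y * x = 1 >].

Definition padic_inv (x : Zp) : Zp := xget x [set y | y * x = 1].

Fact padic_mulV : {in padic_unit, left_inverse 1 padic_inv *%R}.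
Proof. by move=> x /asboolP xU; apply: (xgetPex x xU). Qed.

Fact padic_unitP (x y : Zp) : y * x = 1 -> padic_unit x.
Proof. by move=> yx; apply/asboolP; exists y. Qed.

Fact padic_inv_out : {in [predC padic_unit], padic_inv =1 id}.
Proof.
move=> x /negP xU; rewrite /padic_inv; case: xgetP => // y _ yx.
by case: xU; apply: padic_unitP yx.
Qed.

HB.instance Definition _ := GRing.ComNzRing_hasMulInverse.Build Zp
  padic_mulV padic_unitP padic_inv_out.

Fact padic_coh_le (x : Zp) k m :
  (padic_val x (k + m) = padic_val x k %[mod q k])%Z.
Proof.
elim: m => [|m IH]; first by rewrite addn0.
rewrite -IH addnS; apply/eqP; rewrite eqz_mod_dvd.
apply: (@dvdz_trans (q (k + m))); first by rewrite dvdzE /= dvdn_exp2l ?leq_addr.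
by rewrite -eqz_mod_dvd; apply/eqP/esym/padic_cohm.
Qed.

Fact padic_integral : GRing.integral_domain_axiom Zp.
Proof.
move=> x y xy0; apply/norP => -[x0 y0].
have nz (z : Zp) : z != 0 -> exists k, padic_val z k != 0.
  move=> z0; apply: contrapT => zk; case/eqP: z0; apply: padic_ext => k.
  rewrite /= mod0z; apply/eqP; apply: contrapT => /negP ?.
  by apply: zk; exists k.
have val_bound (z : Zp) k m : padic_val z k != 0 ->
    ~~ (p ^ k %| `|padic_val z (k + m)|)%N.
  move=> zk; apply: contra zk => pk.
  have /dvdz_mod0P : (q k %| padic_val z (k + m))%Z by rewrite dvdzE.
  by rewrite padic_coh_le padic_red => ->.
have [[a xa] [b yb]] := (nz x x0, nz y y0).
have {}xa := val_bound x a b xa; have {}yb := val_bound y b a yb.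
rewrite [(b + a)%N]addnC in yb.
have := congr1 (fun z => padic_val z (a + b)) xy0.
rewrite /= mod0z => /dvdz_mod0P; rewrite dvdzE abszM /=.
set u := `|_|%N in xa *; set v := `|_|%N in yb *.
have gt0 w c : ~~ (p ^ c %| w)%N -> (0 < w)%N.
  by case: w => //; rewrite dvdn0.
have [u0 v0] := (gt0 _ _ xa, gt0 _ _ yb).
rewrite pfactor_dvdn ?muln_gt0 ?u0 // lognM //.
move: xa yb; rewrite !pfactor_dvdn // -!ltnNge => xa yb.
by apply/negP; rewrite -ltnNge -addSn leq_add // ltnW.
Qed.

HB.instance Definition _ := GRing.ComUnitRing_isIntegral.Build Zp padic_integral.

End PadicIntRing.

Notation padic_num pp := {fraction (padic_int pp)}.

Definition symp_form (K : comUnitRingType) (n : nat) : 'M[K]_(n + n) :=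
  block_mx 0 1%:M (- 1%:M) 0.

Definition GSp (K : comUnitRingType) (n : nat) : set 'M[K]_(n + n) :=
  [set A | A \in unitmx /\
     exists2 mu : K, mu \is a GRing.unit &
       A *m symp_form K n *m A^T = mu *: symp_form K n].
Arguments GSp : clear implicits.

Section SymplecticCosets.
Context {p : nat} (pp : prime p) (n : nat).
Local Notation Zp := (padic_int pp).
Local Notation Qp := (padic_num pp).
Local Notation toQp := (map_mx (@tofrac Zp)).

Definition Gamma : set 'M[Qp]_(n + n) := [set toQp A | A in GSp Zp n].

Definition Gplus : set 'M[Qp]_(n + n) :=
  GSp Qp n `&` range (fun A : 'M[Zp]_(n + n) => toQp A).

Definition lcoset (g : 'M[Qp]_(n + n)) : set 'M[Qp]_(n + n) :=
  [set g *m x | x in Gamma].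

Definition rcoset (g : 'M[Qp]_(n + n)) : set 'M[Qp]_(n + n) :=
  [set x *m g | x in Gamma].

Definition dcoset (g : 'M[Qp]_(n + n)) : set 'M[Qp]_(n + n) :=
  [set x *m g *m y | x in Gamma & y in Gamma].

Definition Gplus_cosets : set (set 'M[Qp]_(n + n)) :=
  [set lcoset g | g in Gplus].

Definition coset_repr (X : set 'M[Qp]_(n + n)) : 'M[Qp]_(n + n) :=
  xget 1%:M X.

(** D_k has diagonal blocks of sizes n, n for k = 0, and n-k, k, n-k, k for
    1 <= k <= n. *)
Definition hecke_exp (k : 'I_n.+1) (i : 'I_(n + n)) : nat :=
  if k == 0%N :> nat then (if (i < n)%N then 0 else 1)%N
  else if (i < n - k)%N then 0%N
  else if (i < n)%N then 1%N
  else if (i < n + (n - k))%N then 2%N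
  else 1%N.

Definition hecke_mx (k : 'I_n.+1) : 'M[Qp]_(n + n) :=
  diag_mx (\row_i (p%:R ^+ hecke_exp k i)).

(** Gamma_n D_k Gamma_n / Gamma_n *)
Definition hecke_cosets (k : 'I_n.+1) : set (set 'M[Qp]_(n + n)) :=
  [set lcoset h | h in dcoset (hecke_mx k)].

Definition row_lattice (g : 'M[Qp]_(n + n)) : set 'rV[Qp]_(n + n) :=
  range (fun c : 'rV[Zp]_(n + n) => toQp c *m g).

(** The intersection of a Z_p-lattice with the row vectors over Z[1/p]. *)
Definition rat_lattice (L : set 'rV[Qp]_(n + n)) : set 'rV[rat]_(n + n) :=
  [set v : 'rV[rat]_(n + n) | (forall i, exists k, p%:R ^+ k * v 0 i \is a Num.int) /\
           L (map_mx ratr v)].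

End SymplecticCosets.

Arguments Gamma {p} pp n.
Arguments Gplus {p} pp n.
Arguments Gplus_cosets {p} pp n.
Arguments hecke_mx {p} pp {n} k.
Arguments hecke_cosets {p} pp {n} k.

Section Ehrhart.
Context {R : realType} {d : nat}.
Implicit Types (P : set 'rV[R]_d) (L : set 'rV[rat]_d).

Definition lattice_polytope P : Prop :=
  exists (s : nat) (v : 'I_s -> 'rV[int]_d),
    P = [set x | exists w : 'I_s -> R,
           [/\ forall i, 0 <= w i, \sum_i w i = 1 &
               x = \sum_i w i *: map_mx intr (v i)]].

Definition affine_hull P : set 'rV[R]_d :=
  [set x | exists (s : nat) (y : 'I_s -> 'rV[R]_d) (w : 'I_s -> R),
     [/\ forall i, P (y i), \sum_i w i = 1 & x = \sum_i w i *: y i]].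

Definition full_dimensional P : Prop := affine_hull P = setT.

Definition dilate (m : nat) P : set 'rV[R]_d := [set m%:R *: x | x in P].

Definition int_lattice : set 'rV[rat]_d :=
  range (fun v : 'rV[int]_d => map_mx intr v).

(** The dilation factor m ranges over the positive integers, which already
    determine F. *)
Definition is_ehrhart L P (F : {poly rat}) : Prop :=
  forall m : nat, (0 < m)%N ->
    exists2 N : nat, [set v | dilate m P (map_mx ratr v) /\ L v] #= `I_N &
                     F.[m%:R] = N%:R.

(** The polynomial of Ehrhart's theorem, which applies when P is a lattice
    polytope and L a lattice containing the integral one; 0 is a default. *)
Definition ehrhart L P : {poly rat} := xget 0 (is_ehrhart L P).

End Ehrhart.

Section HeckeAction.
Context {p : nat} (pp : prime p) {n : nat} {R : realType}.
Variable P : set 'rV[R]_(n + n).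
Local Notation Qp := (padic_num pp).

(** E(g . P); vectors are rows, and g . P depends only on the coset g Gamma_n. *)
Definition ehrhart_act (g : 'M[Qp]_(n + n)) : {poly rat} :=
  ehrhart (rat_lattice (row_lattice (invmx g))) P.

(** \sum_h E(h . (g . P)) for h in Gamma_n D_k Gamma_n / Gamma_n. *)
Definition hecke_ehrhart (k : 'I_n.+1) (g : 'M[Qp]_(n + n)) : {poly rat} :=
  \sum_(X \in hecke_cosets pp k) ehrhart_act (g *m coset_repr X).

(** The function E_{n,p,l,P} on G_n^+ / Gamma_n and its image under the Hecke
    operator of D_k; cosets are sets of matrices. *)
Definition ehrhart_coef (l : nat) (X : set 'M[Qp]_(n + n)) : R[i] :=
  ratr (ehrhart_act (coset_repr X))`_l.

Definition hecke_ehrhart_coef (k : 'I_n.+1) (l : nat)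
    (X : set 'M[Qp]_(n + n)) : R[i] :=
  ratr (hecke_ehrhart k (coset_repr X))`_l.

End HeckeAction.

Arguments ehrhart_act {p} pp {n R} P g.
Arguments hecke_ehrhart {p} pp {n R} P k g.
Arguments ehrhart_coef {p} pp {n R} P l X.
Arguments hecke_ehrhart_coef {p} pp {n R} P k l X.

Section Satake.
Context {p : nat} (pp : prime p) {n : nat} {K : fieldType}.
Local Notation Qp := (padic_num pp).

(** The pair (delta, (d_1, ..., d_n)) is read off from a block upper triangular
    representative of the right coset Y = Gamma_n M; it does not depend on the
    choice of that representative. *)
Definition satake_exponents (Y : set 'M[Qp]_(n + n))
    (e : int * ('I_n -> int)) : Prop :=
  exists B D : 'M[Qp]_n,
    [/\ forall i j : 'I_n, (j < i)%N -> D i j = 0,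
        forall i, D i i = p%:R ^ e.2 i &
        Y (block_mx (p%:R ^ e.1 *: invmx D^T) B 0 D)].

(** The monomial x_0 ^ delta * \prod_j (p ^ - j * x_j) ^ d_j at x = a; the
    indices j = 1, ..., n are shifted to 0, ..., n - 1. *)
Definition satake_term (a : 'I_n.+1 -> K) (Y : set 'M[Qp]_(n + n)) : K :=
  let e := xget (0, fun=> 0) (satake_exponents Y) in
  a ord0 ^ e.1 * \prod_(j < n) (p%:R ^- j.+1 * a (lift ord0 j)) ^ e.2 j.

(** The value at x = a of the Satake image of the double coset of g, as a sum
    over Gamma_n \ Gamma_n g Gamma_n. *)
Definition satake_value (g : 'M[Qp]_(n + n)) (a : 'I_n.+1 -> K) : K :=
  \sum_(Y \in [set rcoset M | M in dcoset g]) satake_term a Y.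

End Satake.

Arguments satake_value {p} pp {n K} g a.

(** (p^l, p, p^2, ..., p^(n-1), p^(n-l)), for n > 0. *)
Definition satake_param (K : fieldType) (p n l : nat) (i : 'I_n.+1) : K :=
  if i == 0%N :> nat then p%:R ^+ l
  else if i == n :> nat then p%:R ^ (n%:Z - l%:Z)
  else p%:R ^+ i.

(* Main.v *)
Require Import Defs.
From HB Require Import structures.
From mathcomp Require Import all_boot all_order all_algebra perm complex finmap.
From mathcomp Require Import boolp classical_sets functions cardinality fsbigop.
From mathcomp Require Import reals.
From mathcomp Require Import ring lra zify.

Set Implicit Arguments.
Unset Strict Implicit.
Unset Printing Implicit Defensive.

Import Order.TTheory GRing.Theory Num.Theory.
Local Open Scope classical_set_scope.
Local Open Scope ring_scope.

(** A left coset [h Gamma] of the double coset of [D_k] is determined by the row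
    lattice of [p ^ d.+1 h^-1], where [p ^ d.+1] is the similitude factor of
    [D_k], that is [p] for [k = 0] and [p ^ 2] for [k > 0]. This lattice contains
    [p ^ d.+1 Z_p^2n], hence is determined by its reduction modulo [p ^ d.+1],
    which is a Lagrangian: a submodule [L] of [(Z / p ^ d.+1)^2n] equal to its
    own orthogonal. The Lagrangians obtained are those of a type given by [k],
    the size of their intersection with the multiples of [p]; that there are no
    others is the Cartan decomposition [lagrangian_cartan], proved by splitting
    off hyperbolic planes.

    Ehrhart side. The value of [E (gh P)] at [m] counts the points [v] of [m P]
    such that [p ^ d.+1 v g] is integral with reduction in the Lagrangian of
    [h]. Exchanging the two sums, one has to count the Lagrangians of the given
    type that contain a given vector. By transitivity of the symplectic group on
    primitive vectors ([symplectic_transitive]), this number [depth_count]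
    depends only on the least [j] such that [p ^ j v g] is integral. The points
    with [j] at most [i] are counted by [E (g P)] at [p ^ i m], so the Hecke
    operator acts on Ehrhart polynomials by a combination of the rescalings
    [T |-> p ^ i T] of the argument, which multiply the [l]-th coefficient by
    [p ^ (i l)]. The eigenvalue is the sum over [j <= d.+1] of [depth_count k j]
    times [p ^ (j l) - p ^ ((j - 1) l)], without the subtracted term for [j = 0]
    ([hecke_ehrhart_coefE]).

    Satake side. Right cosets correspond to the same Lagrangians, now through the
    row lattice of [M] itself. At the given parameters all but the last diagonal
    exponent [t] of a triangular representative cancel, and the monomial is
    [p ^ (l (d.+1 - t))]. As [p ^ t] times the last unit vector generates the
    intersection of the lattice with the last coordinate line, the sum over the
    cosets counts Lagrangians by their intersection with that line. The unit
    vector being primitive, this is the same combination of the numbers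
    [depth_count] ([satake_valueE]). Triangular representatives exist by the
    Iwasawa decomposition [iwasawa].

    Polynomiality in [p]. Counting in two ways the pairs of a Lagrangian and a
    primitive vector in it, or a nonzero multiple of [p] in it, expresses the
    numbers of Lagrangians recursively as quotients of values at [p] of integer
    polynomials with monic denominators. A quotient that is an integer at every
    prime is a polynomial ([monic_quotient]).

    The Ehrhart polynomial exists for all the lattices that occur
    ([ehrhart_spec]). Every point of the cone over [P] has a lexicographically
    largest vector of nonnegative coefficients with respect to the vertices;
    being largest depends only on the support of the vector, so the integral
    parts of the coefficients can be counted by binomial coefficients, one for
    each of finitely many vectors of fractional parts. *)

(** * Lexicographically maximal coefficient vectors *)

Section LexicographicMaximum.
Context {R : realFieldType} {s e : nat} (V : 'M[R]_(s, e)).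
Implicit Types (u v k : 'rV[R]_s).

Definition lexpos k :=
  exists2 i : 'I_s, 0 < k 0 i & forall j : 'I_s, (j < i)%N -> k 0 j = 0.

Definition supp k : {set 'I_s} := [set i | k 0 i != 0]%SET.

Definition nonneg k := forall i, 0 <= k 0 i.

(** A vector [u >= 0] with support [S] is the lexicographically largest
    nonnegative solution [v] of [v *m V = u *m V] when no lexicographically
    positive relation can be added to it with a small positive factor. Only the
    coordinates outside [S] restrict such relations, so this is a condition on
    the support. *)
Definition lexmax_support (S : {set 'I_s}) :=
  forall k, k *m V = 0 -> (forall i, i \notin S -> 0 <= k 0 i) -> ~ lexpos k.

Lemma lexpos0 : ~ lexpos 0.
Proof. by case=> i; rewrite mxE ltxx. Qed.

Lemma lexpos_neq0 k : k != 0 -> lexpos k \/ lexpos (- k).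
Proof.
move=> k0; have [i0 ki0] : exists i, k 0 i != 0.
  apply: contrapT => kP; case/eqP: k0; apply/rowP => i; rewrite mxE.
  by apply: contrapT => ki; apply: kP; exists i; apply/eqP.
case: (@arg_minnP _ i0 (fun i => k 0 i != 0) val ki0) => i ki imin.
have kj (j : 'I_s) : (j < i)%N -> k 0 j = 0.
  by move=> ji; apply: contraTeq ji => /imin; rewrite -leqNgt.
case: (ltgtP (k 0 i) 0) ki => // ki _; [right|left]; exists i => //.
  by rewrite mxE oppr_gt0.
by move=> j /kj; rewrite mxE => ->; rewrite oppr0.
Qed.

Lemma lexposD u v : lexpos u -> lexpos v -> lexpos (u + v).
Proof.
move=> [i ui uj] [i' vi vj].
case: (ltngtP i i') => ii'.
- exists i; first by rewrite mxE (vj _ ii') addr0.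
  by move=> j ji; rewrite mxE (uj _ ji) vj ?addr0 // (ltn_trans ji).
- exists i'; first by rewrite mxE (uj _ ii') add0r.
  by move=> j ji; rewrite mxE (vj _ ji) uj ?addr0 // (ltn_trans ji).
- move/val_inj in ii'; subst i'; exists i; first by rewrite mxE addr_gt0.
  by move=> j ji; rewrite mxE uj ?vj ?addr0.
Qed.

Lemma lexposZ t u : 0 < t -> lexpos u -> lexpos (t *: u).
Proof.
move=> t0 [i ui uj]; exists i; first by rewrite mxE mulr_gt0.
by move=> j /uj; rewrite mxE => ->; rewrite mulr0.
Qed.

(** The difference of two solutions with lexicographically maximal support, or
    its opposite, would be a positive relation admissible for one of them. *)
Lemma lexmax_support_inj u v : nonneg u -> nonneg v ->
  lexmax_support (supp u) -> lexmax_support (supp v) ->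
  u *m V = v *m V -> u = v.
Proof.
move=> u0 v0 ug vg uv; apply/eqP; rewrite -subr_eq0; apply: contrapT => /negP.
have off w w' i : nonneg w -> i \notin supp w' -> 0 <= (w - w') 0 i.
  by rewrite inE negbK !mxE => w0 /eqP ->; rewrite subr0.
have ker w w' : w *m V = w' *m V -> (w - w') *m V = 0.
  by move=> ww'; rewrite mulmxBl ww' subrr.
case/lexpos_neq0; last rewrite opprB.
  by apply: vg; [exact: ker | move=> i; exact: off].
by apply: ug; [exact: ker | move=> i; exact: off].
Qed.

(** The largest step along [k] that keeps [u] nonnegative kills a coordinate
    of [u]. *)
Lemma ray_exit u k : nonneg u -> (exists i, k 0 i < 0) ->
  (forall i, u 0 i = 0 -> 0 <= k 0 i) ->
  exists t, [/\ 0 < t, nonneg (u + t *: k) &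
    exists2 i, u 0 i != 0 & (u + t *: k) 0 i = 0].
Proof.
move=> u0 [i0 ki0] uk.
have ui i : k 0 i < 0 -> 0 < u 0 i.
  move=> ki; rewrite lt_neqAle u0 andbT eq_sym; apply/negP => /eqP /uk.
  by rewrite leNgt ki.
pose r i := u 0 i / - k 0 i.
case: (@arg_minP _ _ _ i0 (fun i => k 0 i < 0) r ki0) => i ki imin.
have nk : 0 < - k 0 i by rewrite oppr_gt0.
exists (r i); split; first by rewrite divr_gt0 ?ui.
  move=> j; rewrite !mxE; have [kj|kj] := ltP (k 0 j) 0; last first.
    by apply: addr_ge0 => //; apply: mulr_ge0 => //; apply: divr_ge0 => //; apply: ltW.
  have := imin _ kj; rewrite /r ler_pdivlMr ?oppr_gt0 //.
  by rewrite mulrN lerNl -subr_ge0 opprK addrC.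
exists i; first by rewrite gt_eqF ?ui.
rewrite !mxE /r -[X in _ * X]opprK mulrN mulfVK ?subrr //.
by rewrite gt_eqF.
Qed.

(* The cone of the rows is pointed: the sets of nonnegative solutions are
   bounded. *)
Hypothesis V_pointed : forall k, k *m V = 0 -> k != 0 -> exists i, k 0 i < 0.

(** The vertices of the polytopes of nonnegative solutions. They are determined
    by their support, so that each polytope has finitely many of them. *)
Definition free_support u :=
  forall k, k *m V = 0 -> supp k \subset supp u -> k = 0.

Lemma free_support_inj u v : supp u = supp v -> free_support u ->
  u *m V = v *m V -> u = v.
Proof.
move=> uv ufree uVv; apply/eqP; rewrite -subr_eq0; apply/eqP/ufree.
  by rewrite mulmxBl uVv subrr.
apply/fintype.subsetP => i; rewrite !inE !mxE; apply: contraNN => /eqP ui.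
have : i \notin supp v by rewrite -uv inE ui eqxx.
by rewrite inE negbK ui => /eqP ->; rewrite subr0.
Qed.

(** Moving along a lexicographically positive relation inside the support until
    a coordinate vanishes leads to a vertex. *)
Lemma reduce_support u : nonneg u ->
  exists v, [/\ nonneg v, v *m V = u *m V, free_support v &
                v = u \/ lexpos (v - u)].
Proof.
have [m] := ubnP #|supp u|; elim: m u => // m IH u /ltnSE mu u0.
have [ufree|] := pselect (free_support u); first by exists u; split => //; left.
move=> /existsNP[k] /not_implyP[kV] /not_implyP[ku k0].
wlog : k kV ku k0 / lexpos k.
  move=> W; have [kp|kp] := lexpos_neq0 (introN eqP k0); first exact: (W k).
  apply: (W (- k)) => //; first by rewrite mulNmx kV oppr0.
    by apply/fintype.subsetP => i; rewrite inE mxE oppr_eq0 => ki; apply: (fintype.subsetP ku); rewrite inE.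
  by move/eqP; rewrite oppr_eq0 => /eqP.
move=> kp; have [t [t0 ut [i ui uti]]] : exists t, [/\ 0 < t, nonneg (u + t *: k) &
    exists2 i, u 0 i != 0 & (u + t *: k) 0 i = 0].
  apply: ray_exit => //; first by apply: V_pointed => //; apply/eqP.
  move=> i ui; have : i \notin supp k.
    by apply/negP => /(fintype.subsetP ku); rewrite inE ui eqxx.
  by rewrite inE negbK => /eqP ->.
have lt_supp : (#|supp (u + t *: k)| < m)%N.
  apply: leq_trans mu; apply: proper_card; rewrite properE; apply/andP; split.
    apply/fintype.subsetP => j; rewrite !inE !mxE; apply: contraNN => /eqP uj.
    have : j \notin supp k.
      by apply/negP => /(fintype.subsetP ku); rewrite inE uj eqxx.
    by rewrite inE negbK uj => /eqP ->; rewrite mulr0 addr0.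
  by apply/subsetPn; exists i; rewrite ?inE ?uti ?eqxx.
have [v [v0 vV vfree vu]] := IH _ lt_supp ut.
have ktp : lexpos (t *: k) by exact: lexposZ.
exists v; split => //.
  by rewrite vV mulmxDl -scalemxAl kV scaler0 addr0.
right; case: vu => [->|vu]; first by rewrite addrC addKr.
by have := lexposD vu ktp; congr lexpos; rewrite opprD addrA subrK.
Qed.

Lemma increase_lex u : nonneg u -> ~ lexmax_support (supp u) ->
  exists v, [/\ nonneg v, v *m V = u *m V & lexpos (v - u)].
Proof.
move=> u0 /existsNP[k] /not_implyP[kV] /not_implyP[ku] /contrapT kp.
have k0 : k != 0 by apply: contraPneq kp => ->; exact: lexpos0.
have [||t [t0 ut _]] := @ray_exit u k u0; first exact: V_pointed.
  by move=> i ui; apply: ku; rewrite inE ui eqxx.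
exists (u + t *: k); split => //.
  by rewrite mulmxDl -scalemxAl kV scaler0 addr0.
by rewrite addrC addKr; exact: lexposZ.
Qed.

Lemma finite_maximal (T : finType) (P : T -> Prop) (r : T -> T -> Prop) (x0 : T) :
  (forall x, ~ r x x) -> (forall x y z, r x y -> r y z -> r x z) ->
  P x0 -> exists2 x, P x & forall y, P y -> ~ r x y.
Proof.
move=> irr tr Px0.
pose f x := #|[pred y | `[< r y x >]]|.
have /asboolP Px0b := Px0.
case: (@arg_maxnP _ x0 (fun x => `[< P x >]) f Px0b) => x /asboolP Px xmax.
exists x => // y /asboolP Py rxy.
suff : (f x < f y)%N by have := xmax y Py; rewrite /= leqNgt => /negP.
apply: proper_card; rewrite properE; apply/andP; split.
  apply/fintype.subsetP => z; rewrite !inE => zx; exact: (tr z x y).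
apply/subsetPn; exists x; first by rewrite inE.
by rewrite inE; apply/negP => /asboolP; exact: irr.
Qed.

(** A vertex that is not maximal can be improved to a larger vertex, and there
    are finitely many vertices. *)
Lemma lexmax_support_exists u : nonneg u ->
  exists v, [/\ nonneg v, v *m V = u *m V & lexmax_support (supp v)].
Proof.
move=> u0; apply: contrapT => none.
pose feas v := [/\ nonneg v, v *m V = u *m V & free_support v].
have next v : feas v -> exists2 w, feas w & lexpos (w - v).
  move=> [v0 vV vf]; have [|w [w0 wV wv]] := @increase_lex v v0.
    by move=> vg; apply: none; exists v.
  have [x [x0 xV xf xw]] := reduce_support w0.
  exists x; first by split => //; rewrite xV wV.
  by case: xw => [->//|xw]; have := lexposD xw wv; congr lexpos; rewrite addrA subrK.
have [v0 feas0] : exists v, feas v.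
  by have [x [x0 xV xf _]] := reduce_support u0; exists x.
pose r (S T : {set 'I_s}) := exists v w,
  [/\ feas v, feas w, supp v = S, supp w = T & lexpos (w - v)].
have uniq v w : feas v -> feas w -> supp v = supp w -> v = w.
  move=> [_ vV vf] [_ wV _] vw; apply: free_support_inj => //.
  by rewrite vV wV.
have [|||S [v fv vS] Smax] := @finite_maximal _
  (fun S => exists2 v, feas v & supp v = S) r (supp v0).
- move=> S [v [w [fv fw <- ws vw]]].
  by move: vw; rewrite (uniq _ _ fw fv ws) subrr; exact: lexpos0.
- move=> S T U [v [w [fv fw vS wT vw]]] [v' [w' [fv' fw' v'T w'U vw']]].
  exists v, w'; split => //; have := lexposD vw' vw; congr lexpos.
  by rewrite (uniq _ _ fv' fw) ?v'T // addrA subrK.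
- by exists v0.
have [w fw vw] := next _ fv; apply: (Smax (supp w)); first by exists w.
by exists v, w.
Qed.

End LexicographicMaximum.

(** * Compositions *)

Section CountingTools.

Lemma card_set_finset (T : finType) (B : {set T}) :
  ([set x | x \in B] #= `I_#|B|)%card.
Proof.
have -> : [set x | x \in B] = [set` [fset x in enum B]%fset].
  by apply/seteqP; split => x /=; rewrite inE /= mem_enum.
apply/card_eq_fsetP; rewrite card_fseq undup_id ?enum_uniq //.
by rewrite cardE.
Qed.

Lemma ffact_poly (r n : nat) :
  ((n ^_ r)%:R : rat) = \prod_(i < r) (n%:R - i%:R).
Proof.
elim: r => [|r IH]; first by rewrite big_ord0 ffactn0.
rewrite big_ord_recr /= -IH ffactnSr natrM.
have [rn|nr] := leqP r n; first by rewrite natrB.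
by rewrite ffact_small // !mul0r.
Qed.

(** For [m < c <= m + r] both sides vanish, which is why the polynomial of the
    range [c <= m] is still correct there. *)
Lemma bin_poly (r c : nat) : exists F : {poly rat},
  forall m, (c <= m + r)%N -> F.[m%:R] = ('C(m + r - c, r))%:R.
Proof.
exists ((r`!%:R)^-1 *: \prod_(i < r) ('X + (r%:R - c%:R - i%:R)%:P)) => m cm.
rewrite hornerZ horner_prod -[RHS]mulr1.
have r0 : (r`!%:R : rat) != 0 by rewrite pnatr_eq0 -lt0n fact_gt0.
apply: (mulfI r0); rewrite mulrA divff // mul1r mulr1 -natrM mulnC bin_ffact.
rewrite ffact_poly; apply: eq_bigr => i _.
by rewrite hornerD hornerX hornerC natrB // natrD !addrA.
Qed.

(** Stars and bars, for functions with support in [S]. *)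
Lemma card_compositions (s m t : nat) (S : {set 'I_s}) :
  (0 < #|S|)%N -> (t <= m)%N ->
  #|[set a : {ffun 'I_s -> 'I_m.+1} |
       [forall (i | i \notin S), a i == ord0] && (\sum_i a i == t)%N]%SET|
    = 'C(t + #|S|.-1, #|S|.-1).
Proof.
move=> S0 tm; rewrite addnC -card_ord_partitions.
have sE : size (enum S) = #|S|.-1.+1 by rewrite -cardE prednK.
have [i0 i0S] : exists i, i \in S by apply/set0Pn; rewrite -card_gt0.
have tm1 (x : 'I_t.+1) : (x < m.+1)%N by rewrite ltnS (leq_trans _ tm) // -ltnS.
pose f (x : (#|S|.-1.+1).-tuple 'I_t.+1) : {ffun 'I_s -> 'I_m.+1} :=
  [ffun i => if i \in S then Ordinal (tm1 (nth ord0 x (index i (enum S)))) else ord0].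
have fS x (j : 'I_(#|S|.-1.+1)) : f x (nth i0 (enum S) j) = nth ord0 x j :> nat.
  rewrite ffunE -mem_enum mem_nth ?sE //=.
  by rewrite index_uniq ?sE // enum_uniq.
have f_inj : injective f.
  move=> x y xy; apply/val_inj/(@eq_from_nth _ ord0); first by rewrite !size_tuple.
  move=> j; rewrite size_tuple => jS; apply/val_inj.
  by rewrite /= -(fS x (Ordinal jS)) -(fS y (Ordinal jS)) xy.
have sumS (a : {ffun 'I_s -> 'I_m.+1}) : [forall (i | i \notin S), a i == ord0] ->
    (\sum_i a i = \sum_(j < #|S|.-1.+1) a (nth i0 (enum S) j))%N.
  move=> /forall_inP aS; rewrite (bigID (mem S)) /= [X in (_ + X)%N]big1 ?addn0.
    by rewrite -big_enum (big_nth i0) big_mkord sE.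
  by move=> i /aS /eqP ->.
rewrite -(card_imset _ f_inj); apply: eq_card => a; rewrite inE.
apply/andP/imsetP => [[aS /eqP at_]|[x + ->]]; last first.
  rewrite inE => /eqP xt.
  have fS0 : [forall (i | i \notin S), f x i == ord0].
    by apply/forall_inP => i iS; rewrite ffunE (negPf iS).
  split => //; rewrite sumS //; apply/eqP; rewrite -xt big_tuple.
  by apply: eq_bigr => j _; rewrite fS (tnth_nth ord0).
have ai i : (a i < t.+1)%N by rewrite ltnS -at_ (bigD1 i) //= leq_addr.
pose x := [tuple Ordinal (ai (nth i0 (enum S) j)) | j < #|S|.-1.+1].
exists x.
  rewrite inE big_tuple; apply/eqP; rewrite -[RHS]at_ sumS //.
  apply: eq_bigr => j _.
  by rewrite tnth_mktuple.
apply/ffunP => i; apply: val_inj; rewrite ffunE; case: ifPn => [iS|iS]; last first.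
  by have /forall_inP /(_ i iS) /eqP -> := aS.
have iN : (index i (enum S) < #|S|.-1.+1)%N by rewrite -sE index_mem mem_enum.
have xi : nth ord0 x (index i (enum S)) = tnth x (Ordinal iN) by rewrite (tnth_nth ord0).
by rewrite xi tnth_mktuple /= nth_index // mem_enum.
Qed.

End CountingTools.

(** * Ehrhart polynomials *)

Section Ehrhart.
Context {R : realType} {d : nat}.

Lemma map_ratr_int (w : 'rV[int]_d) :
  map_mx (ratr : rat -> R) (map_mx intr w) = map_mx intr w.
Proof. by apply/rowP => i; rewrite !mxE ratr_int. Qed.

Lemma map_ratr_inj : injective (map_mx (ratr : rat -> R) : 'rV[rat]_d -> 'rV[R]_d).
Proof.
by move=> x y /rowP xy; apply/rowP => i; have := xy i; rewrite !mxE => /fmorph_inj.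
Qed.

Section Polytope.
Variables (s : nat) (v : 'I_s -> 'rV[int]_d).

Definition vertex_mx : 'M[R]_(s, d) := \matrix_i map_mx intr (v i).

(** Lifting the vertices to height 1 turns convex combinations into the
    nonnegative ones of the rows of this matrix. *)
Definition cone_mx : 'M[R]_(s, d + 1) := row_mx vertex_mx (const_mx 1).

Lemma cone_mxE (k k' : 'rV[R]_s) : k *m cone_mx = k' *m cone_mx <->
  k *m vertex_mx = k' *m vertex_mx /\ \sum_i k 0 i = \sum_i k' 0 i.
Proof.
have sumE (k0 : 'rV[R]_s) : (k0 *m (const_mx 1 : 'M_(s, 1))) = (\sum_i k0 0 i)%:M.
  apply/matrixP => i j; rewrite !ord1 !mxE mulr1n.
  by apply: eq_bigr => l _; rewrite mxE mulr1.
rewrite !mul_mx_row !sumE; split => [/eq_row_mx[-> /matrixP /(_ 0 0)]|[-> ->] //].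
by rewrite !mxE !mulr1n.
Qed.

Lemma cone_mx_pointed (k : 'rV[R]_s) : k *m cone_mx = 0 -> k != 0 -> exists i, k 0 i < 0.
Proof.
move=> kV; apply: contra_neqP => /forallNP k0.
have {}k0 i : 0 <= k 0 i by rewrite leNgt; apply/negP/k0.
have /cone_mxE[_] : k *m cone_mx = 0 *m cone_mx by rewrite mul0mx.
under [RHS]eq_bigr do rewrite mxE.
rewrite big1_eq => ks.
by apply/rowP => i; rewrite mxE; apply: (psumr_eq0P _ ks).
Qed.

Lemma mul_vertex_mx (k : 'rV[R]_s) : k *m vertex_mx = \sum_i k 0 i *: map_mx intr (v i).
Proof.
by rewrite mulmx_sum_row; apply: eq_bigr => i _; rewrite rowK.
Qed.

Variables (L : set 'rV[rat]_d) (N : nat).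
Hypothesis N_gt0 : (0 < N)%N.
Hypothesis L_transl : forall x w, L x -> L (x + map_mx intr w).
Hypothesis L_denom : forall x, L x -> forall i, N%:R * x 0 i \is a Num.int.

(** The fractional parts, in ]0, 1] on the support, of the coefficients of the
    points of the cone. *)
Definition fractional_parts : set 'rV[R]_s :=
  [set th : 'rV[R]_s | [/\ forall i, 0 <= th 0 i <= 1, lexmax_support cone_mx (supp th),
     exists2 x, L x & map_mx ratr x = th *m vertex_mx &
     exists j : nat, \sum_i th 0 i = j%:R]].

(** Coefficient vectors with maximal support are determined by the point that
    they represent, and these points have bounded coordinates and bounded
    denominators. *)
Lemma finite_fractional_parts : finite_set fractional_parts.
Proof.
(* A bound for the coordinates multiplied by [N], all coefficients being at
   most 1. *)
pose B := (N * \sum_k \sum_i `|v k ord0 i|%N)%N.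
pose f (aj : {ffun 'I_d -> 'I_(2 * B).+1} * 'I_s.+1) : 'rV[R]_(d + 1) :=
  row_mx (\row_i (((aj.1 i)%:R - B%:R) / N%:R)) (aj.2 : nat)%:R%:M.
have fin : finite_set (range f) by apply: finite_image; exact: finite_finset.
have inj : {in fractional_parts &, injective (mulmx^~ cone_mx)}.
  move=> x y /set_mem[x01 xS _ _] /set_mem[y01 yS _ _].
  by apply: lexmax_support_inj => // i; [case/andP: (x01 i)|case/andP: (y01 i)].
rewrite -(eq_finite_set (inj_card_eq inj)); apply: sub_finite_set fin.
move=> _ [th thP <-].
have [th01 _ [x Lx xE] [j jE]] := thP.
have N0 : (N%:R : R) != 0 by rewrite pnatr_eq0 -lt0n.
have js : (j < s.+1)%N.
  rewrite ltnS -(ler_nat R) -jE.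
  rewrite -[X in _ <= X%:R](card_ord s) -sum1_card natr_sum; apply: ler_sum => i _.
  by case/andP: (th01 i).
have zP i : exists2 z : int, N%:R * x 0 i = z%:~R & (`|z| <= B%:Z)%R.
  have /intrP[z zE] := L_denom Lx i; exists z => //.
  rewrite -(ler_int R) intr_norm -(ratr_int R z) -zE rmorphM /= ratr_nat.
  have -> : ratr (x 0 i) = \sum_k th 0 k * (v k 0 i)%:~R :> R.
    have /rowP/(_ i) := xE; rewrite mxE => ->; rewrite mul_vertex_mx summxE.
    by apply: eq_bigr => k _; rewrite !mxE.
  rewrite normrM normr_nat /B PoszM intrM ler_pM2l ?ltr0n //.
  apply: le_trans (ler_norm_sum _ _ _) _.
  rewrite -[X in _ <= X]/((\sum_k \sum_i0 `|v k ord0 i0|)%N%:R) natr_sum.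
  apply: ler_sum => k _; rewrite (bigD1 i) //= natrD -[leLHS]addr0 lerD //.
  rewrite normrM -intr_norm -abszE; case/andP: (th01 k) => th0 th1.
  by rewrite ger0_norm // ler_piMl.
have [z zP2] := choice (fun i => let: ex_intro2 z a b := zP i in ex_intro _ z (conj a b)).
have zb i : (`|(z i + B%:Z)%R|%N < (2 * B).+1)%N by have [_] := zP2 i; lia.
exists ([ffun i => Ordinal (zb i)], Ordinal js) => //.
rewrite /f /cone_mx mul_mx_row -xE; congr row_mx.
  apply/rowP => i; rewrite !mxE ffunE /=.
  have [zE zB] := zP2 i.
  have -> : (`|(z i + B%:Z)%R|%N%:R : R) = (z i)%:~R + B%:R.
    rewrite -[LHS]/((`|(z i + B%:Z)%R|%N%:Z)%:~R) gez0_abs ?intrD //; lia.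
  rewrite addrK -(ratr_int R) -zE rmorphM /= ratr_nat mulrAC divff // mul1r //.
apply/matrixP => a b; rewrite !ord1 !mxE mulr1n -jE.
by apply: eq_bigr => l _; rewrite mxE mulr1.
Qed.

(** The remainder of a positive number is taken in ]0, 1], so that subtracting
    integral parts does not change supports. *)
Lemma floor_part (y : R) : 0 <= y ->
  exists a : nat, [/\ 0 <= y - a%:R <= 1, (y - a%:R == 0) = (y == 0) & a%:R <= y].
Proof.
move=> y0; have [->|yn0] := eqVneq y 0; first by exists 0%N; rewrite subr0 lexx ler01 eqxx.
have yp : 0 < y by rewrite lt_neqAle eq_sym yn0.
have [a1 a2] := andP (Num.Theory.ceil_itv y).
exists `|Num.ceil y - 1|%N.
have cp : (0 <= Num.ceil y - 1)%R by rewrite subr_ge0 -gtz0_ge1 ceil_gt0.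
have -> : (`|Num.ceil y - 1|%N%:R : R) = (Num.ceil y - 1)%:~R.
  by rewrite -[LHS]/((`|Num.ceil y - 1|%N%:Z)%:~R) gez0_abs.
by rewrite intrB in a1 *; split; lra.
Qed.

Lemma fractional_parts_uniq (y y' : R) (a a' : nat) :
  0 <= y <= 1 -> 0 <= y' <= 1 -> (y == 0) = (y' == 0) ->
  (y = 0 -> a = 0%N) -> (y' = 0 -> a' = 0%N) -> y + a%:R = y' + a'%:R -> a = a'.
Proof.
move=> y01 y01' yy ya ya' e.
have [y0|y0] := eqVneq y 0.
  by rewrite ya // ya' //; apply/eqP; rewrite -yy y0.
have y0' : y' != 0 by rewrite -yy.
have yp : 0 < y by rewrite lt_neqAle eq_sym y0; case/andP: y01.
have yp' : 0 < y' by rewrite lt_neqAle eq_sym y0'; case/andP: y01'.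
have [aa|aa|//] := ltngtP a a'.
  by have : (a.+1%:R : R) <= a'%:R; [rewrite ler_nat | rewrite -natr1; move=> ?; exfalso; lra].
by have : (a'.+1%:R : R) <= a%:R; [rewrite ler_nat | rewrite -natr1; move=> ?; exfalso; lra].
Qed.

Definition polytope : set 'rV[R]_d :=
  [set x | exists w : 'I_s -> R, [/\ forall i, 0 <= w i, \sum_i w i = 1 &
               x = \sum_i w i *: map_mx intr (v i)]].

Lemma dilate_polytopeP m x : (0 < m)%N ->
  dilate m polytope x <->
  exists k : 'rV[R]_s, [/\ nonneg k, \sum_i k 0 i = m%:R & x = k *m vertex_mx].
Proof.
move=> m0; have mR : (m%:R : R) != 0 by rewrite pnatr_eq0 -lt0n.
split=> [[_ [w [w0 w1 ->]] <-]|[k [k0 km ->]]].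
  exists (\row_i (m%:R * w i)); split.
  - by move=> i; rewrite mxE mulr_ge0.
  - by under eq_bigr do rewrite mxE; rewrite -mulr_sumr w1 mulr1.
  - rewrite mul_vertex_mx scaler_sumr; apply: eq_bigr => i _.
    by rewrite mxE scalerA.
exists (\sum_i (k 0 i / m%:R) *: map_mx intr (v i)).
  exists (fun i => k 0 i / m%:R); split => //.
  - by move=> i; rewrite divr_ge0.
  - by rewrite -mulr_suml km divff.
rewrite mul_vertex_mx scaler_sumr; apply: eq_bigr => i _.
by rewrite scalerA mulrC mulfVK.
Qed.

Lemma supp_fractional (th : 'rV[R]_s) (a : 'I_s -> nat) :
  (forall i, 0 <= th 0 i) -> (forall i, i \notin supp th -> a i = 0%N) ->
  supp (th + \row_i (a i)%:R) = supp th.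
Proof.
move=> th0 ath; apply/setP => i; rewrite !inE !mxE.
have [thi|thi] := eqVneq (th 0 i) 0.
  by rewrite ath ?inE ?thi ?eqxx // addr0 eqxx.
by rewrite gt_eqF // ltr_wpDr // lt_neqAle eq_sym thi th0.
Qed.

(** The lexicographically largest coefficient vector of a point of [m P] in [L]
    is the sum of a vector [t] of fractional parts and of a vector of natural
    numbers with support in that of [t] and with a prescribed sum. Conversely,
    all such sums are largest. For each [t] they are counted by stars and
    bars. *)
Lemma ehrhart_polytope : exists F, is_ehrhart L polytope F.
Proof.
pose T : finType := fset_set fractional_parts.
have TP (t : T) : fractional_parts (val t).
  by have := valP t; rewrite in_fset_set ?inE //; exact: finite_fractional_parts.
have /choice[X XP] (t : T) : exists x, L x /\ map_mx ratr x = val t *m vertex_mx.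
  by have [_ _ [x Lx xE] _] := TP t; exists x.
have /choice[j jP] (t : T) : exists j : nat, \sum_i val t 0 i = j%:R.
  by have [_ _ _ ?] := TP t.
have /choice[F FP] (t : T) : exists F : {poly rat}, forall m, (0 < m)%N ->
    F.[m%:R] = #|[set a : {ffun 'I_s -> 'I_m.+1} |
       [forall (i | i \notin supp (val t)), a i == ord0]
         && (\sum_i a i + j t == m)%N]%SET|%:R.
  have [th01 _ _ _] := TP t.
  have js : (j t <= #|supp (val t)|)%N.
    rewrite -(ler_nat R) -jP (bigID (mem (supp (val t)))) /= [X in _ + X]big1 ?addr0.
      by rewrite -sum1_card natr_sum; apply: ler_sum => i _; case/andP: (th01 i).
    by move=> i; rewrite inE negbK => /eqP.
  have [S0|Sp] := posnP #|supp (val t)|.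
    exists 0 => m m0; rewrite horner0; apply/esym/eqP.
    rewrite pnatr_eq0 cards_eq0; apply/eqP/setP => a; rewrite !inE.
    apply/negP => /andP[/forall_inP aS]; rewrite big1 => [|i _].
      by rewrite add0n; move: js; rewrite S0 leqn0 => /eqP ->; rewrite eq_sym -leqn0 leqNgt m0.
    have /eqP -> // : a i == ord0 by apply: aS; rewrite (cards0_eq S0) inE.
  have [F FE] := bin_poly #|supp (val t)|.-1 (j t); exists F => m m0.
  rewrite FE; last by lia.
  have [jm|mj] := leqP (j t) m.
    rewrite -addnBAC // -(@card_compositions s m (m - j t)) ?leq_subr //.
    congr (_%:R); apply: eq_card => a; rewrite !inE; congr andb.
    by rewrite -(eqn_add2r (j t)) subnK.
  rewrite bin_small; last by lia.
  congr (_%:R); apply/esym/eqP; rewrite cards_eq0; apply/eqP/setP => a; rewrite !inE.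
  by apply/negP => /andP[_ /eqP]; lia.
exists (\sum_(t : T) F t) => m m0.
pose B := [set ta : T * {ffun 'I_s -> 'I_m.+1} |
    [forall (i | i \notin supp (val ta.1)), ta.2 i == ord0]
         && (\sum_i ta.2 i + j ta.1 == m)%N]%SET.
exists #|B|; last first.
  rewrite -sum1_card (reindex_onto (fun ta => (ta.1, ta.2)) id) /=; last by case.
  rewrite horner_sum natr_sum (eq_bigl (fun ta => (ta.1, ta.2) \in B)); last first.
    by move=> [t a]; rewrite eqxx andbT.
  under [RHS]eq_bigl do rewrite inE /=.
  rewrite -(pair_big_dep xpredT (fun t (a : {ffun 'I_s -> 'I_m.+1}) =>
    [forall (i | i \notin supp (val t)), a i == ord0] && (\sum_i a i + j t == m)%N)
    (fun _ _ => 1%:R)) /=.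
  apply: eq_bigr => t _; rewrite FP // -natr_sum sum1_card; congr (_%:R).
  by apply: eq_card => a; rewrite inE.
pose f (ta : T * {ffun 'I_s -> 'I_m.+1}) : 'rV[rat]_d :=
  X ta.1 + map_mx intr (\sum_i (ta.2 i)%:R *: v i).
pose lam (ta : T * {ffun 'I_s -> 'I_m.+1}) : 'rV[R]_s :=
  val ta.1 + \row_i (ta.2 i : nat)%:R.
have fE ta : map_mx ratr (f ta) = lam ta *m vertex_mx.
  rewrite /f /lam map_mxD map_ratr_int mulmxDl; have [_ ->] := XP ta.1.
  congr (_ + _); rewrite mul_vertex_mx raddf_sum; apply: eq_bigr => i _.
  by apply/rowP => l; rewrite !mxE /= intrM natz.
have BP ta : ta \in B -> [/\ nonneg (lam ta), supp (lam ta) = supp (val ta.1),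
    \sum_i lam ta 0 i = m%:R & forall i, val ta.1 0 i = 0 -> ta.2 i = 0%N :> nat].
  rewrite inE => /andP[/forall_inP aS /eqP am].
  have a0 i : i \notin supp (val ta.1) -> ta.2 i = 0%N :> nat by move=> /aS /eqP ->.
  have [th01 _ _ _] := TP ta.1.
  split.
  - by move=> i; rewrite !mxE addr_ge0 //; case/andP: (th01 i).
  - by rewrite supp_fractional // => i; case/andP: (th01 i).
  - under eq_bigr do rewrite !mxE.
    by rewrite big_split /= jP -natr_sum -natrD addnC am.
  - by move=> i thi; apply: a0; rewrite inE thi eqxx.
have f_inj : {in [set ta | ta \in B] &, injective f}.
  move=> ta tb /set_mem /= taB /set_mem /= tbB fab.
  have [la0 sa suma a0] := BP _ taB; have [lb0 sb sumb b0] := BP _ tbB.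
  have [tha01 ga _ _] := TP ta.1; have [thb01 gb _ _] := TP tb.1.
  have lab : lam ta = lam tb.
    apply: (@lexmax_support_inj _ _ _ cone_mx) => //; rewrite ?sa ?sb //.
    by apply/cone_mxE; rewrite -!fE fab suma sumb.
  have sab : supp (val ta.1) = supp (val tb.1) by rewrite -sa -sb lab.
  have ab : ta.2 = tb.2.
    apply/ffunP => i; apply: val_inj => /=.
    have /rowP/(_ i) := lab; rewrite !mxE.
    apply: fractional_parts_uniq => //; [|exact: a0|exact: b0].
    by have /setP/(_ i) := sab; rewrite !inE => /negb_inj.
  have tt : ta.1 = tb.1.
    by apply: val_inj; move: lab; rewrite /lam ab => /addIr.
  by case: ta tb ab tt {taB tbB fab la0 sa suma a0 lb0 sb sumb b0 tha01 ga thb01 gb lab sab} => ? ? [? ?] /= -> ->.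
have -> : [set y | dilate m polytope (map_mx ratr y) /\ L y] = f @` [set ta | ta \in B].
  apply/seteqP; split => [y [/dilate_polytopeP[//|k [k0 km yE]] Ly]|_ [ta /= taB <-]].
    have [k' [k'0 kV k'S]] := lexmax_support_exists cone_mx_pointed k0.
    have /cone_mxE[kV1 kV2] := kV; rewrite -kV1 in yE.
    have /choice[a aP] := fun i => floor_part (k'0 i).
    pose th : 'rV[R]_s := \row_i (k' 0 i - (a i)%:R).
    have sth : supp th = supp k'.
      by apply/setP => i; rewrite !inE mxE; have [_ -> _] := aP i.
    have athE : k' = th + \row_i (a i)%:R by apply/rowP => i; rewrite !mxE subrK.
    have am i : (a i < m.+1)%N.
      rewrite ltnS -(ler_nat R) -km -kV2.
      have [_ _ /le_trans] := aP i; apply.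
      by rewrite (bigD1 i) //= ler_wpDr ?sumr_ge0.
    have suma : \sum_i th 0 i + (\sum_i a i)%N%:R = m%:R.
      rewrite natr_sum -big_split /= -km -kV2; apply: eq_bigr => i _.
      by rewrite mxE subrK.
    have thP : fractional_parts th.
      split.
      - by move=> i; rewrite mxE; have [] := aP i.
      - by rewrite sth.
      - exists (y + map_mx intr (- \sum_i (a i)%:R *: v i)); first exact: L_transl.
        rewrite map_mxD map_ratr_int yE {1}athE mulmxDl -addrA -[RHS]addr0.
        congr (_ + _); rewrite raddfN /= raddf_sum mul_vertex_mx.
        apply/eqP; rewrite subr_eq0; apply/eqP/eq_bigr => i _.
        by apply/rowP => l; rewrite !mxE /= intrM natz.
      - exists (m - \sum_i a i)%N; rewrite natrB; first by rewrite -suma addrK.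
        rewrite -(ler_nat R) -suma lerDr sumr_ge0 // => i _; rewrite mxE.
        by have [/andP[]] := aP i.
    have tT : th \in fset_set fractional_parts.
      by rewrite in_fset_set ?inE //; exact: finite_fractional_parts.
    pose ta : T * {ffun 'I_s -> 'I_m.+1} :=
      ([` tT]%fset, [ffun i => Ordinal (am i)]).
    have lamE : lam ta = k'.
      by apply/rowP => i; rewrite /lam !mxE ffunE /= subrK.
    exists ta.
      rewrite /= inE; apply/andP; split.
        apply/forall_inP => i; rewrite inE negbK /= => /eqP thi.
        rewrite ffunE; apply/eqP/val_inj => /=.
        have [_ + a2] := aP i; rewrite mxE in thi; rewrite thi eqxx.
        move=> /esym/eqP k'i; move: a2; rewrite k'i lern0 => /eqP //.
      rewrite -(eqr_nat R) natrD -jP /= addrC; apply/eqP; rewrite -[RHS]suma.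
      by congr (_ + _%:R); apply: eq_bigr => i _; rewrite ffunE.
    by apply: map_ratr_inj; rewrite fE lamE yE.
  have [la0 sa suma a0] := BP _ taB; split; last exact/L_transl/(XP ta.1).1.
  by apply/dilate_polytopeP => //; exists (lam ta); rewrite -fE.
apply: card_eq_trans (card_set_finset B).
exact: inj_card_eq.
Qed.

End Polytope.

Theorem ehrhart_spec (P : set 'rV[R]_d) (L : set 'rV[rat]_d) (N : nat) :
  lattice_polytope P -> (0 < N)%N ->
  (forall x w, L x -> L (x + map_mx intr w)) ->
  (forall x, L x -> forall i, N%:R * x 0 i \is a Num.int) ->
  is_ehrhart L P (ehrhart L P).
Proof.
move=> [s [v ->]] N0 L1 L2; rewrite /ehrhart.
have [F FP] := ehrhart_polytope v N0 L1 L2.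
exact: (@xgetPex _ 0 (is_ehrhart L (polytope v)) (ex_intro _ F FP)).
Qed.

End Ehrhart.

(** * Arithmetic of p-adic integers and numbers *)

Section PadicIntegers.
Context {p : nat} {pp : prime p}.
Local Notation Zp := (padic_int pp).
Local Notation q k := ((p ^ k)%N%:Z).

Lemma padic_valD (x y : Zp) k :
  padic_val (x + y) k = ((padic_val x k + padic_val y k) %% q k)%Z.
Proof. by []. Qed.

Lemma padic_valM (x y : Zp) k :
  padic_val (x * y) k = ((padic_val x k * padic_val y k) %% q k)%Z.
Proof. by []. Qed.

Lemma padic_val0 k : padic_val (0 : Zp) k = 0.
Proof. exact: mod0z. Qed.

Lemma padic_val_nat n k : padic_val (n%:R : Zp) k = (n%:Z %% q k)%Z.
Proof.
elim: n => [|n IH]; first by rewrite padic_val0 mod0z.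
rewrite -natr1 padic_valD IH -addn1 PoszD.
have -> : padic_val (1 : Zp) k = (1 %% q k)%Z by [].
by rewrite modzDm.
Qed.

Lemma padic_val_int (a : int) k : padic_val (a%:~R : Zp) k = (a %% q k)%Z.
Proof.
case: a => n; first exact: padic_val_nat.
rewrite NegzE rmorphN /= -[LHS]/((- padic_val (n.+1%:R : Zp) k %% q k)%Z).
by rewrite padic_val_nat modzNm.
Qed.

Lemma pexp_neq0 k : q k != 0.
Proof. by rewrite gt_eqF // ltz_nat expn_gt0 (prime_gt0 pp). Qed.

Lemma padic_val_ge0 (x : Zp) k : 0 <= padic_val x k.
Proof. by rewrite -padic_red modz_ge0 // pexp_neq0. Qed.

Lemma padic_val_lt (x : Zp) k : padic_val x k < q k.
Proof. by rewrite -padic_red ltz_pmod // ltz_nat expn_gt0 (prime_gt0 pp). Qed.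

Lemma padic_val_cong (x : Zp) k m :
  (padic_val x (k + m) %% q k)%Z = padic_val x k.
Proof. by rewrite padic_coh_le padic_red. Qed.

(** The quotients by [p ^ k] of the residues modulo [p ^ (k + j)] form a coherent
    sequence in [j]. *)
Lemma padic_dvdP (x : Zp) k : padic_val x k = 0 <-> exists y, x = p%:R ^+ k * y.
Proof.
rewrite -natrX; split=> [xk|[y ->]]; last first.
  by rewrite padic_valM padic_val_nat modzMml modzMr.
have div j : (q k %| padic_val x (k + j))%Z.
  by apply/dvdz_mod0P; rewrite padic_val_cong.
pose y j := (padic_val x (k + j) %/ q k)%Z.
have yE j : y j * q k = padic_val x (k + j) by apply: divzK.
have ycoh j : (y j = y j.+1 %[mod q j])%Z.
  apply/eqP; rewrite eqz_mod_dvd -(@dvdz_mul2r (q k)) ?pexp_neq0 //.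
  rewrite mulrBl !yE -PoszM -expnD [(j + k)%N]addnC -eqz_mod_dvd; apply/eqP.
  by rewrite -[in RHS](addn1 j) addnA padic_coh_le.
exists (padic_mk ycoh); apply: padic_ext => j.
rewrite padic_valM padic_val_nat /= modzMm mulrC yE.
by rewrite addnC padic_val_cong.
Qed.

(** Inverses modulo [p ^ k] obtained from Bezout relations are unique modulo
    [p ^ k], hence form a coherent sequence. *)
Lemma padic_unit_or_dvd (x : Zp) : x \is a GRing.unit \/ exists y, x = p%:R * y.
Proof.
have [x1|x1] := eqVneq (padic_val x 1) 0; first by right; apply/(padic_dvdP x 1).
left.
have cop k : coprimez (padic_val x k) (q k).
  case: k => [|k]; first by rewrite expn0 coprimezE coprimen1.
  rewrite coprimezE /= coprime_pexpr // coprime_sym prime_coprime //.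
  apply: contra x1 => px; apply/eqP.
  rewrite -(padic_val_cong x 1 k) expn1 add1n; apply/dvdz_mod0P.
  by rewrite dvdzE.
pose y k := (egcdz (padic_val x k) (q k)).1.
have yE k : (q k %| y k * padic_val x k - 1)%Z.
  rewrite /y; case: egcdzP => u v + _ /=.
  rewrite (eqP (cop k)) => /(canRL (addrK _)) ->.
  by rewrite addrAC subrr add0r rpredN dvdz_mull.
have ycoh k : (y k = y k.+1 %[mod q k])%Z.
  have yS : (q k %| y k.+1 * padic_val x k - 1)%Z.
    rewrite -eqz_mod_dvd padic_coh modzMmr eqz_mod_dvd.
    by apply: dvdz_trans (yE k.+1); rewrite dvdzE /= dvdn_exp2l.
  apply/eqP; rewrite eqz_mod_dvd -(@Gauss_dvdzl _ _ (padic_val x k)); last first.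
    by rewrite coprimez_sym.
  by have := rpredB (yE k) yS; rewrite opprB addrA subrK mulrBl.
apply/asboolP; exists (padic_mk ycoh); apply: padic_ext => k.
rewrite padic_valM /= modzMml; apply/eqP; rewrite eqz_mod_dvd; exact: yE.
Qed.

Lemma padic_natr_eq0 n : ((n%:R : Zp) == 0) = (n == 0)%N.
Proof.
apply/eqP/eqP => [n0|->//].
have nq : (n < p ^ n)%N by exact/ltn_expl/prime_gt1.
have := padic_val_nat n n; rewrite n0 padic_val0 modz_small; first by case.
by rewrite lez_nat ltz_nat nq.
Qed.

Lemma padic_p_neq0 : (p%:R : Zp) != 0.
Proof. by rewrite padic_natr_eq0 -lt0n prime_gt0. Qed.

Lemma padic_p_Nunit (y : Zp) : p%:R * y \isn't a GRing.unit.
Proof.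
apply/negP => /unitrP[z [_ yz]].
have /(padic_dvdP _ 1) : exists w : Zp, 1 = p%:R ^+ 1 * w.
  by exists (y * z); rewrite expr1 mulrA.
have -> : padic_val (1 : Zp) 1 = (1 %% q 1)%Z by [].
by rewrite modz_small // ltz_nat expn1 prime_gt1.
Qed.

Lemma padic_valuation (x : Zp) : x != 0 ->
  exists j u, u \is a GRing.unit /\ x = p%:R ^+ j * u.
Proof.
move=> x0; have [k xk] : exists k, padic_val x k != 0.
  apply: contrapT => nk; case/eqP: x0; apply: padic_ext => k.
  by rewrite padic_val0; apply: contrapT => xk; apply: nk; exists k; apply/eqP.
elim: k x xk {x0} => [|k IH] x xk.
  by move: xk; rewrite -padic_red expn0 modz1.
have [xu|[y xy]] := padic_unit_or_dvd x.
  by exists 0%N, x; rewrite expr0 mul1r.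
have [|j [u [uu yE]]] := IH y; last first.
  by exists j.+1, u; rewrite xy yE exprS mulrA.
apply: contraNneq xk => yk.
have /padic_dvdP[z yz] := yk.
by apply/eqP/padic_dvdP; exists z; rewrite xy yz mulrA -exprS.
Qed.

Lemma intr_Zp_mod (N : nat) (a : int) : (1 < N)%N ->
  (a %% N%:Z)%Z%:~R = a%:~R :> 'Z_N.
Proof.
move=> N1; rewrite /modz intrB intrM.
by rewrite -[(N%:Z)%:~R]/(N%:R) pchar_Zp // mulr0 subr0.
Qed.

Lemma pexp_gt1 d : (1 < p ^ d.+1)%N.
Proof. by rewrite -{1}(expn0 p) ltn_exp2l ?prime_gt1. Qed.

(** The exponent [d.+1] makes the modulus larger than 1, as is required of
    ['Z_q]. *)
Definition red d (x : Zp) : 'Z_(p ^ d.+1) := (padic_val x d.+1)%:~R.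

Lemma red_is_zmod_morphism d : zmod_morphism (red d).
Proof.
move=> x y; rewrite /red -intrB.
have -> : padic_val (x - y) d.+1 =
    ((padic_val x d.+1 + ((- padic_val y d.+1) %% q d.+1)%Z) %% q d.+1)%Z by [].
by rewrite modzDmr intr_Zp_mod // pexp_gt1.
Qed.

Lemma red_is_monoid_morphism d : monoid_morphism (red d).
Proof.
split=> [|x y]; rewrite /red.
  have -> : padic_val (1 : Zp) d.+1 = (1 %% q d.+1)%Z by [].
  by rewrite intr_Zp_mod ?pexp_gt1.
by rewrite padic_valM intr_Zp_mod ?pexp_gt1 // intrM.
Qed.

HB.instance Definition _ d :=
  GRing.isZmodMorphism.Build Zp 'Z_(p ^ d.+1) (red d) (red_is_zmod_morphism d).
HB.instance Definition _ d :=
  GRing.isMonoidMorphism.Build Zp 'Z_(p ^ d.+1) (red d) (red_is_monoid_morphism d).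

Lemma red_eq0 d (x : Zp) : red d x = 0 <-> exists y, x = p%:R ^+ d.+1 * y.
Proof.
rewrite -padic_dvdP /red; split=> [|->//].
have := padic_val_ge0 x d.+1; have := padic_val_lt x d.+1.
case: (padic_val x d.+1) => // n; rewrite ltz_nat => nq _.
move/(congr1 val); rewrite /= -[_%:~R]/(n%:R) => n0.
by rewrite -(modn_small nq) -(val_Zp_nat (pexp_gt1 d)) n0.
Qed.

Lemma red_surj d (v : 'Z_(p ^ d.+1)) : exists x, red d x = v.
Proof. by exists (v : nat)%:R; rewrite rmorph_nat natr_Zp. Qed.

End PadicIntegers.

Section RatInField.
Context {F : fieldType} (F_char0 : forall n : nat, (n%:R == 0 :> F) = (n == 0)%N).

Lemma intr_char0 (z : int) : (z%:~R == 0 :> F) = (z == 0).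
Proof.
case: z => n; first exact: F_char0.
by rewrite NegzE rmorphN !oppr_eq0 F_char0.
Qed.

(** This makes [ratr] a morphism to any field of characteristic 0, ordered or
    not. *)
Lemma ratr_char0 (x : rat) (a b : int) : b != 0 -> x * b%:~R = a%:~R ->
  ratr x = a%:~R / b%:~R :> F.
Proof.
move=> b0 xb; rewrite /ratr; apply/eqP.
rewrite eqr_div ?intr_char0 ?denq_neq0 // -!intrM; apply/eqP; congr (_%:~R).
apply: (@intr_inj rat); rewrite !intrM -xb mulrAC -numqE mulrC.
by rewrite mulrC.
Qed.

Lemma ratr_is_zmod_morphism_char0 : zmod_morphism (ratr : rat -> F).
Proof.
move=> x y.
rewrite (@ratr_char0 (x - y) (numq x * denq y - numq y * denq x) (denq x * denq y)).
- rewrite /ratr !intrB !intrM.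
  have := denq_neq0 x; have := denq_neq0 y; rewrite -2!intr_char0 => dy dx.
  by rewrite -(mulNr (numq y)%:~R (denq y)%:~R^-1) addf_div // mulNr.
- by rewrite mulf_neq0 ?denq_neq0.
- by rewrite intrB !intrM !numqE; ring.
Qed.

Lemma ratr_is_monoid_morphism_char0 : monoid_morphism (ratr : rat -> F).
Proof.
split=> [|x y]; first by rewrite -[1]/(1%:~R) ratr_int.
rewrite (@ratr_char0 (x * y) (numq x * numq y) (denq x * denq y)).
- by rewrite /ratr !intrM invfM mulrACA.
- by rewrite mulf_neq0 ?denq_neq0.
- by rewrite !intrM !numqE mulrACA.
Qed.

End RatInField.

Section PadicNumbers.
Context {p : nat} {pp : prime p}.
Local Notation Zp := (padic_int pp).
Local Notation Qp := (padic_num pp).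
Local Notation F := (@tofrac Zp).

Lemma tofrac_inj : injective F.
Proof. by move=> x y /eqP; rewrite tofrac_eq => /eqP. Qed.

Lemma padic_num_char0 n : ((n%:R : Qp) == 0) = (n == 0)%N.
Proof. by rewrite -(rmorph_nat F) tofrac_eq0 padic_natr_eq0. Qed.

Lemma ratr_padicB : zmod_morphism (ratr : rat -> Qp).
Proof. exact: ratr_is_zmod_morphism_char0 padic_num_char0. Qed.

Lemma ratr_padicM : monoid_morphism (ratr : rat -> Qp).
Proof. exact: ratr_is_monoid_morphism_char0 padic_num_char0. Qed.

Lemma padic_p_num_neq0 : (p%:R : Qp) != 0.
Proof. by rewrite padic_num_char0 -lt0n prime_gt0. Qed.

Lemma fractionP (x : Qp) : exists a b, b != 0 /\ x * F b = F a.
Proof.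
elim/quotW: x => r; exists (frac r).1, (frac r).2; split; first exact: denom_ratioP.
unlock tofrac; rewrite -[LHS]/(FracField.mul _ _) -FracField.pi_mul.
apply/eqP; rewrite FracField.equivf_def /FracField.equivf /FracField.mulf !numden_Ratio ?mulf_neq0 ?oner_neq0 ?denom_ratioP //.
by rewrite !mulr1 mulrC.
Qed.

Lemma exp_p_int (j : int) (w : Zp) : (p%:R : Qp) ^ j = F w -> 0 <= j.
Proof.
case: j => // j; rewrite NegzE -exprnN => /(congr1 (fun x => x * p%:R ^+ j.+1)).
rewrite /= mulVf ?expf_neq0 ?padic_p_num_neq0 // -(rmorph_nat F) -rmorphXn -rmorphM.
rewrite -[X in X = _](rmorph1 F) => /tofrac_inj w1.
have := @padic_p_Nunit _ pp (p%:R ^+ j * w).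
by rewrite mulrA -exprS mulrC -w1 unitr1.
Qed.

(** A prime factor [p] of the denominator would also divide the numerator. *)
Lemma rat_int_of_padic (r : rat) k (z : Zp) :
  p%:R ^+ k * r \is a Num.int -> ratr r = F z -> r \is a Num.int.
Proof.
move=> /intrP[c rc] rz.
have db : (denq r)%:~R != 0 :> Qp by rewrite (intr_char0 padic_num_char0) denq_neq0.
have zE : z * (denq r)%:~R = (numq r)%:~R.
  apply: tofrac_inj; rewrite tofracM !rmorph_int -rz /ratr mulfVK //.
have dr : (`|denq r| %| p ^ k)%N.
  have : (denq r %| numq r * (p ^ k)%N%:Z)%Z.
    apply/dvdzP; exists c; apply: (@intr_inj rat).
    by rewrite !intrM -rc numqE -[(p ^ k)%N%:Z%:~R]/((p ^ k)%N%:R) natrX; ring.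
  by rewrite Gauss_dvdzr // coprimezE coprime_sym coprime_num_den.
have /(dvdn_pfactor _ _ pp)[[|i] _ dE] := dr.
  by apply/intrP; exists (numq r); rewrite numqE -absz_denq dE mulr1.
have pz : (p %| `|denq r|)%N by rewrite dE expnS dvdn_mulr.
have pn : (p %| `|numq r|)%N.
  have /eqP : padic_val ((numq r)%:~R : Zp) 1 = 0.
    apply/padic_dvdP; exists (z * (`|denq r| %/ p)%N%:R).
    by rewrite expr1 mulrCA -natrM mulnC divnK // -zE -{1}absz_denq.
  by rewrite padic_val_int expn1 => /eqP/dvdz_mod0P; rewrite dvdzE.
have := coprime_num_den r; rewrite /coprime => /eqP cnd.
have : (p %| 1)%N by rewrite -cnd dvdn_gcd pn.
by rewrite dvdn1 => /eqP p1; have := prime_gt1 pp; rewrite p1.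
Qed.

End PadicNumbers.

(** * The symplectic form and its similitudes *)

Section SymplecticForm.
Context {K : comUnitRingType} {n : nat}.
Local Notation J := (symp_form K n).
Implicit Types (A B : 'M[K]_(n + n)).

Lemma symp_form_sqr : J *m J = - 1%:M.
Proof.
rewrite /symp_form mulmx_block !mul0mx !mulmx0 !mul1mx !mulmx1 !addr0 !add0r.
by rewrite scalar_mx_block opp_block_mx !oppr0.
Qed.

Lemma tr_symp_form : J^T = - J.
Proof.
rewrite /symp_form tr_block_mx opp_block_mx !trmx0 linearN /= trmx1.
by rewrite !oppr0 opprK.
Qed.

Definition similitude mu A := A *m J *m A^T = mu *: J.

Lemma similitudeM a b A B :
  similitude a A -> similitude b B -> similitude (a * b) (A *m B).
Proof.
rewrite /similitude => hA hB.
have -> : A *m B *m J *m (A *m B)^T = A *m (B *m J *m B^T) *m A^T.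
  by rewrite trmx_mul !mulmxA.
rewrite hB -scalemxAr -scalemxAl hA.
by rewrite scalerA mulrC.
Qed.

Lemma similitude_inv mu A : mu \is a GRing.unit -> similitude mu A ->
  A \in unitmx /\ invmx A = - mu^-1 *: (J *m A^T *m J).
Proof.
move=> mu_unit hA.
have AV : A *m (- mu^-1 *: (J *m A^T *m J)) = 1%:M.
  rewrite -scalemxAr !mulmxA hA -scalemxAl symp_form_sqr scalerA mulNr mulVr //.
  by rewrite scaleN1r opprK.
have [Au _] := mulmx1_unit AV; split => //.
by rewrite -[LHS]mulmx1 -AV mulKmx.
Qed.

Lemma similitudeV mu A : mu \is a GRing.unit -> similitude mu A ->
  similitude mu^-1 (invmx A).
Proof.
move=> mu_unit hA; have [Au _] := similitude_inv mu_unit hA.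
rewrite /similitude -[J in LHS]scale1r -(mulVr mu_unit) -scalerA -hA.
rewrite -scalemxAr -scalemxAl !mulmxA mulVmx // mul1mx -mulmxA -trmx_mul.
by rewrite mulVmx // trmx1 mulmx1.
Qed.

Lemma similitude1 : similitude 1 1%:M.
Proof. by rewrite /similitude mul1mx trmx1 mulmx1 scale1r. Qed.

Lemma similitude_form : similitude 1 J.
Proof.
by rewrite /similitude symp_form_sqr tr_symp_form mulNmx mul1mx opprK scale1r.
Qed.

Lemma mul_block_form (m1 m2 : nat) (A B : 'M[K]_(m1, n)) (C D : 'M[K]_(m2, n)) :
  row_mx A B *m J *m (row_mx C D)^T = A *m D^T - B *m C^T.
Proof.
rewrite /symp_form mul_row_block !mulmx0 mulmxN !mulmx1 add0r addr0.
by rewrite tr_row_mx mul_row_col mulNmx addrC.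
Qed.

Lemma similitude_blockP mu (A B C D : 'M[K]_n) :
  similitude mu (block_mx A B C D) <->
  [/\ A *m B^T = B *m A^T, A *m D^T - B *m C^T = mu%:M & C *m D^T = D *m C^T].
Proof.
have -> : (similitude mu (block_mx A B C D)) =
  (block_mx (A *m B^T - B *m A^T) (A *m D^T - B *m C^T)
            (C *m B^T - D *m A^T) (C *m D^T - D *m C^T)
   = block_mx 0 mu%:M (- mu%:M) 0).
  rewrite /similitude; congr (_ = _); last first.
    by rewrite /symp_form scale_block_mx !scaler0 scalerN scalemx1.
  rewrite -!mul_block_form {1}block_mxEv mul_col_mx block_mxEv tr_col_mx.
  by rewrite mul_col_row.
split=> [/eq_block_mx[AB AD _ CD]|[AB AD CD]].
  by split => //; apply/eqP; rewrite -subr_eq0 ?AB ?CD.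
rewrite AB AD CD !subrr; congr block_mx.
have : (A *m D^T - B *m C^T)^T = mu%:M by rewrite AD tr_scalar_mx.
rewrite linearB /= !trmx_mul !trmxK => <-.
by rewrite opprB.
Qed.

Lemma similitude_levi (U : 'M[K]_n) : U \in unitmx ->
  similitude 1 (block_mx U 0 0 (invmx U)^T).
Proof.
move=> Uu; apply/similitude_blockP; rewrite !(trmx0, mulmx0, mul0mx) subr0 trmxK.
by rewrite mulmxV.
Qed.

Lemma similitude_shear (B : 'M[K]_n) : B^T = B ->
  similitude 1 (block_mx 1%:M B 0 1%:M).
Proof.
move=> Bs; apply/similitude_blockP.
by rewrite Bs !(trmx1, trmx0, mulmx1, mul1mx, mulmx0) subr0.
Qed.

Lemma similitude_scale (u : K) : similitude u (block_mx u%:M 0 0 1%:M).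
Proof.
apply/similitude_blockP.
by rewrite !(trmx1, trmx0, mulmx1, mulmx0, mul0mx) subr0.
Qed.

Lemma form_alternating m (X : 'M[K]_(m, n + n)) i : (X *m J *m X^T) i i = 0.
Proof.
rewrite -[X]hsubmxK mul_block_form !mxE; apply/eqP; rewrite subr_eq0; apply/eqP.
by apply: eq_bigr => j _; rewrite [RHS]mulrC !mxE.
Qed.

Lemma tr_form m1 m2 (X : 'M[K]_(m1, n + n)) (Y : 'M[K]_(m2, n + n)) :
  (X *m J *m Y^T)^T = - (Y *m J *m X^T).
Proof. by rewrite !trmx_mul trmxK tr_symp_form mulNmx mulmxN mulmxA. Qed.

(** A basis of a Lagrangian direct summand is the lower half of a symplectic
    matrix: any dual family [- Z^T J] has an alternating Gram matrix, which is
    cancelled by adding to that family combinations of the rows of [X]. *)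
Lemma isotropic_extend (X : 'M[K]_(n, n + n)) (Z : 'M[K]_(n + n, n)) :
  X *m Z = 1%:M -> X *m J *m X^T = 0 ->
  exists Y : 'M[K]_(n, n + n), similitude 1 (col_mx Y X).
Proof.
move=> XZ XX; pose Y0 := - (Z^T *m J).
have Y0X : Y0 *m J *m X^T = 1%:M.
  rewrite /Y0 !mulNmx -(mulmxA Z^T) symp_form_sqr mulmxN mulmx1 mulNmx opprK.
  by rewrite -trmx_mul XZ trmx1.
have XY0 : X *m J *m Y0^T = - 1%:M.
  by rewrite -[LHS]opprK -tr_form Y0X trmx1.
have [G GE] : exists G, Y0 *m J *m Y0^T = G by eexists.
(* Half of an alternating matrix, without division by 2. *)
pose W : 'M[K]_n := \matrix_(i, j) (if (i < j)%N then G i j else 0).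
have WG : W - W^T = G.
  apply/matrixP => i j; rewrite !mxE.
  case: ltngtP => [ij|ij|/val_inj->]; rewrite ?subr0 ?sub0r ?subrr.
  - by [].
  - by have /matrixP/(_ i j) := tr_form Y0 Y0; rewrite GE mxE [in RHS]mxE => ->; rewrite opprK.
  - by rewrite -GE form_alternating.
exists (Y0 + W *m X); rewrite /similitude scale1r.
rewrite mul_col_mx tr_col_mx mul_col_row /symp_form; congr block_mx.
- rewrite linearD /= mulmxDl mulmxDl !mulmxDr GE trmx_mul !mulmxA Y0X mul1mx.
  rewrite -!(mulmxA W) XY0 XX.
  rewrite mulmxN mulmx1 mul0mx mulmx0 addr0 -WG.
  by rewrite subrK subrr.
- by rewrite !mulmxDl Y0X -!(mulmxA W) XX mulmx0 addr0.
- by rewrite linearD /= mulmxDr XY0 trmx_mul mulmxA XX mul0mx addr0.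
- exact: XX.
Qed.

End SymplecticForm.

Lemma map_symp_form (R S : comUnitRingType) (f : {rmorphism R -> S}) n :
  map_mx f (symp_form R n) = symp_form S n.
Proof. by rewrite /symp_form map_block_mx map_mxN map_mx1 map_mx0. Qed.

Lemma similitude_map (R S : comUnitRingType) (f : {rmorphism R -> S}) n mu
    (g : 'M[R]_(n + n)) : similitude mu g -> similitude (f mu) (map_mx f g).
Proof.
move=> /(congr1 (map_mx f)); rewrite !map_mxM map_mxZ -map_trmx.
by rewrite map_symp_form.
Qed.

Section Transitivity.
Context {K : comUnitRingType}.

(** With [c] the [i]-th unit column, [1 + c r] maps the [i]-th unit row to [a],
    and its determinant is the unit [a 0 i]. *)
Lemma extend_row (n : nat) (a : 'rV[K]_n.+1) i : a 0 i \is a GRing.unit ->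
  exists2 U : 'M[K]_n.+1, U \in unitmx & a *m U = delta_mx 0 0.
Proof.
move=> ai; pose c : 'cV[K]_n.+1 := delta_mx i 0.
pose r : 'rV[K]_n.+1 := a - delta_mx 0 i.
have rc : r *m c = (a 0 i - 1)%:M.
  by apply/matrixP => j k; rewrite !ord1 -colE !mxE !eqxx.
pose V := 1%:M + c *m r; pose V' := 1%:M - (a 0 i)^-1 *: (c *m r).
have crcr : (c *m r) *m (c *m r) = (a 0 i - 1) *: (c *m r).
  by rewrite mulmxA -(mulmxA c) rc mul_mx_scalar -scalemxAl.
have VV' : V *m V' = 1%:M.
  rewrite /V /V'; move: (c *m r) crcr => z zz.
  rewrite mulmxDl mul1mx mulmxBr mulmx1 -scalemxAr zz scalerA.
  rewrite mulrBr mulr1 mulVr // scalerBl scale1r opprB [X in _ + X]addrC.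
  by rewrite subrK subrK.
have dV : delta_mx 0 i *m V = a.
  rewrite mulmxDr mulmx1 mulmxA mul_delta_mx.
  by rewrite -rowE /r; apply/rowP => j; rewrite !mxE addrC subrK.
have [Vu _] := mulmx1_unit VV'.
exists (invmx V *m tperm_mx i 0).
  by rewrite unitmx_mul unitmx_inv Vu unitmx_perm.
rewrite -{1}dV mulmxA mulmxK // -rowE.
by apply/rowP => j; rewrite !mxE tpermL eqxx eq_sym.
Qed.

Definition e_vec n : 'rV[K]_(n.+1 + n.+1) := row_mx (delta_mx 0 0) 0.

(** Multiplication by [symp_form] moves the unit entry to the first half. An
    element of the Levi subgroup then takes the first half to a unit vector, and
    a shear clears the second half. *)
Lemma symplectic_transitive (n : nat) (v : 'rV[K]_(n.+1 + n.+1)) i :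
  v 0 i \is a GRing.unit ->
  exists g : 'M[K]_(n.+1 + n.+1), similitude 1 g /\ v *m g = e_vec n.
Proof.
wlog [j ->] : v i / exists j, i = lshift n.+1 j => [W vi|].
  case: (split_ordP i) vi => j -> vj; first by apply: (W v (lshift _ j)) => //; exists j.
  have vJ : v *m symp_form K n.+1 = row_mx (- rsubmx v) (lsubmx v).
    rewrite -{1}[v]hsubmxK /symp_form mul_row_block !mulmx0 mulmxN !mulmx1.
    by rewrite add0r addr0.
  have [||g [gS gE]] := W (v *m symp_form K n.+1) (lshift n.+1 j).
  - by exists j.
  - by rewrite vJ row_mxEl !mxE unitrN.
  exists (symp_form K n.+1 *m g); split; last by rewrite mulmxA.
  by have := similitudeM similitude_form gS; rewrite mulr1.
move=> vj; have [|U Uu aU] := @extend_row n (lsubmx v) j; first by rewrite mxE.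
(* A symmetric [B] whose first row is [- b]. *)
pose b := rsubmx v *m (invmx U)^T.
pose d : 'rV[K]_n.+1 := delta_mx 0 0.
pose B : 'M[K]_n.+1 := b 0 0 *: delta_mx 0 0 - d^T *m b - b^T *m d.
have BS : B^T = B.
  rewrite /B !linearB /= linearZ /= trmx_delta !trmx_mul !trmxK.
  by rewrite addrAC.
have dB : d *m B = - b.
  rewrite /B !mulmxBr -scalemxAr !mulmxA.
  have -> : d *m delta_mx 0 0 = d by rewrite mul_delta_mx.
  have -> : d *m d^T = 1%:M by rewrite trmx_delta mul_delta_mx; apply/matrixP => x y; rewrite !ord1 !mxE.
  have -> : d *m b^T = (b 0 0)%:M.
    by rewrite -rowE; apply/matrixP => x y; rewrite !ord1 !mxE.
  by rewrite mul1mx mul_scalar_mx addrAC subrr add0r.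
exists (block_mx U 0 0 (invmx U)^T *m block_mx 1%:M B 0 1%:M); split.
  by have := similitudeM (similitude_levi Uu) (similitude_shear BS); rewrite mulr1.
rewrite mulmxA -{1}[v]hsubmxK mul_row_block !mulmx0 addr0 add0r aU -/b -/d.
by rewrite mul_row_block !mulmx0 !mulmx1 addr0 dB addNr.
Qed.

End Transitivity.

(** The orthogonal sum of a hyperbolic plane and a form of smaller rank. *)
Section Hyperbolic.
Context {K : comUnitRingType} {n : nat}.
Implicit Types (a d x y : 'M[K]_1) (M N : 'M[K]_(n + n)).

Definition plane_sum_mx a d M : 'M[K]_((1 + n) + (1 + n)) :=
  block_mx (block_mx a 0 0 (ulsubmx M) : 'M_(1 + n)) (block_mx 0 0 0 (ursubmx M) : 'M_(1 + n))
           (block_mx 0 0 0 (dlsubmx M) : 'M_(1 + n)) (block_mx d 0 0 (drsubmx M) : 'M_(1 + n)).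

Definition plane_sum_vec x y (u : 'rV[K]_(n + n)) : 'rV[K]_((1 + n) + (1 + n)) :=
  row_mx (row_mx x (lsubmx u) : 'rV_(1 + n)) (row_mx y (rsubmx u) : 'rV_(1 + n)).

Lemma plane_sum_vecP (w : 'rV[K]_((1 + n) + (1 + n))) :
  exists x y u, w = plane_sum_vec x y u.
Proof.
exists (lsubmx (lsubmx w : 'rV_(1 + n))), (lsubmx (rsubmx w : 'rV_(1 + n))).
exists (row_mx (rsubmx (lsubmx w : 'rV_(1 + n))) (rsubmx (rsubmx w : 'rV_(1 + n)))).
by rewrite /plane_sum_vec row_mxKl row_mxKr !hsubmxK.
Qed.

Lemma plane_sum_vec_inj x y u x' y' u' :
  plane_sum_vec x y u = plane_sum_vec x' y' u' -> [/\ x = x', y = y' & u = u'].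
Proof.
move=> e; have [e1 e2] := @eq_row_mx _ _ (1 + n) (1 + n) _ _ _ _ e.
have [-> lu] := @eq_row_mx _ _ 1 n _ _ _ _ e1.
have [-> ru] := @eq_row_mx _ _ 1 n _ _ _ _ e2; split => //.
by rewrite -[u]hsubmxK -[u']hsubmxK lu ru.
Qed.

Lemma plane_sum_vecD x y u x' y' u' :
  plane_sum_vec x y u + plane_sum_vec x' y' u' =
    plane_sum_vec (x + x') (y + y') (u + u').
Proof. by rewrite /plane_sum_vec !linearD /= -!add_row_mx. Qed.

Lemma plane_sum_vecZ c x y u :
  c *: plane_sum_vec x y u = plane_sum_vec (c *: x) (c *: y) (c *: u).
Proof. by rewrite /plane_sum_vec !linearZ /= -!scale_row_mx. Qed.

Lemma plane_sum_vec_mul x y u a d M :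
  plane_sum_vec x y u *m plane_sum_mx a d M = plane_sum_vec (x *m a) (y *m d) (u *m M).
Proof.
rewrite /plane_sum_vec /plane_sum_mx mul_row_block !mul_row_block.
rewrite !mulmx0 !addr0 !add0r !add_row_mx !addr0 !add0r.
have -> : u *m M = row_mx (lsubmx u *m ulsubmx M + rsubmx u *m dlsubmx M)
                          (lsubmx u *m ursubmx M + rsubmx u *m drsubmx M).
  by rewrite -mul_row_block hsubmxK submxK.
by rewrite row_mxKl row_mxKr.
Qed.

Lemma plane_sum_form x y u x' y' u' :
  plane_sum_vec x y u *m symp_form K (1 + n) *m (plane_sum_vec x' y' u')^T =
    x *m y'^T - y *m x'^T + u *m symp_form K n *m u'^T.
Proof.
rewrite -[u in RHS]hsubmxK -[u' in RHS]hsubmxK !mul_block_form.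
rewrite /plane_sum_vec !tr_row_mx !mul_row_col.
by rewrite opprD addrACA.
Qed.

Lemma plane_sum_similitude a d M mu : a *m d^T = mu%:M -> similitude mu M ->
  similitude mu (plane_sum_mx a d M).
Proof.
move=> ad; rewrite -{1}[M]submxK => /similitude_blockP[h1 h2 h3].
apply/similitude_blockP.
rewrite !tr_block_mx !mulmx_block !(trmx0, mulmx0, mul0mx, addr0, add0r).
rewrite h1 h3 ad opp_block_mx add_block_mx !(oppr0, addr0) h2.
by rewrite -scalar_mx_block.
Qed.

End Hyperbolic.

(** * Lagrangians modulo a power of p *)

Section Lagrangians.
Context {p : nat} {pp : prime p} {d : nat}.
Local Notation Zp := (padic_int pp).
Local Notation A := 'Z_(p ^ d.+1).
Local Notation redm := (map_mx (@red p pp d)).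

Section FixedRank.
Context {n : nat}.
Local Notation V := 'rV[A]_(n + n).
Local Notation J := (symp_form A n).
Implicit Types (L : {set V}) (u v w : V).

Definition perp L : {set V} := [set w | [forall v in L, w *m J *m v^T == 0]]%SET.

Definition lagrangian L := perp L == L.

Definition p_multiples : {set V} := [set p%:R *: u | u in [set: V]]%SET.

Definition transform (g : 'M[A]_(n + n)) L : {set V} := [set v *m g | v in L]%SET.

Lemma perpP L w : reflect (forall v, v \in L -> w *m J *m v^T = 0) (w \in perp L).
Proof.
rewrite inE; apply: (iffP forall_inP) => h v vL; first exact/eqP/h.
exact/eqP/h.
Qed.

Lemma mem_p_multiples v : reflect (exists u, v = p%:R *: u) (v \in p_multiples).
Proof.
by apply: (iffP imsetP) => [[u _ ->]|[u ->]]; exists u; rewrite ?inE.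
Qed.

Lemma lagrangianP L : lagrangian L ->
  forall w, reflect (forall v, v \in L -> w *m J *m v^T = 0) (w \in L).
Proof. by move=> /eqP LE w; have := perpP L w; rewrite LE. Qed.

Lemma lagrangian0 L : lagrangian L -> 0 \in L.
Proof. by move=> /lagrangianP LP; apply/LP => v _; rewrite !mul0mx. Qed.

Lemma lagrangianD L u v : lagrangian L -> u \in L -> v \in L -> u + v \in L.
Proof.
move=> /lagrangianP LP /LP uL /LP vL; apply/LP => w wL.
by rewrite !mulmxDl uL // vL // addr0.
Qed.

Lemma lagrangianZ L a u : lagrangian L -> u \in L -> a *: u \in L.
Proof.
move=> /lagrangianP LP /LP uL; apply/LP => w wL.
by rewrite -!scalemxAl uL // scaler0.
Qed.

Lemma mem_transform g L v : g \in unitmx ->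
  (v *m g \in transform g L) = (v \in L).
Proof.
by move=> gu; apply: mem_imset; apply: (can_inj (mulmxK gu)).
Qed.

Lemma card_transform g L : g \in unitmx -> #|transform g L| = #|L|.
Proof. by move=> gu; apply: card_imset; apply: (can_inj (mulmxK gu)). Qed.

Lemma transformK g L : g \in unitmx -> transform (invmx g) (transform g L) = L.
Proof.
move=> gu; apply/setP => v; rewrite -{1}[v](mulmxK gu).
by rewrite mem_transform ?unitmx_inv // mem_transform.
Qed.

Lemma lagrangian_transform mu g L : mu \is a GRing.unit -> similitude mu g ->
  lagrangian L -> lagrangian (transform g L).
Proof.
move=> muu gS /lagrangianP LP; have [gu _] := similitude_inv muu gS.
apply/eqP/setP => w; rewrite -[w](mulmxKV gu); move: (w *m _) => {}w.
rewrite mem_transform //.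
have form v : w *m g *m J *m (v *m g)^T = mu *: (w *m J *m v^T).
  rewrite trmx_mul -!mulmxA (mulmxA J) (mulmxA g) (mulmxA g J) gS.
  by rewrite -scalemxAl -scalemxAr !mulmxA.
apply/perpP/LP => h v vL.
  have := h (v *m g); rewrite mem_transform // form => /(_ vL).
  by move=> /(congr1 ( *:%R mu^-1)); rewrite scalerA mulVr // scale1r scaler0.
by case/imsetP: vL => {}v vL ->; rewrite form h // scaler0.
Qed.

Lemma p_multiples_transform g L : g \in unitmx ->
  #|transform g L :&: p_multiples| = #|L :&: p_multiples|.
Proof.
move=> gu; rewrite -[RHS](card_transform _ gu); congr #|pred_of_set _|.
apply/setP => w; rewrite -[w](mulmxKV gu); move: (w *m _) => {}w.
rewrite inE !mem_transform // inE; congr andb.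
apply/idP/idP => /mem_p_multiples[u uE]; apply/mem_p_multiples.
  by exists (u *m invmx g); rewrite -[w](mulmxK gu) uE -scalemxAl.
by exists (u *m g); rewrite uE -scalemxAl.
Qed.

(** For [d = 1] the condition on the cardinal says that the reduction of [L]
    modulo [p] has rank [n - k]; for [d = 0] it always holds, the only multiple
    of [p] being 0. *)
Definition lagrangians (k : nat) : {set {set V}} :=
  [set L | lagrangian L && (#|L :&: p_multiples| == p ^ (d * (n + k)))%N]%SET.

Lemma lagrangians_transform k mu g L : mu \is a GRing.unit -> similitude mu g ->
  (transform g L \in lagrangians k) = (L \in lagrangians k).
Proof.
move=> muu gS; have [gu _] := similitude_inv muu gS.
rewrite !inE p_multiples_transform //; congr andb; apply/idP/idP => h.
  rewrite -[L](transformK _ gu).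
  by apply: (lagrangian_transform _ (similitudeV muu gS)) h; rewrite unitrV.
exact: (lagrangian_transform muu gS).
Qed.

(** Similitudes permute the Lagrangians of each type. *)
Lemma card_lagrangians_mem k mu g v : mu \is a GRing.unit -> similitude mu g ->
  #|[set L in lagrangians k | v *m g \in L]%SET|
    = #|[set L in lagrangians k | v \in L]%SET|.
Proof.
move=> muu gS; have [gu _] := similitude_inv muu gS.
rewrite -(card_imset (mem [set L in lagrangians k | v \in L]%SET)
            (can_inj (fun L => transformK L gu))).
congr #|pred_of_set _|; apply/setP => L; rewrite inE.
apply/andP/imsetP => [[LL vL]|[L' + ->]]; last first.
  by rewrite inE => /andP[L'L vL']; rewrite (lagrangians_transform _ _ muu gS) mem_transform.
exists (transform (invmx g) L).
  rewrite inE (lagrangians_transform _ _ _ (similitudeV muu gS)) ?unitrV //.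
  by rewrite LL -[v](mulmxK gu) mem_transform ?unitmx_inv.
by rewrite -{1}[g]invmxK transformK ?unitmx_inv.
Qed.

Definition row_span (M : 'M[A]_(n + n)) : {set V} := [set c *m M | c in [set: V]]%SET.

Lemma row_spanP M v : reflect (exists c, v = c *m M) (v \in row_span M).
Proof.
by apply: (iffP imsetP) => [[c _ ->]|[c ->]]; exists c; rewrite ?inE.
Qed.

Lemma row_span_mulr M g : row_span (M *m g) = transform g (row_span M).
Proof.
by rewrite /row_span /transform -imset_comp; apply: eq_imset => c /=; rewrite mulmxA.
Qed.

Lemma row_span_mull M g : g \in unitmx -> row_span (g *m M) = row_span M.
Proof.
move=> gu; apply/setP => v; apply/row_spanP/row_spanP => -[c ->].
  by exists (c *m g); rewrite mulmxA.
by exists (c *m invmx g); rewrite mulmxA mulmxKV.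
Qed.

Lemma redm_surj m l (v : 'M[A]_(m, l)) : exists w : 'M[Zp]_(m, l), redm w = v.
Proof.
have /choice[f fP] := @red_surj p pp d.
by exists (map_mx f v); apply/matrixP => i j; rewrite !mxE.
Qed.

Lemma padic_primitive_or_dvd m (w : 'rV[Zp]_m) :
  (exists i, w 0 i \is a GRing.unit) \/ exists u : 'rV[Zp]_m, w = p%:R *: u.
Proof.
have [h|h] := pselect (exists i, w 0 i \is a GRing.unit); [by left | right].
have /choice[f fP] i : exists y, w 0 i = p%:R * y.
  by have [wi|//] := padic_unit_or_dvd (w 0 i); case: h; exists i.
by exists (\row_i f i); apply/rowP => i; rewrite !mxE.
Qed.

Lemma primitive_lift (w : 'rV[Zp]_(n + n)) : redm w \notin p_multiples ->
  exists i, w 0 i \is a GRing.unit.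
Proof.
have [//|[u ->]] := padic_primitive_or_dvd w.
case/mem_p_multiples; exists (redm u).
by rewrite map_mxZ rmorph_nat.
Qed.

End FixedRank.

End Lagrangians.

Arguments p_multiples : clear implicits.
Arguments lagrangians : clear implicits.

(** * Splitting off a hyperbolic plane *)

Section PlaneLift.
Context {p : nat} {pp : prime p} {d : nat}.
Local Notation Zp := (padic_int pp).
Local Notation A := 'Z_(p ^ d.+1).
Local Notation redm := (map_mx (@red p pp d)).

Lemma e_vecE (K : comUnitRingType) n : e_vec n = plane_sum_vec 1%:M 0 0 :> 'rV[K]_((1 + n) + (1 + n)).
Proof.
rewrite /e_vec /plane_sum_vec !linear0; congr row_mx; last by rewrite row_mx0.
apply/rowP => i; rewrite !mxE; by case: split_ordP => j ->; rewrite ?ord1 !mxE.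
Qed.

Section FixedRank.
Context {n : nat}.
Local Notation V := 'rV[A]_(n + n).
Local Notation W := 'rV[A]_((1 + n) + (1 + n)).
Implicit Types (L : {set V}) (u : V).

(** The preimage of [L] in the orthogonal of [e_vec], whose quotient by the line
    of [e_vec] is the symplectic module of rank one less. *)
Definition plane_lift L : {set W} :=
  [set plane_sum_vec xu.1 0 xu.2 | xu in finset.setX [set: 'M[A]_1] L]%SET.

Lemma mem_plane_lift L x y u :
  (plane_sum_vec x y u \in plane_lift L) = (y == 0) && (u \in L).
Proof.
apply/imsetP/andP => [[[x' u']]|[/eqP -> uL]].
  by rewrite inE => /andP[_ u'L] /plane_sum_vec_inj[_ -> ->].
by exists (x, u) => //; rewrite !inE.
Qed.

Lemma plane_lift_inj : injective plane_lift.
Proof.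
move=> L L' LL'; apply/setP => u.
by have := mem_plane_lift L 0 0 u; rewrite LL' mem_plane_lift eqxx.
Qed.

Lemma lagrangian_plane_lift L : lagrangian L -> lagrangian (plane_lift L).
Proof.
move=> LL; apply/eqP/setP => w; have [x [y [u ->]]] := plane_sum_vecP w.
rewrite mem_plane_lift; apply/perpP/andP => [h|[/eqP -> uL] v].
  have y0 : y = 0.
    have := h (plane_sum_vec 1%:M 0 0); rewrite mem_plane_lift eqxx lagrangian0 //.
    move=> /(_ isT); rewrite plane_sum_form !trmx0 !mulmx0 trmx1 mulmx1 sub0r addr0.
    by move/eqP; rewrite oppr_eq0 => /eqP.
  split; first by rewrite y0.
  apply/(lagrangianP LL) => v vL.
  have := h (plane_sum_vec 0 0 v); rewrite mem_plane_lift eqxx vL => /(_ isT).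
  by rewrite plane_sum_form !trmx0 !mulmx0 subrr add0r.
have [x' [y' [u' ->]]] := plane_sum_vecP v.
rewrite mem_plane_lift => /andP[/eqP -> u'L].
rewrite plane_sum_form mul0mx trmx0 mulmx0 subrr add0r.
exact: (lagrangianP LL _ uL).
Qed.

(** A Lagrangian that contains [e_vec] is orthogonal to it, hence is the preimage
    of its image in the quotient. *)
Lemma plane_lift_surj (L : {set W}) : lagrangian L -> e_vec n \in L ->
  exists2 L' : {set V}, lagrangian L' & L = plane_lift L'.
Proof.
rewrite e_vecE => LL eL.
pose L' : {set V} := [set u | plane_sum_vec 0 0 u \in L]%SET.
have LP x y u : (plane_sum_vec x y u \in L) = (y == 0) && (u \in L').
  have y0 : plane_sum_vec x y u \in L -> y = 0.
    move/(lagrangianP LL) => /(_ _ eL).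
    rewrite plane_sum_form !trmx0 !mulmx0 trmx1 mulmx1 sub0r addr0.
    by move/eqP; rewrite oppr_eq0 => /eqP.
  have x0 c : c *: plane_sum_vec 1%:M 0 0 = plane_sum_vec c%:M 0 0 :> W.
    by rewrite plane_sum_vecZ !scaler0 scalemx1.
  have xE : x = (x 0 0)%:M by rewrite -mx11_scalar.
  apply/idP/andP => [h|[/eqP -> uL']].
    split; first by rewrite (y0 h).
    rewrite inE -(y0 h).
    have := lagrangianD LL h (lagrangianZ (- x 0 0) LL eL).
    by rewrite x0 plane_sum_vecD !addr0 {1}xE -[X in plane_sum_vec X]raddfD /= subrr raddf0 (y0 h).
  move: uL'; rewrite inE => uL'.
  have := lagrangianD LL uL' (lagrangianZ (x 0 0) LL eL).
  by rewrite x0 plane_sum_vecD !addr0 add0r -xE.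
have LE : L = plane_lift L'.
  apply/setP => w; have [x [y [u ->]]] := plane_sum_vecP w.
  by rewrite mem_plane_lift LP.
exists L' => //; apply/eqP/setP => u.
apply/perpP/idP => [h|uL' v vL'].
  have : plane_sum_vec 0 0 u \in L.
    apply/(lagrangianP LL) => w; have [x' [y' [u' ->]]] := plane_sum_vecP w.
    rewrite LP => /andP[/eqP -> u'L].
    by rewrite plane_sum_form !mul0mx subrr add0r h.
  by rewrite LP => /andP[].
have : plane_sum_vec 0 0 u \in L by rewrite LP eqxx.
move/(lagrangianP LL)/(_ (plane_sum_vec 0 0 v)); rewrite LP eqxx vL' => /(_ isT).
by rewrite plane_sum_form !mul0mx subrr add0r.
Qed.

Lemma card_A : #|{: A}| = (p ^ d.+1)%N.
Proof. by rewrite card_ord Zp_cast // (@pexp_gt1 p pp). Qed.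

Lemma card_plane_lift L : #|plane_lift L| = (p ^ d.+1 * #|L|)%N.
Proof.
rewrite card_imset => [|[x u] [x' u'] /plane_sum_vec_inj[/= -> _ -> //]].
by rewrite cardsX cardsT card_mx muln1 card_A.
Qed.

Lemma p_multiples_plane x y u :
  (plane_sum_vec x y u \in p_multiples p d (1 + n)) =
  [&& x \in [set p%:R *: z | z in [set: 'M[A]_1]]%SET,
      y \in [set p%:R *: z | z in [set: 'M[A]_1]]%SET & u \in p_multiples p d n].
Proof.
apply/mem_p_multiples/and3P => [[w]|[/imsetP[x' _ ->] /imsetP[y' _ ->] /mem_p_multiples[u' ->]]].
  have [x' [y' [u' ->]]] := plane_sum_vecP w.
  rewrite plane_sum_vecZ => /plane_sum_vec_inj[-> -> ->].
  split; [by apply/imsetP; exists x'|by apply/imsetP; exists y'|].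
  by apply/mem_p_multiples; exists u'.
by exists (plane_sum_vec x' y' u'); rewrite plane_sum_vecZ.
Qed.

Lemma card_p_multiples_11 : #|[set p%:R *: z | z in [set: 'M[A]_1]]%SET| = (p ^ d)%N.
Proof.
have p0 := prime_gt0 pp; have q1 : (1 < p ^ d.+1)%N := @pexp_gt1 p pp d.
pose f (i : 'I_(p ^ d)) : 'M[A]_1 := (p * i)%N%:R%:M.
have f_inj : injective f.
  move=> i j /matrixP/(_ 0 0); rewrite !mxE !mulr1n => /(congr1 val).
  rewrite /= !val_Zp_nat // !modn_small; try by rewrite expnS ltn_pmul2l.
  by move=> /eqP; rewrite eqn_pmul2l // => /eqP /val_inj.
rewrite -[RHS]card_ord -(card_imset _ f_inj); apply: eq_card => z.
apply/imsetP/imsetP => [[y _ ->]|[i _ ->]].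
  have yb : ((y 0%R 0%R : nat) %% p ^ d < p ^ d)%N by rewrite ltn_mod expn_gt0 p0.
  exists (Ordinal yb) => //; apply/matrixP => a b; rewrite !ord1 !mxE mulr1n /=.
  rewrite -[y _ _ in LHS]natr_Zp -natrM; apply: val_inj.
  rewrite /= !val_Zp_nat //; move: (nat_of_ord (y 0 0)) => c.
  by rewrite expnS -!muln_modr modn_mod.
exists (i : nat)%:R%:M; rewrite ?inE //.
by apply/matrixP => a b; rewrite !ord1 !mxE !mulr1n natrM.
Qed.

Lemma card_plane_lift_p L :
  #|plane_lift L :&: p_multiples p d (1 + n)| = (p ^ d * #|L :&: p_multiples p d n|)%N.
Proof.
rewrite -card_p_multiples_11 -cardsX.
have inj : injective (fun xu : 'M[A]_1 * V => plane_sum_vec xu.1 0 xu.2 : W).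
  by move=> [x u] [x' u'] /plane_sum_vec_inj[/= -> _ -> //].
rewrite -(card_imset _ inj); apply: eq_card => w.
have [x [y [u ->]]] := plane_sum_vecP w.
rewrite inE mem_plane_lift p_multiples_plane.
apply/andP/imsetP => [[/andP[/eqP -> uL] /and3P[xp _ up]]|[[x' u'] + /plane_sum_vec_inj[-> -> ->]]].
  by exists (x, u) => //; rewrite !inE /= xp uL.
rewrite !inE /= => /and3P[-> -> ->]; rewrite eqxx andbT; split => //.
by rewrite andbT; apply/imsetP; exists 0; rewrite ?inE ?scaler0.
Qed.

Lemma plane_lift_lagrangians k L :
  (plane_lift L \in lagrangians p d (1 + n) k) = (L \in lagrangians p d n k).
Proof.
rewrite !inE card_plane_lift_p.
have -> : lagrangian (plane_lift L) = lagrangian L.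
  apply/idP/idP => [LL|]; last exact: lagrangian_plane_lift.
  have := lagrangian0 LL; have -> : 0 = plane_sum_vec 0 0 0 :> W.
    by rewrite /plane_sum_vec !linear0 !row_mx0.
  rewrite mem_plane_lift eqxx /= => L0.
  have [|L' L'L /plane_lift_inj -> //] := plane_lift_surj LL.
  by rewrite e_vecE mem_plane_lift eqxx.
congr andb; rewrite -addnA mulnDr muln1 expnD.
by rewrite eqn_pmul2l // expn_gt0 prime_gt0.
Qed.

End FixedRank.
End PlaneLift.

(** * The Cartan decomposition *)

Lemma map_plane_sum_mx (R S : comUnitRingType) (f : {rmorphism R -> S}) n
    (a b : 'M[R]_1) (M : 'M[R]_(n + n)) :
  map_mx f (plane_sum_mx a b M) = plane_sum_mx (map_mx f a) (map_mx f b) (map_mx f M).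
Proof.
rewrite /plane_sum_mx !map_block_mx !map_mx0.
by rewrite map_ulsubmx map_ursubmx map_dlsubmx map_drsubmx.
Qed.

Lemma map_invmx_unit (R S : comUnitRingType) (f : {rmorphism R -> S}) n
    (g : 'M[R]_n) : g \in unitmx ->
  map_mx f g \in unitmx /\ map_mx f (invmx g) = invmx (map_mx f g).
Proof.
move=> gu; have gV : map_mx f g *m map_mx f (invmx g) = 1%:M.
  by rewrite -map_mxM mulmxV // map_mx1.
have [gu' _] := mulmx1_unit gV; split => //.
by rewrite -[LHS](mulKmx gu') gV mulmx1.
Qed.

Section ElementaryDivisors.
Variables (p d : nat) (K : comUnitRingType).

Definition elem_upper n k : 'rV[K]_n :=
  \row_i p%:R ^+ (if (i < n - k)%N then 0 else 1)%N.

Definition elem_lower n k : 'rV[K]_n :=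
  \row_i p%:R ^+ (if (i < n - k)%N then d.+1 else d)%N.

(** The elementary divisors 1 (n - k times), p, p^(d+1) (n - k times), p^d. *)
Definition elem_mx n k : 'M[K]_(n + n) :=
  diag_mx (row_mx (elem_upper n k) (elem_lower n k)).

Lemma elem_mxS n k : (k <= n)%N ->
  elem_mx (1 + n) k = plane_sum_mx 1%:M (p%:R ^+ d.+1)%:M (elem_mx n k).
Proof.
move=> kn; have lt1 (i : 'I_n) : (1 + i < 1 + n - k)%N = (i < n - k)%N by lia.
have lt0 : (0 < 1 + n - k)%N by lia.
have -> : elem_mx (1 + n) k = diag_mx (row_mx
    (row_mx 1%:M (elem_upper n k)) (row_mx (p%:R ^+ d.+1)%:M (elem_lower n k))).
  congr (diag_mx (row_mx _ _)); apply/rowP => i; rewrite mxE.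
    case: (@split_ordP 1 n i) => j ->; rewrite ?row_mxEl ?row_mxEr !mxE ?ord1 /=.
      by rewrite lt0 expr0.
    by rewrite lt1.
  case: (@split_ordP 1 n i) => j ->; rewrite ?row_mxEl ?row_mxEr !mxE ?ord1 /=.
    by rewrite lt0.
  by rewrite lt1.
rewrite /elem_mx /plane_sum_mx !diag_mx_row block_mxKul block_mxKur block_mxKdl block_mxKdr.
have d1 (a : K) : diag_mx (a%:M : 'rV_1) = a%:M.
  by apply/matrixP => i j; rewrite !ord1 !mxE.
by rewrite !d1 -[X in block_mx _ X _ _]block_mx0 -[X in block_mx _ _ X _]block_mx0.
Qed.

End ElementaryDivisors.

Lemma map_elem_mx p d n k (R S : comUnitRingType) (f : {rmorphism R -> S}) :
  map_mx f (elem_mx p d R n k) = elem_mx p d S n k.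
Proof.
rewrite /elem_mx map_diag_mx map_row_mx; congr (diag_mx (row_mx _ _));
  by apply/rowP => i; rewrite !mxE rmorphXn /= rmorph_nat.
Qed.

Section Cartan.
Context {p : nat} {pp : prime p} {d : nat}.
Local Notation Zp := (padic_int pp).
Local Notation A := 'Z_(p ^ d.+1).
Local Notation redm := (map_mx (@red p pp d)).

Lemma p_exp0 : (p%:R : A) ^+ d.+1 = 0.
Proof. by rewrite -natrX pchar_Zp // (@pexp_gt1 p pp). Qed.

Lemma row_span_plane n (M : 'M[A]_(n + n)) :
  row_span (plane_sum_mx 1%:M 0 M) = plane_lift (row_span M).
Proof.
apply/setP => w; have [x [y [u ->]]] := plane_sum_vecP w.
rewrite mem_plane_lift; apply/row_spanP/andP => [[c]|[/eqP -> /row_spanP[c ->]]].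
  have [x' [y' [u' ->]]] := plane_sum_vecP c.
  rewrite plane_sum_vec_mul mulmx0 => /plane_sum_vec_inj[_ -> ->].
  by rewrite eqxx; split => //; apply/row_spanP; exists u'.
by exists (plane_sum_vec x 0 c); rewrite plane_sum_vec_mul mulmx0 mulmx1.
Qed.

Lemma transform_plane_lift n (h : 'M[A]_(n + n)) (L : {set 'rV[A]_(n + n)}) :
  transform (plane_sum_mx 1%:M 1%:M h) (plane_lift L) = plane_lift (transform h L).
Proof.
apply/setP => w; have [x [y [u ->]]] := plane_sum_vecP w.
rewrite mem_plane_lift; apply/imsetP/andP => [[v]|[/eqP -> /imsetP[v vL ->]]].
  have [x' [y' [u' ->]]] := plane_sum_vecP v.
  rewrite mem_plane_lift plane_sum_vec_mul !mulmx1 => /andP[/eqP -> u'L].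
  by move=> /plane_sum_vec_inj[_ -> ->]; rewrite eqxx; split => //; apply: imset_f.
by exists (plane_sum_vec x 0 v); rewrite ?mem_plane_lift ?eqxx // plane_sum_vec_mul !mulmx1.
Qed.

Lemma row_span_elemS n k : (k <= n)%N ->
  row_span (elem_mx p d A (1 + n) k) = plane_lift (row_span (elem_mx p d A n k)).
Proof.
by move=> kn; rewrite elem_mxS // p_exp0 raddf0 row_span_plane.
Qed.

Lemma thin_row n (v w : 'rV[A]_(n + n)) : n = 0%N -> v = w.
Proof. by move=> n0; move: v w; rewrite n0 => v w; rewrite thinmx0 [w]thinmx0. Qed.

Lemma row_span_elem_diag n : d = 1%N \/ n = 0%N ->
  row_span (elem_mx p d A n n) = p_multiples p d n.
Proof.
case=> [d1|n0]; last first.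
  apply/setP => v; rewrite (thin_row v 0 n0).
  apply/row_spanP/mem_p_multiples => _; exists 0.
    by rewrite scaler0.
  by rewrite mul0mx.
have -> : elem_mx p d A n n = p%:R%:M.
  rewrite /elem_mx -diag_const_mx; congr diag_mx.
  apply/rowP => i; rewrite !mxE.
  by case: splitP => j _; rewrite !mxE subnn ltn0 ?d1 expr1.
apply/setP => v; apply/row_spanP/mem_p_multiples => -[c ->]; exists c;
  by rewrite mul_mx_scalar.
Qed.

(** Modulo [p ^ 2] the multiples of [p] are their own orthogonal. *)
Lemma p_multiples_lagrangian n : d = 1%N \/ n = 0%N ->
  lagrangian (p_multiples p d n).
Proof.
case=> [d1|n0]; last first.
  apply/eqP/setP => v; rewrite (thin_row v 0 n0).
  apply/perpP/mem_p_multiples => _; first by exists 0; rewrite scaler0.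
  by move=> w _; rewrite !mul0mx.
apply/eqP/setP => w; apply/perpP/idP => [h|/mem_p_multiples[u ->] v /mem_p_multiples[u' ->]].
  have [v vE] := @redm_surj p pp d _ _ (w *m symp_form A n).
  have /choice[y yP] i : exists y, v 0 i = p%:R * y.
    have pi_p : p%:R *: delta_mx 0 i \in p_multiples p d n.
      by apply/mem_p_multiples; exists (delta_mx 0 i).
    have /matrixP/(_ 0 0) := h _ pi_p.
    rewrite linearZ /= -scalemxAr trmx_delta -colE -vE !mxE -(rmorph_nat (@red p pp d)) -rmorphM.
    move=> /red_eq0[y]; rewrite d1 exprS expr1 -mulrA => /(mulfI padic_p_neq0) ->.
    by exists y.
  apply/mem_p_multiples; exists (- (redm (\row_i y i) *m symp_form A n)).
  have -> : w = - (w *m symp_form A n *m symp_form A n).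
    by rewrite -mulmxA symp_form_sqr mulmxN mulmx1 opprK.
  rewrite -vE scalerN scalemxAl; congr (- (_ *m _)).
  by apply/rowP => i; rewrite !mxE yP rmorphM rmorph_nat.
rewrite linearZ /= -!scalemxAl -scalemxAr scalerA -expr2.
have e : 2%N = d.+1 by rewrite d1.
by rewrite e p_exp0 scale0r.
Qed.

(** The Cartan decomposition for the elementary divisors at hand: a primitive
    vector of [L] is moved to [e_vec], which splits off a hyperbolic plane. *)
Lemma lagrangian_cartan n (L : {set 'rV[A]_(n + n)}) : (d <= 1)%N ->
  lagrangian L -> exists k (g : 'M[Zp]_(n + n)),
    [/\ (k <= n)%N, d = 0%N -> k = 0%N, similitude 1 g &
        L = row_span (elem_mx p d A n k *m redm g)].
Proof.
move=> d1; elim: n L => [|n IH] L LL.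
  exists 0%N, 1%:M; split => //; first exact: similitude1.
  apply/setP => v; rewrite (thin_row v 0) // (lagrangian0 LL).
  by apply/esym/row_spanP; exists 0; rewrite mul0mx.
have [Lp|/subsetPn[v vL vp]] := boolP (L \subset p_multiples p d n.+1).
  have {}d1 : d = 1%N.
    apply/eqP; rewrite eqn_leq d1 /= lt0n; apply/negP => /eqP d0.
    have p0 : (p%:R : A) = 0 by rewrite -p_exp0 d0 expr1.
    have L0 v : v \in L -> v = 0.
      by move/(fintype.subsetP Lp) => /mem_p_multiples[u ->]; rewrite p0 scale0r.
    have : e_vec n = 0 :> 'rV[A]_(n.+1 + n.+1).
      by apply/L0/(lagrangianP LL) => v /L0 ->; rewrite trmx0 mulmx0.
    move/rowP/(_ (lshift n.+1 0)); rewrite row_mxEl !mxE => /eqP.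
    by rewrite oner_eq0.
  exists n.+1, 1%:M; split; rewrite ?d1 //; first exact: similitude1.
  rewrite map_mx1 mulmx1 row_span_elem_diag; last by left.
  apply/eqP; rewrite finset.eqEsubset Lp /=; apply/fintype.subsetP => w wp.
  apply/(lagrangianP LL) => v /(fintype.subsetP Lp) vp.
  have /lagrangianP LP : lagrangian (p_multiples p d n.+1).
    by apply: p_multiples_lagrangian; left.
  by apply: (elimT (LP w)).
have [w wE] := @redm_surj p pp d _ _ v.
rewrite -wE in vp; have [i wi] := primitive_lift vp.
have [g [gS gE]] := symplectic_transitive wi.
have gS' := similitude_map (@red p pp d) gS; rewrite rmorph1 in gS'.
have [gu _] := similitude_inv (unitr1 _) gS.
have [gu' _] := similitude_inv (unitr1 _) gS'.
have eL : e_vec n \in transform (redm g) L.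
  have -> : e_vec n = v *m redm g.
    rewrite -wE -map_mxM gE /e_vec map_row_mx map_mx0; congr row_mx.
    by rewrite map_delta_mx.
  by rewrite mem_transform.
have [|L' L'L LE] := plane_lift_surj _ eL.
  exact: (lagrangian_transform (unitr1 _) gS' LL).
have [k [h [kn k0 hS L'E]]] := IH _ L'L.
exists k, (plane_sum_mx 1%:M 1%:M h *m invmx g); split => //.
- exact: leqW.
- have hS' : similitude 1 (plane_sum_mx 1%:M 1%:M h).
    by apply: plane_sum_similitude => //; rewrite trmx1 mulmx1.
  by have := similitudeM hS' (similitudeV (unitr1 _) gS); rewrite invr1 mulr1.
rewrite -[LHS](transformK _ gu') LE L'E row_span_mulr -transform_plane_lift.
rewrite -row_span_elemS // map_mxM (map_invmx_unit (red d) gu).2 mulmxA !row_span_mulr.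
congr (transform _ (transform _ _)).
by rewrite map_plane_sum_mx !map_mx1.
Qed.

End Cartan.

(** * Numbers of Lagrangians and their incidence with vectors *)

Section Counting.
Context {p : nat} {pp : prime p} {d : nat}.
Local Notation Zp := (padic_int pp).
Local Notation A := 'Z_(p ^ d.+1).
Local Notation redm := (map_mx (@red p pp d)).

Lemma card_p_multiples n : #|p_multiples p d n| = (p ^ (d * (n + n)))%N.
Proof.
elim: n => [|n IH].
  rewrite muln0 expn0; apply/eqP/cards1P; exists 0; apply/setP => v.
  rewrite (thin_row v 0) // inE eqxx; apply/mem_p_multiples; exists 0.
  by rewrite scaler0.
pose pA := [set p%:R *: z | z in [set: 'M[A]_1]]%SET.
pose f (t : 'M[A]_1 * 'M[A]_1 * 'rV[A]_(n + n)) : 'rV[A]_((1 + n) + (1 + n)) :=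
  plane_sum_vec t.1.1 t.1.2 t.2.
have f_inj : injective f.
  by move=> [[x y] u] [[x' y'] u'] /plane_sum_vec_inj[/= -> -> ->].
have -> : p_multiples p d (1 + n) =
    (f @: finset.setX (finset.setX pA pA) (p_multiples p d n))%SET.
  apply/setP => w; have [x [y [u ->]]] := plane_sum_vecP w.
  rewrite p_multiples_plane.
  apply/and3P/imsetP => [[xp yp up]|[[[x' y'] u'] + /plane_sum_vec_inj[-> -> ->]]].
    by exists (x, y, u) => //; rewrite !finset.in_setX /= xp yp up.
  by rewrite !finset.in_setX /= -andbA => /and3P.
rewrite card_imset // !cardsX (@card_p_multiples_11 p pp) IH -!expnD; congr (p ^ _)%N.
lia.
Qed.

Lemma row_span_elem_spec n k : (d <= 1)%N -> (k <= n)%N -> (d = 0%N -> k = 0%N) ->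
  [/\ lagrangian (row_span (elem_mx p d A n k)),
      #|row_span (elem_mx p d A n k)| = (p ^ (d.+1 * n))%N &
      row_span (elem_mx p d A n k) \in lagrangians p d n k].
Proof.
move=> d1; elim: n => [|n IH] kn k0.
  have -> : k = 0%N by lia.
  rewrite row_span_elem_diag ?inE ?(@p_multiples_lagrangian p pp); try by right.
  by rewrite finset.setIid card_p_multiples !muln0 expn0 eqxx.
move: kn; rewrite leq_eqVlt => /predU1P[kE|kn]; last first.
  have [LL Lc Lk] := IH kn k0.
  rewrite row_span_elemS // plane_lift_lagrangians //; split => //.
    exact: lagrangian_plane_lift.
  by rewrite (@card_plane_lift p pp) Lc -expnD mulnS.
have {}d1 : d = 1%N by lia.
subst k.
rewrite row_span_elem_diag ?inE ?(@p_multiples_lagrangian p pp); try by left.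
rewrite finset.setIid card_p_multiples eqxx; split => //; congr (p ^ _)%N.
lia.
Qed.

Lemma lagrangian_cartan_type n (L : {set 'rV[A]_(n + n)}) : (d <= 1)%N ->
  lagrangian L -> exists k (g : 'M[Zp]_(n + n)),
    [/\ (k <= n)%N, d = 0%N -> k = 0%N, similitude 1 g,
        L = row_span (elem_mx p d A n k *m redm g) & L \in lagrangians p d n k].
Proof.
move=> d1 LL; have [k [g [kn k0 gS LE]]] := lagrangian_cartan d1 LL.
exists k, g; split => //.
have [_ _] := row_span_elem_spec d1 kn k0; rewrite LE row_span_mulr.
have := similitude_map (@red p pp d) gS; rewrite rmorph1 => gS'.
by rewrite (lagrangians_transform _ _ (unitr1 _) gS').
Qed.

Lemma card_lagrangian n (L : {set 'rV[A]_(n + n)}) : (d <= 1)%N ->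
  lagrangian L -> #|L| = (p ^ (d.+1 * n))%N.
Proof.
move=> d1 LL; have [k [g [kn k0 gS LE]]] := lagrangian_cartan d1 LL.
have := similitude_map (@red p pp d) gS; rewrite rmorph1 => gS'.
have [gu _] := similitude_inv (unitr1 _) gS'.
have [_ <- _] := row_span_elem_spec d1 kn k0.
by rewrite LE row_span_mulr card_transform.
Qed.

Lemma lagrangians_cartan n k (L : {set 'rV[A]_(n + n)}) : (d <= 1)%N ->
  (d = 0%N -> k = 0%N) -> L \in lagrangians p d n k ->
  exists2 g : 'M[Zp]_(n + n), similitude 1 g &
    (k <= n)%N /\ L = row_span (elem_mx p d A n k *m redm g).
Proof.
move=> d1 k0 Lk; have /andP[LL /eqP Lc] : lagrangian L && (#|L :&: p_multiples p d n| == p ^ (d * (n + k)))%N.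
  by move: Lk; rewrite inE.
have [k' [g [kn k0' gS LE]]] := lagrangian_cartan_type d1 LL.
rewrite inE LL Lc /= eqn_exp2l ?prime_gt1 // => /eqP kk'.
exists g => //; have -> : k = k'; last by [].
have [d0|d0] := posnP d; first by rewrite k0 // k0'.
by move: kk' => /eqP; rewrite eqn_pmul2l // eqn_add2l => /eqP.
Qed.

Lemma card_lagrangians_diag n : (d = 1%N \/ d = 0%N /\ n = 0%N) ->
  #|lagrangians p d n n| = 1%N.
Proof.
move=> h; have d1 : (d <= 1)%N by lia.
have k0 : d = 0%N -> n = 0%N by lia.
have h' : d = 1%N \/ n = 0%N by lia.
have [_ _] := row_span_elem_spec d1 (leqnn n) k0.
rewrite row_span_elem_diag // => pk.
apply/eqP/cards1P; exists (p_multiples p d n); apply/setP => L; rewrite [RHS]inE.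
apply/idP/eqP => [Lk|->//]; have [g gS [_ ->]] := lagrangians_cartan d1 k0 Lk.
have := similitude_map (@red p pp d) gS; rewrite rmorph1 => gS'.
have [gu _] := similitude_inv (unitr1 _) gS'.
rewrite row_span_mulr row_span_elem_diag //.
apply/setP => v; apply/imsetP/mem_p_multiples => [[w /mem_p_multiples[u ->] ->]|[u ->]].
  by exists (u *m redm g); rewrite scalemxAl.
exists (p%:R *: (u *m invmx (redm g))); last by rewrite -scalemxAl mulmxKV.
by apply/mem_p_multiples; exists (u *m invmx (redm g)).
Qed.

Lemma card_lagrangians_large n k : (d <= 1)%N -> (d = 0%N -> k = 0%N) -> (n < k)%N ->
  #|lagrangians p d n k| = 0%N.
Proof.
move=> d1 k0 nk; apply/eqP; rewrite cards_eq0; apply/eqP/setP => L.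
rewrite [RHS]inE; apply/negP => /(lagrangians_cartan d1 k0)[g _ []].
by rewrite leqNgt nk.
Qed.

Definition incident n k j :=
  #|[set L in lagrangians p d n.+1 k | (p%:R ^+ j *: e_vec n) \in L]%SET|.

(** The symplectic group moves any primitive vector to [e_vec]. *)
Lemma incident_primitive n k j (w : 'rV[Zp]_(n.+1 + n.+1)) i :
  w 0 i \is a GRing.unit ->
  #|[set L in lagrangians p d n.+1 k | (p%:R ^+ j *: redm w) \in L]%SET|
    = incident n k j.
Proof.
move=> wi; have [g [gS gE]] := symplectic_transitive wi.
have := similitude_map (@red p pp d) gS; rewrite rmorph1 => gS'.
rewrite -(card_lagrangians_mem _ _ (unitr1 _) gS') -scalemxAl -map_mxM gE.
by rewrite /incident /e_vec map_row_mx map_mx0 map_delta_mx.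
Qed.

(** The Lagrangians that contain [e_vec] are the lifts of those of rank one
    less. *)
Lemma incident0 n k : incident n k 0 = #|lagrangians p d n k|.
Proof.
rewrite -(card_imset _ (@plane_lift_inj p d n)) /incident expr0 scale1r.
apply: eq_card => L; rewrite inE; apply/andP/imsetP => [[Lk eL]|[L' L'k ->]].
  have LL : lagrangian L by move: Lk; rewrite inE => /andP[].
  have [L' L'L LE] := plane_lift_surj LL eL; exists L' => //.
  by rewrite -(@plane_lift_lagrangians p pp) -LE.
split; first by rewrite (@plane_lift_lagrangians p pp).
rewrite e_vecE mem_plane_lift eqxx /=.
by apply: lagrangian0; move: L'k; rewrite inE => /andP[].
Qed.

Lemma incident_top n k : incident n k d.+1 = #|lagrangians p d n.+1 k|.
Proof.
apply: eq_card => L; rewrite inE (@p_exp0 p pp) scale0r.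
have [|//] := boolP (L \in _); rewrite inE => /andP[LL _].
by rewrite lagrangian0.
Qed.

(** Both sides count the pairs of a Lagrangian [L] and an element of
    [L :&: T]. *)
Lemma double_count n k j (T : {set 'rV[A]_(n.+1 + n.+1)}) m :
  (forall v, v \in T -> exists i (w : 'rV[Zp]_(n.+1 + n.+1)),
      w 0 i \is a GRing.unit /\ v = p%:R ^+ j *: redm w) ->
  (forall L, L \in lagrangians p d n.+1 k -> #|L :&: T| = m) ->
  (#|lagrangians p d n.+1 k| * m = incident n k j * #|T|)%N.
Proof.
move=> TP LT; rewrite -sum_nat_const -(eq_bigr _ LT).
under eq_bigr do rewrite -sum1_card.
have -> : (\sum_(L in lagrangians p d n.+1 k) \sum_(v in L :&: T) 1 =
   \sum_(L in lagrangians p d n.+1 k) \sum_(v in T | v \in L) 1)%N.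
  by apply: eq_bigr => L _; apply: eq_bigl => v; rewrite inE andbC.
rewrite (exchange_big_dep (mem T)) /=; last by move=> L v _ /andP[].
rewrite mulnC -sum_nat_const; apply: eq_bigr => v vT.
have [i [w [wi vE]]] := TP v vT.
rewrite -(incident_primitive k j wi) -vE -sum1_card; apply: eq_bigl => L.
by rewrite inE vT.
Qed.

(** [double_count] applied to the primitive vectors. *)
Lemma lagrangians_rec n k : (d <= 1)%N ->
  (#|lagrangians p d n.+1 k| * (p ^ (d.+1 * n.+1) - p ^ (d * (n.+1 + k)))
    = #|lagrangians p d n k| *
      (p ^ (d.+1 * (n.+1 + n.+1)) - p ^ (d * (n.+1 + n.+1))))%N.
Proof.
move=> d1; rewrite -(incident0 n k).
have -> : (p ^ (d.+1 * (n.+1 + n.+1)) - p ^ (d * (n.+1 + n.+1)) =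
    #|~: p_multiples p d n.+1|)%N.
  rewrite -(card_p_multiples n.+1) [RHS]cardsCs finset.setCK card_mx mul1n.
  by rewrite (@card_A p pp) expnM.
apply: double_count => [v|L].
  rewrite finset.in_setC; have [w <-] := @redm_surj p pp d _ _ v.
  by move=> /primitive_lift[i wi]; exists i, w; rewrite expr0 scale1r.
rewrite inE => /andP[LL /eqP <-].
rewrite -(card_lagrangian d1 LL) -(cardsID (p_multiples p d n.+1) L) addKn.
by congr #|pred_of_set _|; apply/setP => v; rewrite !inE andbC.
Qed.

(** [double_count] applied to the nonzero multiples of [p], which modulo [p ^ 2]
    are the multiples by [p] of the primitive vectors. *)
Lemma incident_rec n k : d = 1%N ->
  (#|lagrangians p d n.+1 k| * (p ^ (n.+1 + k) - 1)
    = incident n k 1 * (p ^ (n.+1 + n.+1) - 1))%N.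
Proof.
move=> d1.
have c0 (S : {set 'rV[A]_(n.+1 + n.+1)}) : 0 \in S ->
    #|S :&: p_multiples p d n.+1 :\ 0| = (#|S :&: p_multiples p d n.+1| - 1)%N.
  move=> S0; rewrite [in RHS](cardsD1 0).
  have -> : 0 \in S :&: p_multiples p d n.+1.
    by rewrite inE S0; apply/mem_p_multiples; exists 0; rewrite scaler0.
  by rewrite addKn.
have -> : (p ^ (n.+1 + n.+1) - 1 = #|p_multiples p d n.+1 :\ 0%R|)%N.
  have := c0 finset.setT; rewrite finset.setTI card_p_multiples d1 mul1n => -> //.
  by rewrite inE.
apply: double_count => [v|L].
  rewrite !inE => /andP[v0 /mem_p_multiples[u uE]].
  have [w wE] := @redm_surj p pp d _ _ u.
  have [[i wi]|[x xE]] := padic_primitive_or_dvd w.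
    by exists i, w; rewrite expr1 wE.
  case/eqP: v0; rewrite uE -wE xE map_mxZ rmorph_nat scalerA -expr2.
  have e : 2%N = d.+1 by rewrite d1.
  by rewrite e (@p_exp0 p pp) scale0r.
rewrite inE => /andP[LL /eqP Lc].
have e : (d * (n.+1 + k) = n.+1 + k)%N by rewrite d1 mul1n.
by rewrite finset.setIDA (c0 _ (lagrangian0 LL)) Lc e.
Qed.

End Counting.

Arguments incident : clear implicits.

(** * Polynomiality in the prime *)

Section PolynomialQuotients.

Lemma poly_bound (T : {poly int}) b : (size T <= b.+1)%N ->
  exists C : int, forall x : int, 1 <= x -> `|T.[x]| <= C * x ^+ b.
Proof.
move=> Tb; exists (\sum_(i < b.+1) `|T`_i|) => x x1.
rewrite (horner_coef_wide _ Tb) mulr_suml; apply: le_trans (ler_norm_sum _ _ _) _.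
apply: ler_sum => i _; rewrite normrM ler_wpM2l // normrX.
rewrite ger0_norm ?(le_trans _ x1) //; apply: ler_weXn2l => //.
by rewrite -ltnS.
Qed.

(** The leading term of [P] is a nonzero integer times a power of [x] higher than
    those in [T]. *)
Lemma poly_dominated (P T : {poly int}) : (size T < size P)%N ->
  exists x0 : int, forall x, x0 <= x -> `|T.[x]| < `|P.[x]|.
Proof.
move=> TP; have P0 : P != 0 by rewrite -size_poly_gt0 (leq_ltn_trans _ TP).
case sP : (size P) TP => [|[|b]]; first by [].
  rewrite ltnS leqn0 size_poly_eq0 => /eqP ->; exists 0 => x _.
  have /size_poly1P[c c0 ->] : size P == 1%N by rewrite sP.
  by rewrite horner0 hornerC normr0 normr_gt0.
rewrite ltnS => TS.
pose P' := P - lead_coef P *: 'X^(b.+1).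
have P'S : (size P' <= b.+1)%N.
  apply/leq_sizeP => j bj; rewrite coefB coefZ coefXn.
  have [->|jb] := eqVneq j b.+1; first by rewrite mulr1 lead_coefE sP subrr.
  rewrite mulr0 subr0 nth_default // sP ltn_neqAle eq_sym jb //.
have [C CP] := poly_bound TS; have [C' C'P] := poly_bound P'S.
exists (Num.max 1 (C + C' + 1)) => x; rewrite ge_max => /andP[x1 xC].
have x0 : 0 < x by apply: lt_le_trans x1.
apply: le_lt_trans (CP _ x1) _.
have xb : 0 < x ^+ b by rewrite exprn_gt0.
have PE : P.[x] = lead_coef P * x ^+ b.+1 + P'.[x].
  by rewrite /P' hornerD hornerN hornerZ hornerXn addrC subrK.
have lc1 : 1 <= `|lead_coef P| by rewrite -gtz0_ge1 normr_gt0 lead_coef_eq0.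
have : `|lead_coef P * x ^+ b.+1| <= `|P.[x]| + `|P'.[x]|.
  by rewrite -[X in `|X| <= _](addrK P'.[x]) -PE ler_normB.
have : x ^+ b.+1 <= `|lead_coef P * x ^+ b.+1|.
  by rewrite normrM (gtr0_norm (exprn_gt0 _ x0)) ler_peMl // ltW // exprn_gt0.
have := C'P _ x1; rewrite exprS => h1 h2 h3.
have h4 : C * x ^+ b + C' * x ^+ b < x * x ^+ b.
  by rewrite -mulrDl ltr_pM2r // (lt_le_trans _ xC) // ltrDl.
rewrite -(ltrD2r (C' * x ^+ b)); apply: (lt_le_trans h4).
apply: (le_trans h2); apply: (le_trans h3).
by rewrite lerD2l.
Qed.

(** Divisibility of integers at all primes by a monic polynomial is divisibility
    of polynomials: the remainder is dominated by the divisor. *)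
Lemma monic_quotient (A B : {poly int}) (N : nat -> int) :
  A \is monic -> (forall p, prime p -> A.[p%:Z] != 0) ->
  (forall p, prime p -> N p * A.[p%:Z] = B.[p%:Z]) ->
  exists Q : {poly int}, forall p, prime p -> N p = Q.[p%:Z].
Proof.
move=> Am A0 NAB; pose Q := Pdiv.Ring.rdivp B A; pose T := Pdiv.Ring.rmodp B A.
have BE : B = Q * A + T by exact: Pdiv.RingMonic.rdivp_eq.
have TA : (size T < size A)%N by apply: Pdiv.Ring.ltn_rmodpN0; exact: monic_neq0.
have [x0 x0P] := poly_dominated TA.
have NQ p : prime p -> (N p - Q.[p%:Z]) * A.[p%:Z] = T.[p%:Z].
  by move=> pp; rewrite mulrBl NAB // BE hornerD hornerM addrC addrA addNr add0r.
have large x : exists2 p, prime p & x <= p%:Z.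
  have [p xp pp] := prime_above `|x|%N; exists p => //.
  by rewrite (le_trans (ler_norm x)) // -abszE lez_nat ltnW.
have T0 : T = 0.
  apply/eqP; apply: contrapT => /negP T0.
  have [|x1 x1P] := @poly_dominated T 0; first by rewrite size_poly0 size_poly_gt0.
  have [p pp] := large (Num.max x0 x1); rewrite ge_max => /andP[px0 px1].
  have := x0P _ px0; rewrite -NQ // normrM gtr_pMl ?normr_gt0 ?A0 //.
  rewrite ltNge -gtz0_ge1 normr_gt0 negbK => /eqP a0.
  by have := x1P _ px1; rewrite horner0 normr0 -NQ // a0 mul0r normr0 ltxx.
exists Q => p pp; apply/eqP; rewrite -subr_eq0.
have := NQ p pp; rewrite T0 horner0 => /eqP; rewrite mulf_eq0.
by rewrite (negPf (A0 _ pp)) orbF.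
Qed.

End PolynomialQuotients.

Section PolynomialCounts.
Variable d : nat.
Hypothesis d_le1 : (d <= 1)%N.

Lemma horner_Xn_sub (a b : nat) (p : nat) : (b <= a)%N -> prime p ->
  ('X^a - 'X^b : {poly int}).[p%:Z] = (p ^ a - p ^ b)%N%:Z.
Proof.
move=> ba pp; rewrite hornerD hornerN !hornerXn -!natz -!natrX natrB //.
by rewrite leq_exp2l // prime_gt1.
Qed.

Lemma monic_Xn_sub (a b : nat) : (b < a)%N -> ('X^a - 'X^b : {poly int}) \is monic.
Proof.
move=> ba; rewrite monicE lead_coefDl ?lead_coefXn //.
by rewrite size_polyN !size_polyXn.
Qed.

Lemma pexp_sub_neq0 (p a b : nat) : prime p -> (b < a)%N -> (p ^ a - p ^ b)%N%:Z != 0.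
Proof.
move=> pp ba; rewrite eqz_nat -lt0n subn_gt0 ltn_exp2l //; exact: prime_gt1.
Qed.

(** [lagrangians_rec] gives the induction step: for [k <= n.+1] the factor on its
    left-hand side is a monic polynomial in [p], except for [k = n.+1] and
    [d = 1], where it vanishes and there is only one Lagrangian. *)
Lemma card_lagrangians_poly n k : (d = 0%N -> k = 0%N) ->
  exists Q : {poly int}, forall p, prime p ->
    #|lagrangians p d n k|%:Z = Q.[p%:Z].
Proof.
move=> k0; elim: n => [|n [Q IH]].
  have [kp|kp] := posnP k.
    exists 1 => p pp; rewrite hornerC kp; congr (_%:Z).
    by apply: (@card_lagrangians_diag p pp); lia.
  exists 0 => p pp; rewrite horner0.
  by rewrite (@card_lagrangians_large p pp).
have [nk|kn] := ltnP n.+1 k.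
  by exists 0 => p pp; rewrite horner0 (@card_lagrangians_large p pp).
have [kE|kn'] := boolP ((k == n.+1) && (d == 1%N)).
  move/andP: kE => [/eqP -> /eqP dE]; exists 1 => p pp; rewrite hornerC; congr (_%:Z).
  by apply: (@card_lagrangians_diag p pp); left.
have lt1 : (d * (n.+1 + k) < d.+1 * n.+1)%N.
  by move: d_le1; rewrite leq_eqVlt ltnS leqn0 => /orP[/eqP dE|/eqP dE]; move: kn'; rewrite ?dE ?mul0n ?mul1n //; lia.
have lt2 : (d * (n.+1 + n.+1) < d.+1 * (n.+1 + n.+1))%N by rewrite ltn_pmul2r.
apply: (@monic_quotient ('X^(d.+1 * n.+1) - 'X^(d * (n.+1 + k)))
          (Q * ('X^(d.+1 * (n.+1 + n.+1)) - 'X^(d * (n.+1 + n.+1))))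
          (fun p => #|lagrangians p d n.+1 k|%:Z)).
- exact: monic_Xn_sub.
- by move=> p pp; rewrite horner_Xn_sub ?(ltnW lt1) // pexp_sub_neq0.
- move=> p pp; rewrite hornerM -IH // !horner_Xn_sub ?(ltnW lt1) ?(ltnW lt2) //.
  by rewrite -!PoszM (@lagrangians_rec p pp).
Qed.

Lemma incident_poly n k j : (d = 0%N -> k = 0%N) -> (j <= d.+1)%N ->
  exists Q : {poly int}, forall p, prime p -> (incident p d n k j)%:Z = Q.[p%:Z].
Proof.
move=> k0 jd; have [Q QP] := card_lagrangians_poly n k0.
have [Q' Q'P] := card_lagrangians_poly n.+1 k0.
have [->|j0] := eqVneq j 0%N.
  by exists Q => p pp; rewrite (@incident0 p pp) QP.
have [->|jd'] := eqVneq j d.+1.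
  by exists Q' => p pp; rewrite (@incident_top p pp) Q'P.
have dE : d = 1%N by lia.
have -> : j = 1%N by lia.
have nn : (0 < n.+1 + n.+1)%N by [].
apply: (@monic_quotient ('X^(n.+1 + n.+1) - 'X^0) (Q' * ('X^(n.+1 + k) - 'X^0))
          (fun p => (incident p d n k 1)%:Z)).
- exact: monic_Xn_sub.
- by move=> p pp; rewrite horner_Xn_sub // pexp_sub_neq0.
- move=> p pp; rewrite hornerM -Q'P // !horner_Xn_sub // -!PoszM expn0.
  by rewrite (@incident_rec p pp).
Qed.

End PolynomialCounts.

(** * Hecke cosets and Lagrangians *)

Section SimilitudeGroup.
Context {K : comUnitRingType} {n : nat}.
Implicit Types A B : 'M[K]_(n + n).

Lemma GSpP A : GSp K n A <-> exists2 mu, mu \is a GRing.unit & similitude mu A.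
Proof.
split=> [[_ [mu muu h]]|[mu muu h]]; first by exists mu.
by split; [have [] := similitude_inv muu h | exists mu].
Qed.

Lemma GSp_unit A : GSp K n A -> A \in unitmx. Proof. by case. Qed.

Lemma GSpM A B : GSp K n A -> GSp K n B -> GSp K n (A *m B).
Proof.
move=> /GSpP[a au hA] /GSpP[b bu hB]; apply/GSpP; exists (a * b).
  by rewrite unitrM au.
exact: similitudeM.
Qed.

Lemma GSpV A : GSp K n A -> GSp K n (invmx A).
Proof.
move=> /GSpP[a au hA]; apply/GSpP; exists a^-1; first by rewrite unitrV.
exact: similitudeV.
Qed.

Lemma GSp_similitude1 A : similitude 1 A -> GSp K n A.
Proof. by move=> h; apply/GSpP; exists 1; rewrite ?unitr1. Qed.

Lemma GSp_form : GSp K n (symp_form K n).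
Proof. exact/GSp_similitude1/similitude_form. Qed.

Lemma GSp_form_opp : GSp K n (- symp_form K n).
Proof.
apply: GSp_similitude1; have := @similitude_form K n.
by rewrite /similitude linearN /= mulmxN !mulNmx opprK.
Qed.

End SimilitudeGroup.

Lemma scale_invmxK (K : comUnitRingType) m (a : K) (M : 'M[K]_m) :
  a \is a GRing.unit -> M \in unitmx -> a *: invmx (a *: invmx M) = M.
Proof.
move=> au Mu; rewrite invmxZ ?invmxK; last by rewrite unitmxZ ?unitmx_inv.
by rewrite scalerA divrr // scale1r.
Qed.

Lemma mulmx_flip (K : comUnitRingType) m (c : K) (D F x y : 'M[K]_m) :
  D *m F = c%:M -> x \in unitmx -> y \in unitmx ->
  (x *m D *m y) *m (invmx y *m F *m invmx x) = c%:M.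
Proof.
move=> DF xu yu; rewrite !mulmxA mulmxK // -(mulmxA x) DF mul_mx_scalar.
by rewrite -scalemxAl mulmxV // scalemx1.
Qed.

Section ElementaryForm.
Variables (p d : nat) (K : comUnitRingType) (n k : nat).
Local Notation D := (elem_mx p d K n k).
Local Notation J := (symp_form K n).

Lemma tr_elem_mx : D^T = D. Proof. exact: tr_diag_mx. Qed.

Lemma elem_mx_similitude : similitude (p%:R ^+ d.+1) D.
Proof.
rewrite /elem_mx diag_mx_row; apply/similitude_blockP.
rewrite !trmx0 !mulmx0 !mul0mx subr0 tr_diag_mx mulmx_diag; split => //.
rewrite -diag_const_mx; congr diag_mx; apply/rowP => i; rewrite !mxE.
by case: ifP => _; rewrite ?mul1r // expr1 exprS.
Qed.

Lemma elem_mx_flip : D *m (- J *m D *m J) = (p%:R ^+ d.+1)%:M.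
Proof.
have := elem_mx_similitude; rewrite /similitude tr_elem_mx => DJD.
rewrite !mulNmx mulmxN !mulmxA DJD -scalemxAl symp_form_sqr scalerN opprK.
by rewrite scalemx1.
Qed.

Lemma elem_mx_flip' : (- J *m D *m J) *m D = (p%:R ^+ d.+1)%:M.
Proof.
have := elem_mx_similitude; rewrite /similitude tr_elem_mx => DJD.
rewrite !mulNmx -!mulmxA (mulmxA D) DJD -scalemxAr symp_form_sqr scalerN opprK.
by rewrite scalemx1.
Qed.

End ElementaryForm.

Section HeckeCosets.
Context {p : nat} {pp : prime p} {n : nat}.
Variable k : 'I_n.+1.
Local Notation Zp := (padic_int pp).
Local Notation Qp := (padic_num pp).
Local Notation toQp := (map_mx (@tofrac Zp)).

(** The similitude factor of the Hecke operator of index [k] is [p ^ d.+1]. *)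
Definition hecke_deg : nat := if k == 0%N :> nat then 0 else 1.
Local Notation d := hecke_deg.
Local Notation D := (elem_mx p d Zp n k).
Local Notation pd := (p%:R ^+ d.+1).

Lemma hecke_deg_le1 : (d <= 1)%N. Proof. by rewrite /hecke_deg; case: ifP. Qed.

Lemma hecke_deg0 : d = 0%N -> k = 0%N :> nat.
Proof. by rewrite /hecke_deg; case: ifP => // /eqP. Qed.

Lemma toQp_inj m l : injective (toQp : 'M_(m, l) -> _).
Proof.
by move=> x y /matrixP xy; apply/matrixP => i j; have := xy i j; rewrite !mxE => /tofrac_inj.
Qed.

Lemma hecke_mxE : hecke_mx pp k = toQp D.
Proof.
rewrite map_elem_mx /hecke_mx /elem_mx; congr diag_mx; apply/rowP => i.
rewrite !mxE /hecke_exp /hecke_deg.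
case: splitP => j ij; rewrite !mxE ij; congr (_ ^+ _).
  have [k0|_] := eqVneq (k : nat) 0%N; first by rewrite k0 subn0 ltn_ord.
  by [].
have [k0|_] := eqVneq (k : nat) 0%N; first by rewrite k0 subn0 ltn_ord.
have -> : (n + j < n - k)%N = false by lia.
by rewrite ltn_add2l.
Qed.

Lemma tofrac_pd : tofrac (pd : Zp) = pd.
Proof. by rewrite rmorphXn /= rmorph_nat. Qed.

Lemma pd_neq0 : (pd : Qp) != 0.
Proof. by rewrite expf_neq0 // padic_p_num_neq0. Qed.

Local Notation H := (dcoset (hecke_mx pp k)).

Lemma heckeP M : H M <-> exists x y,
  [/\ GSp Zp n x, GSp Zp n y & M = toQp (x *m D *m y)].
Proof.
split=> [[_ [x Gx <-] [_ [y Gy <-] <-]]|[x [y [Gx Gy ->]]]].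
  by exists x, y; rewrite hecke_mxE !map_mxM.
by exists (toQp x); [exists x | exists (toQp y); [exists y|rewrite hecke_mxE !map_mxM]].
Qed.

Lemma hecke_similitude M : H M -> exists2 u : Zp, u \is a GRing.unit &
  similitude (pd * tofrac u) M.
Proof.
move=> /heckeP[x [y [/GSpP[a au hx] /GSpP[b bu hy] ->]]].
exists (a * b); first by rewrite unitrM au.
have := similitudeM (similitudeM hx (elem_mx_similitude p d Zp n k)) hy.
move=> /(similitude_map (@tofrac Zp)).
by rewrite -mulrA mulrCA !rmorphM /= rmorphXn /= rmorph_nat.
Qed.

Lemma hecke_mu_unit (u : Zp) : u \is a GRing.unit ->
  (pd : Qp) * tofrac u \is a GRing.unit.
Proof.
move=> uu; rewrite unitrM; apply/andP; split; last exact: rmorph_unit.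
by rewrite unitfE; exact: pd_neq0.
Qed.

Lemma hecke_unit M : H M -> M \in unitmx.
Proof.
move=> /hecke_similitude[u uu hM].
by have [] := similitude_inv (hecke_mu_unit uu) hM.
Qed.

Lemma hecke_mull M x : GSp Zp n x -> H M -> H (toQp x *m M).
Proof.
move=> Gx /heckeP[a [b [Ga Gb ->]]]; apply/heckeP; exists (x *m a), b.
by split; [exact: GSpM | | rewrite !map_mxM !mulmxA].
Qed.

Lemma hecke_mulr M x : GSp Zp n x -> H M -> H (M *m toQp x).
Proof.
move=> Gx /heckeP[a [b [Ga Gb ->]]]; apply/heckeP; exists a, (b *m x).
by split; [ | exact: GSpM | rewrite !map_mxM !mulmxA].
Qed.

Lemma toQp_inv (x : 'M[Zp]_(n + n)) : GSp Zp n x ->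
  toQp x \in unitmx /\ toQp (invmx x) = invmx (toQp x).
Proof. by move=> /GSp_unit; exact: map_invmx_unit. Qed.

Definition flip (M : 'M[Qp]_(n + n)) := pd *: invmx M.

Lemma pd_unit : (pd : Qp) \is a GRing.unit.
Proof. by rewrite unitfE; exact: pd_neq0. Qed.

Lemma flipK M : M \in unitmx -> flip (flip M) = M.
Proof. exact: scale_invmxK pd_unit. Qed.

(** The inverse of the double coset is, up to [p ^ d.+1], the double coset:
    [symp_form] conjugates [D] into [p ^ d.+1 D^-1]. *)
Lemma hecke_flip M : H M -> H (flip M).
Proof.
move=> HM; have Mu := hecke_unit HM.
have /heckeP[x [y [Gx Gy ME]]] := HM; apply/heckeP.
exists (invmx y *m - symp_form Zp n), (symp_form Zp n *m invmx x); split.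
- by apply: GSpM; [exact: GSpV | exact: GSp_form_opp].
- by apply: GSpM; [exact: GSp_form | exact: GSpV].
have -> : invmx y *m - symp_form Zp n *m D *m (symp_form Zp n *m invmx x)
    = invmx y *m (- symp_form Zp n *m D *m symp_form Zp n) *m invmx x.
  by rewrite !mulmxA.
have := mulmx_flip (elem_mx_flip p d Zp n k) (GSp_unit Gx) (GSp_unit Gy).
move=> /(congr1 toQp); rewrite map_mxM -ME => MF.
apply: (can_inj (mulKmx Mu)); rewrite MF /flip -scalemxAr mulmxV // scalemx1.
by rewrite map_scalar_mx /= tofrac_pd.
Qed.

End HeckeCosets.

Section Reduction.
Context {p : nat} {pp : prime p} {n : nat}.
Variable k : 'I_n.+1.
Local Notation Zp := (padic_int pp).
Local Notation Qp := (padic_num pp).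
Local Notation toQp := (map_mx (@tofrac Zp)).
Local Notation d := (hecke_deg k).
Local Notation A := 'Z_(p ^ d.+1).
Local Notation redm := (map_mx (@red p pp d)).
Local Notation D := (elem_mx p d Zp n k).
Local Notation pd := (p%:R ^+ d.+1).
Local Notation H := (dcoset (hecke_mx pp k)).
Local Notation Lag := (lagrangians p d n k).

Lemma row_latticeP (M : 'M[Qp]_(n + n)) w :
  row_lattice M w <-> exists c : 'rV[Zp]_(n + n), w = toQp c *m M.
Proof. by split=> [[c _ <-]|[c ->]]; [exists c | exists c]. Qed.

Lemma row_lattice_mull (x : 'M[Zp]_(n + n)) (M : 'M[Qp]_(n + n)) :
  GSp Zp n x -> row_lattice (toQp x *m M) = row_lattice M.
Proof.
move=> /GSp_unit xu; apply/seteqP; split => w /row_latticeP[c ->]; apply/row_latticeP.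
  by exists (c *m x); rewrite map_mxM mulmxA.
exists (c *m invmx x); rewrite map_mxM !mulmxA -[_ *m toQp x]mulmxA -map_mxM.
by rewrite mulVmx // map_mx1 mulmx1.
Qed.

Definition lattice_red (M : 'M[Qp]_(n + n)) : {set 'rV[A]_(n + n)} :=
  [set v | `[< exists2 w : 'rV[Zp]_(n + n), redm w = v & row_lattice M (toQp w) >]]%SET.

Lemma lattice_redP M v : v \in lattice_red M <->
  exists2 w : 'rV[Zp]_(n + n), redm w = v & row_lattice M (toQp w).
Proof. by rewrite finset.in_set; split=> [/asboolP|/asboolP]. Qed.

Lemma lattice_redE (x y : 'M[Zp]_(n + n)) : GSp Zp n x -> GSp Zp n y ->
  lattice_red (toQp (x *m D *m y)) = transform (redm y) (row_span (elem_mx p d A n k)).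
Proof.
move=> Gx Gy; rewrite -row_span_mulr.
have [xu _] := map_invmx_unit (@red p pp d) (GSp_unit Gx).
rewrite -(row_span_mull _ xu) mulmxA -(map_elem_mx p d n k (@red p pp d)) -!map_mxM.
apply/setP => v; apply/idP/row_spanP => [|[c ->]].
  move=> /lattice_redP[w <- /row_latticeP[c]].
  rewrite -map_mxM => /toQp_inj ->; exists (redm c).
  by rewrite [LHS]map_mxM.
have [c' <-] := @redm_surj p pp d _ _ c.
apply/lattice_redP; exists (c' *m (x *m D *m y)); first by rewrite [LHS]map_mxM.
by apply/row_latticeP; exists c'; rewrite [LHS]map_mxM.
Qed.

Lemma lattice_red_lagrangians M : H M -> lattice_red M \in Lag.
Proof.
move=> /heckeP[x [y [Gx Gy ->]]]; rewrite lattice_redE //.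
have /GSpP[mu muu hy] := Gy.
have mu' : @red p pp d mu \is a GRing.unit by exact: rmorph_unit.
rewrite (lagrangians_transform _ _ mu' (similitude_map (@red p pp d) hy)).
have kn : (k <= n)%N by rewrite -ltnS.
by have [_ _] := @row_span_elem_spec p pp d n k (hecke_deg_le1 k) kn (@hecke_deg0 n k).
Qed.

Lemma hecke_lattice_pd M z : H M -> row_lattice M (toQp (pd *: z)).
Proof.
move=> /heckeP[x [y [Gx Gy ->]]]; apply/row_latticeP.
exists (z *m invmx y *m (- symp_form Zp n *m D *m symp_form Zp n) *m invmx x).
rewrite -map_mxM; congr toQp.
have := elem_mx_flip' p d Zp n k; move: (- symp_form Zp n *m D *m symp_form Zp n) => F FD.
rewrite !mulmxA mulmxKV ?(GSp_unit Gx) // -(mulmxA _ F) FD mul_mx_scalar.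
by rewrite -scalemxAl mulmxKV ?(GSp_unit Gy).
Qed.

Lemma row_latticeD (M : 'M[Qp]_(n + n)) u v :
  row_lattice M u -> row_lattice M v -> row_lattice M (u + v).
Proof.
move=> /row_latticeP[c ->] /row_latticeP[c' ->]; apply/row_latticeP.
by exists (c + c'); rewrite map_mxD mulmxDl.
Qed.

Lemma redm_eq0 (w : 'rV[Zp]_(n + n)) : redm w = 0 -> exists z, w = pd *: z.
Proof.
move=> /rowP w0; have /choice[z zP] i : exists z, w 0 i = pd * z.
  by apply/red_eq0; have := w0 i; rewrite !mxE.
by exists (\row_i z i); apply/rowP => i; rewrite !mxE.
Qed.

(** As the lattice contains [p ^ d.+1 Z_p^2n], it is determined by its
    reduction. *)
Lemma mem_lattice_red M (w : 'rV[Zp]_(n + n)) : H M ->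
  row_lattice M (toQp w) <-> redm w \in lattice_red M.
Proof.
move=> HM; split=> [h|/lattice_redP[w' /eqP]]; first by apply/lattice_redP; exists w.
rewrite -subr_eq0 -map_mxB => /eqP /redm_eq0[z zE] w'M.
rewrite -[w](subKr w') zE -scaleNr scaleNr -scalerN map_mxD.
exact: row_latticeD w'M (hecke_lattice_pd _ HM).
Qed.

Lemma hecke_lattice_int M w : H M -> row_lattice M w -> exists w', w = toQp w'.
Proof.
move=> /heckeP[x [y [Gx Gy ->]]] /row_latticeP[c ->].
by rewrite -map_mxM; eexists.
Qed.

Lemma lattice_red_surj L : L \in Lag -> exists2 M, H M & lattice_red M = L.
Proof.
move=> /(@lagrangians_cartan p pp d)[||g gS [kn ->]].
- exact: hecke_deg_le1.
- exact: hecke_deg0.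
have G1 : GSp Zp n 1%:M by apply/GSp_similitude1/similitude1.
have Gg := GSp_similitude1 gS.
exists (toQp (1%:M *m D *m g)); first by apply/heckeP; exists 1%:M, g.
by rewrite lattice_redE // row_span_mulr.
Qed.

Lemma lattice_red_eq M M' : H M -> H M' -> lattice_red M = lattice_red M' ->
  exists2 c : 'M[Zp]_(n + n), GSp Zp n c & M' = toQp c *m M.
Proof.
move=> HM HM' e.
have half N N' : H N -> H N' -> lattice_red N = lattice_red N' ->
    exists c : 'M[Zp]_(n + n), N' = toQp c *m N.
  move=> HN HN' eN; have /choice[c cP] i : exists c : 'rV[Zp]_(n + n), row i N' = toQp c *m N.
    have N'i : row_lattice N' (row i N').
      by apply/row_latticeP; exists (delta_mx 0 i); rewrite map_delta_mx -rowE.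
    have [w wE] := hecke_lattice_int HN' N'i.
    by apply/row_latticeP; move: N'i; rewrite wE => /(mem_lattice_red _ HN'); rewrite -eN => /(mem_lattice_red _ HN).
  exists (\matrix_i c i); apply/row_matrixP => i.
  by rewrite cP row_mul -map_row rowK.
have [c cE] := half _ _ HM HM' e; have [c' c'E] := half _ _ HM' HM (esym e).
exists c => //; split.
  have : toQp (c' *m c) = 1%:M.
    apply: (can_inj (mulmxK (hecke_unit HM))).
    by rewrite mul1mx map_mxM -mulmxA -cE -c'E.
  by rewrite -(map_mx1 (@tofrac Zp)) => /toQp_inj /mulmx1_unit[].
have [u uu hM] := hecke_similitude HM; have [u' uu' hM'] := hecke_similitude HM'.
exists (u' / u); first by rewrite unitrM uu' unitrV.
have hc : similitude (tofrac (u' / u)) (toQp c).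
  have -> : toQp c = M' *m invmx M by rewrite cE mulmxK // (hecke_unit HM).
  have := similitudeM hM' (similitudeV (hecke_mu_unit _ uu) hM).
  congr similitude.
  rewrite invrM; last first; [exact: rmorph_unit| exact: pd_unit|].
  rewrite mulrA -(mulrA pd) mulrC (mulKr (pd_unit k)).
  by rewrite -rmorphV // -rmorphM.
apply: toQp_inj; move: hc; rewrite /similitude !map_mxM map_mxZ map_trmx.
by rewrite !map_symp_form.
Qed.

End Reduction.

Lemma invmx_mul (K : comUnitRingType) m (M N : 'M[K]_m) :
  M \in unitmx -> N \in unitmx -> invmx (M *m N) = invmx N *m invmx M.
Proof.
move=> Mu Nu; have MNu : M *m N \in unitmx by rewrite unitmx_mul Mu.
apply: (can_inj (mulKmx MNu)); rewrite mulmxV // -mulmxA (mulmxA N) mulmxV //.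
by rewrite mul1mx mulmxV.
Qed.

(** Sums over cosets range over infinite types of sets of matrices; a bijection
    with a finite set turns them into finite sums. *)
Lemma fsum_bijection (I : choiceType) (T : finType) (V : nmodType) (P : set I)
    (S : {set T}) (h : I -> T) (F : I -> V) (G : T -> V) :
  (forall x, P x -> h x \in S) ->
  (forall x y, P x -> P y -> h x = h y -> x = y) ->
  (forall t, t \in S -> exists2 x, P x & h x = t) ->
  (forall x, P x -> F x = G (h x)) ->
  \sum_(x \in P) F x = \sum_(t in S) G t.
Proof.
move=> hS hinj hsurj FG.
rewrite (eq_fsbigr (fun x => G (h x))); last by move=> x /set_mem /FG.
rewrite -(@reindex_fsbig _ _ _ _ _ h P [set t | t \in S] G); last first.
  split=> [x /hS //|x y /set_mem Px /set_mem Py|t /hsurj[x Px <-]].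
    exact: hinj.
  by exists x.
rewrite -big_enum (@fsbig_seq _ _ _ _ _ _ (enum_uniq _)); apply: eq_fsbigl.
by apply/seteqP; split => t /=; rewrite mem_enum.
Qed.

Section CosetSums.
Context {p : nat} {pp : prime p} {n : nat}.
Variable k : 'I_n.+1.
Local Notation Zp := (padic_int pp).
Local Notation Qp := (padic_num pp).
Local Notation toQp := (map_mx (@tofrac Zp)).
Local Notation d := (hecke_deg k).
Local Notation H := (dcoset (hecke_mx pp k)).
Local Notation Lag := (lagrangians p d n k).

Lemma GSp1 : GSp Zp n 1%:M.
Proof. exact/GSp_similitude1/similitude1. Qed.

Lemma rcosetP (g M : 'M[Qp]_(n + n)) : rcoset g M <-> exists2 x, GSp Zp n x & M = toQp x *m g.
Proof.
split=> [[_ [x Gx <-] <-]|[x Gx ->]]; first by exists x.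
by exists (toQp x) => //; exists x.
Qed.

Lemma lcosetP (g M : 'M[Qp]_(n + n)) : lcoset g M <-> exists2 x, GSp Zp n x & M = g *m toQp x.
Proof.
split=> [[_ [x Gx <-] <-]|[x Gx ->]]; first by exists x.
by exists (toQp x) => //; exists x.
Qed.

Lemma toQpV_mulK (x : 'M[Zp]_(n + n)) m (M : 'M[Qp]_(n + n, m)) : GSp Zp n x ->
  toQp (invmx x) *m (toQp x *m M) = M.
Proof. by move=> Gx; rewrite mulmxA -map_mxM mulVmx ?(GSp_unit Gx) // map_mx1 mul1mx. Qed.

Lemma toQpV_mulKr (x : 'M[Zp]_(n + n)) m (M : 'M[Qp]_(m, n + n)) : GSp Zp n x ->
  M *m toQp x *m toQp (invmx x) = M.
Proof. by move=> Gx; rewrite -mulmxA -map_mxM mulmxV ?(GSp_unit Gx) // map_mx1 mulmx1. Qed.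

Lemma rcoset_eq (g : 'M[Qp]_(n + n)) x : GSp Zp n x -> rcoset (toQp x *m g) = rcoset g.
Proof.
move=> Gx; apply/seteqP; split => M /rcosetP[y Gy ->]; apply/rcosetP.
  by exists (y *m x); [exact: GSpM | rewrite map_mxM mulmxA].
exists (y *m invmx x); first by apply: GSpM => //; exact: GSpV.
by rewrite map_mxM -mulmxA toQpV_mulK.
Qed.

Lemma lcoset_eq (g : 'M[Qp]_(n + n)) x : GSp Zp n x -> lcoset (g *m toQp x) = lcoset g.
Proof.
move=> Gx; apply/seteqP; split => M /lcosetP[y Gy ->]; apply/lcosetP.
  by exists (x *m y); [exact: GSpM | rewrite map_mxM mulmxA].
exists (invmx x *m y); first by apply: GSpM => //; exact: GSpV.
by rewrite map_mxM mulmxA toQpV_mulKr.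
Qed.

Lemma rcoset_refl (g : 'M[Qp]_(n + n)) : rcoset g g.
Proof. by apply/rcosetP; exists 1%:M; [exact: GSp1 | rewrite map_mx1 mul1mx]. Qed.

Lemma lcoset_refl (g : 'M[Qp]_(n + n)) : lcoset g g.
Proof. by apply/lcosetP; exists 1%:M; [exact: GSp1 | rewrite map_mx1 mulmx1]. Qed.

(** A right coset [Gamma M] corresponds to the row lattice of [M]. *)
Lemma sum_right_cosets (V : nmodType) (F : set 'M[Qp]_(n + n) -> V) G :
  (forall M, H M -> F (rcoset M) = G (lattice_red k M)) ->
  \sum_(Y \in [set rcoset M | M in H]) F Y = \sum_(L in Lag) G L.
Proof.
move=> FG; pose r (Y : set 'M[Qp]_(n + n)) := xget 1%:M Y.
have rP M : H M -> exists2 x, GSp Zp n x & r (rcoset M) = toQp x *m M.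
  by move=> HM; apply/rcosetP; apply: (@xgetPex _ _ (rcoset M)); exists M; exact: rcoset_refl.
have hE M : H M -> lattice_red k (r (rcoset M)) = lattice_red k M.
  move=> HM; have [x Gx ->] := rP M HM.
  by rewrite /lattice_red row_lattice_mull.
apply: (@fsum_bijection _ _ _ _ _ (fun Y => lattice_red k (r Y))).
- by move=> _ [M HM <-]; rewrite hE //; exact: lattice_red_lagrangians.
- move=> _ _ [M HM <-] [M' HM' <-]; rewrite !hE // => /(lattice_red_eq HM HM')[c Gc ->].
  by rewrite rcoset_eq.
- move=> L /(@lattice_red_surj p pp)[M HM <-]; exists (rcoset M); first by exists M.
  exact: hE.
- by move=> _ [M HM <-]; rewrite hE // FG.
Qed.

(** A left coset [h Gamma] corresponds to the row lattice of [p ^ d.+1 h^-1]. *)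
Lemma sum_left_cosets (V : nmodType) (F : set 'M[Qp]_(n + n) -> V) G :
  (forall X, hecke_cosets pp k X -> H (coset_repr X) ->
     F X = G (lattice_red k (flip k (coset_repr X)))) ->
  \sum_(X \in hecke_cosets pp k) F X = \sum_(L in Lag) G L.
Proof.
move=> FG.
have rP h : H h -> exists2 x, GSp Zp n x & coset_repr (lcoset h) = h *m toQp x.
  by move=> Hh; apply/lcosetP; apply: (@xgetPex _ _ (lcoset h)); exists h; exact: lcoset_refl.
have rH h : H h -> H (coset_repr (lcoset h)).
  by move=> Hh; have [x Gx ->] := rP h Hh; exact: hecke_mulr.
have flipM (h : 'M[Qp]_(n + n)) x : H h -> GSp Zp n x ->
    flip k (h *m toQp x) = toQp (invmx x) *m flip k h.
  move=> Hh Gx; have [xu xV] := toQp_inv Gx.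
  rewrite /flip -scalemxAr xV; congr ( _ *: _).
  have hu := hecke_unit Hh.
  exact: (invmx_mul hu xu).
have hE h : H h -> lattice_red k (flip k (coset_repr (lcoset h))) = lattice_red k (flip k h).
  move=> Hh; have [x Gx ->] := rP h Hh; rewrite (flipM _ _ Hh Gx).
  by rewrite /lattice_red (row_lattice_mull _ (GSpV Gx)).
have inj h h' : H h -> H h' ->
    lattice_red k (flip k (coset_repr (lcoset h))) =
    lattice_red k (flip k (coset_repr (lcoset h'))) -> lcoset h = lcoset h'.
  move=> Hh Hh' e0; have ee := etrans (esym (hE _ Hh)) (etrans e0 (hE _ Hh')).
  have [c Gc e] := lattice_red_eq (hecke_flip Hh) (hecke_flip Hh') ee.
  have e' : flip k (h *m toQp (invmx c)) = flip k h'.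
    by rewrite (flipM _ _ Hh (GSpV Gc)) invmxK e.
  have Hc := hecke_mulr (GSpV Gc) Hh.
  have -> : h' = h *m toQp (invmx c).
    by rewrite -(flipK k (hecke_unit Hh')) -e' (flipK k (hecke_unit Hc)).
  exact/esym/lcoset_eq/(GSpV Gc).
have surj L : L \in Lag -> exists2 X, hecke_cosets pp k X &
    lattice_red k (flip k (coset_repr X)) = L.
  move=> /(@lattice_red_surj p pp)[M HM <-]; exists (lcoset (flip k M)).
    by exists (flip k M) => //; exact: hecke_flip.
  by rewrite (hE _ (hecke_flip HM)) (flipK k (hecke_unit HM)).
apply: (@fsum_bijection _ _ _ _ _ (fun X => lattice_red k (flip k (coset_repr X)))).
- by move=> _ [h Hh <-]; rewrite (hE _ Hh); exact/lattice_red_lagrangians/hecke_flip.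
- by move=> _ _ [h Hh <-] [h' Hh' <-] /(inj _ _ Hh Hh').
- exact: surj.
- move=> _ [h Hh <-]; apply: FG; first by exists h.
  exact: rH.
Qed.

End CosetSums.

(** * The Hecke action on Ehrhart polynomials *)

Lemma poly_eq_nat (F G : {poly rat}) :
  (forall m, (0 < m)%N -> F.[m%:R] = G.[m%:R]) -> F = G.
Proof.
move=> FG; apply/eqP; rewrite -subr_eq0; apply: contrapT => /negP H0.
pose rs : seq rat := [seq i%:R | i <- iota 1 (size (F - G))].
have : (size rs < size (F - G)%R)%N.
  apply: max_poly_roots => //.
    apply/allP => _ /mapP[i + ->]; rewrite mem_iota => /andP[i0 _].
    by rewrite rootE hornerD hornerN FG // subrr.
  by rewrite map_inj_uniq ?iota_uniq // => i j /eqP; rewrite eqr_nat => /eqP.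
by rewrite size_map size_iota ltnn.
Qed.

(** The coefficientwise form of the substitution [T |-> c T]. *)
Definition scale_arg (c : rat) (E : {poly rat}) : {poly rat} :=
  \poly_(i < size E) (c ^+ i * E`_i).

Lemma horner_scale_arg c E x : (scale_arg c E).[x] = E.[c * x].
Proof.
rewrite horner_poly horner_coef; apply: eq_bigr => i _.
by rewrite exprMn mulrAC mulrC.
Qed.

Lemma coef_scale_arg c E i : (scale_arg c E)`_i = c ^+ i * E`_i.
Proof.
by rewrite coef_poly; case: ltnP => // h; rewrite nth_default ?mulr0.
Qed.

Section PadicLattices.
Context {p : nat} {pp : prime p} {n : nat}.
Local Notation Zp := (padic_int pp).
Local Notation Qp := (padic_num pp).
Local Notation toQp := (map_mx (@tofrac Zp)).
Local Notation ratQ := (map_mx (ratr : rat -> Qp)).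

Definition integral (w : 'rV[Qp]_(n + n)) := exists w' : 'rV[Zp]_(n + n), w = toQp w'.

(** Every nonzero denominator is a power of [p] times a unit. *)
Lemma padic_denominator (x : Qp) : exists t, exists z : Zp, p%:R ^+ t * x = tofrac z.
Proof.
have [a [b [b0 xb]]] := fractionP x.
have [j [u [uu bE]]] := padic_valuation b0.
exists j, (a * u^-1); rewrite [RHS]rmorphM rmorphV //= -xb bE rmorphM rmorphXn /= rmorph_nat.
have u0 : (tofrac u : Qp) \is a GRing.unit by exact: rmorph_unit.
by rewrite -mulrA (mulrK u0) mulrC.
Qed.

Lemma padic_denominator_mx a b (M : 'M[Qp]_(a, b)) :
  exists t, exists N : 'M[Zp]_(a, b), p%:R ^+ t *: M = toQp N.
Proof.
have /choice[t tP] (ij : 'I_a * 'I_b) := padic_denominator (M ij.1 ij.2).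
have /choice[z zP] := tP.
pose T := (\sum_ij t ij)%N; exists T.
exists (\matrix_(i, j) (p%:R ^+ (T - t (i, j)) * z (i, j))).
apply/matrixP => i j; rewrite !mxE rmorphM rmorphXn /= rmorph_nat -(zP (i, j)).
rewrite mulrA -exprD subnK // /T (bigD1 (i, j)) //=; exact: leq_addr.
Qed.

Lemma integral_mul (w : 'rV[Qp]_(n + n)) (N : 'M[Zp]_(n + n)) :
  integral w -> integral (w *m toQp N).
Proof. by move=> [w' ->]; exists (w' *m N); rewrite map_mxM. Qed.

Lemma integralD (v w : 'rV[Qp]_(n + n)) : integral v -> integral w -> integral (v + w).
Proof. by move=> [v' ->] [w' ->]; exists (v' + w'); rewrite map_mxD. Qed.

Lemma integralZ (c : Zp) (w : 'rV[Qp]_(n + n)) : integral w -> integral (tofrac c *: w).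
Proof. by move=> [w' ->]; exists (c *: w'); rewrite map_mxZ. Qed.

Lemma integral_pZ t (w : 'rV[Qp]_(n + n)) : integral w -> integral (p%:R ^+ t *: w).
Proof.
by move=> /(integralZ (p%:R ^+ t)); rewrite rmorphXn /= rmorph_nat.
Qed.

Lemma integral_int (w : 'rV[int]_(n + n)) : integral (ratQ (map_mx intr w)).
Proof.
exists (map_mx intr w); apply/rowP => i; rewrite !mxE ratr_int.
by rewrite rmorph_int.
Qed.

Lemma ratQD (x y : 'rV[rat]_(n + n)) : ratQ (x + y) = ratQ x + ratQ y.
Proof.
have r0 : (ratr 0 : Qp) = 0 by exact: (ratr_nat Qp 0).
have rN z : (ratr (- z) : Qp) = - ratr z by rewrite -sub0r ratr_padicB r0 sub0r.
by apply/rowP => i; rewrite !mxE -[y 0 i in LHS]opprK ratr_padicB rN opprK.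
Qed.

Lemma ratQZ (c : rat) (x : 'rV[rat]_(n + n)) : ratQ (c *: x) = ratr c *: ratQ x.
Proof. by apply/rowP => i; rewrite !mxE ratr_padicM.2. Qed.

Lemma ratr_p t : ratr (p%:R ^+ t) = p%:R ^+ t :> Qp.
Proof. by rewrite -natrX ratr_nat natrX. Qed.

Lemma row_lattice_inv (g : 'M[Qp]_(n + n)) w : g \in unitmx ->
  row_lattice (invmx g) w <-> integral (w *m g).
Proof.
move=> gu; split=> [/row_latticeP[c ->]|[c cE]].
  by exists c; rewrite (mulmxKV gu).
by apply/row_latticeP; exists c; rewrite -cE (mulmxK gu).
Qed.

Lemma GplusP (g : 'M[Qp]_(n + n)) : Gplus pp n g ->
  g \in unitmx /\ exists N : 'M[Zp]_(n + n), g = toQp N.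
Proof.
move=> Gg.
have gu := GSp_unit (proj1 Gg).
have [N _ NE] := proj2 Gg.
split; first exact: gu.
exists N.
exact: (esym NE).
Qed.

Lemma ehrhart_act_spec (R : realType) (P : set 'rV[R]_(n + n)) g : Gplus pp n g ->
  lattice_polytope P ->
  is_ehrhart (rat_lattice (row_lattice (invmx g))) P (ehrhart_act pp P g).
Proof.
move=> /GplusP[gu [N gN]] PP.
have [t [V VE]] := padic_denominator_mx (invmx g).
apply: (@ehrhart_spec R _ P _ (p ^ t)) => //.
- by rewrite expn_gt0 prime_gt0.
- move=> x w [xp /(row_lattice_inv _ gu) xg]; split.
    move=> i; have [s sx] := xp i; exists s; rewrite !mxE mulrDr rpredD //.
    by rewrite rpredM ?rpredX ?rpred_nat // rpred_int.
  apply/(row_lattice_inv _ gu); rewrite ratQD mulmxDl; apply: integralD => //.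
  by rewrite gN; apply/integral_mul/integral_int.
- move=> x [xp /row_latticeP[c cE]] i; have [s sx] := xp i.
  have e : ratr (p%:R ^+ t * x 0 i) = tofrac ((c *m V) 0 i).
    have /rowP/(_ i) : p%:R ^+ t *: ratQ x = toQp (c *m V).
      by rewrite cE scalemxAr VE map_mxM.
    by rewrite !mxE ratr_padicM.2 ratr_p.
  rewrite natrX; apply: (@rat_int_of_padic p pp _ s _ _ e).
  by rewrite mulrCA rpredM // rpredX // rpred_nat.
Qed.

End PadicLattices.

Section HeckeEigen.
Context {p : nat} {pp : prime p} {n : nat}.
Variable k : 'I_n.+2.
Local Notation Zp := (padic_int pp).
Local Notation Qp := (padic_num pp).
Local Notation toQp := (map_mx (@tofrac Zp)).
Local Notation d := (hecke_deg k).
Local Notation redm := (map_mx (@red p pp d)).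
Local Notation pd := (p%:R ^+ d.+1).
Local Notation Lag := (lagrangians p d n.+1 k).
Local Notation V := 'rV[Qp]_(n.+1 + n.+1).

(** A lattice is recovered from its Lagrangian through division by [p ^ d.+1],
    so this is the number of lattices of type [k] containing [e_vec / p ^ j]. *)
Definition depth_count j := incident p d n k (d.+1 - j).

Definition integral_at (x : V) (j : nat) : bool := `[< integral (p%:R ^+ j *: x) >].

Definition integral_before (x : V) (j : nat) : bool :=
  if j is i.+1 then integral_at x i else false.

(** Only the term of the least [j] such that [p ^ j x] is integral is not 0. For
    this [j] the vector [p ^ j x] is primitive, unless [j] is 0 and [x] lies in all
    the lattices. *)
Lemma depth_count_sum (x : V) (w : 'rV[Zp]_(n.+1 + n.+1)) : pd *: x = toQp w ->
  (#|[set L in Lag | redm w \in L]%SET|%:R : rat) =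
  \sum_(j < d.+2) (depth_count j)%:R *
     ((integral_at x j)%:R - (integral_before x j)%:R).
Proof.
move=> xw; pose I := integral_at x.
have IP j : I j <-> integral (p%:R ^+ j *: x) by split=> /asboolP.
have Itop : I d.+1 by apply/IP; exists w.
have exI : exists j, I j by exists d.+1.
have Imono i j : (i <= j)%N -> I i -> I j.
  move=> ij /IP Ii; apply/IP; rewrite -(subnK ij) exprD -scalerA.
  exact: integral_pZ.
case: (ex_minnP exI) => j0 Ij0 jmin.
have j0d : (j0 < d.+2)%N by rewrite ltnS jmin.
rewrite (bigD1 (Ordinal j0d)) //= [X in _ + X]big1 ?addr0; last first.
  move=> [j jd] /= jj0; have {}jj0 : j != j0 by apply: contraNneq jj0 => jj0; apply/eqP/val_inj.
  rewrite -/(I j); have [jlt|jge|/eqP] := ltngtP j j0; last by rewrite (negPf jj0).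
    have NI i : (i <= j)%N -> I i = false.
      by move=> ij; apply/negP => /jmin; rewrite leqNgt (leq_ltn_trans ij jlt).
    have -> : integral_before x j = false.
      by case: j NI {jd jj0 jlt} => // j NI; exact/NI/leqnSn.
    by rewrite NI // subrr mulr0.
  have -> : integral_before x j = true.
    by case: j jge {jd jj0} => // j jge; exact: Imono Ij0.
  by rewrite (Imono _ _ (ltnW jge) Ij0) subrr mulr0.
have -> : integral_before x j0 = false.
  case: j0 Ij0 jmin {j0d} => // j _ jmin; apply/negP => /jmin.
  by rewrite ltnn.
rewrite -/(I j0) Ij0 subr0 mulr1; congr (_%:R).
have /IP[y yE] := Ij0.
have wy : w = p%:R ^+ (d.+1 - j0) *: y.
  apply: toQp_inj; rewrite -xw map_mxZ rmorphXn /= rmorph_nat -yE scalerA -exprD.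
  by rewrite subnK.
have [jz|jp] := posnP j0.
  rewrite /depth_count jz subn0 (@incident_top p pp); apply: eq_card => L.
  rewrite inE wy jz subn0 map_mxZ rmorphXn /= rmorph_nat (@p_exp0 p pp) scale0r.
  have [|//] := boolP (L \in _); rewrite inE => /andP[LL _].
  by rewrite lagrangian0.
have [[i yi]|[z zE]] := padic_primitive_or_dvd y.
  rewrite /depth_count -(incident_primitive k _ yi).
  by rewrite wy map_mxZ rmorphXn /= rmorph_nat.
have : I j0.-1.
  apply/IP; exists z; apply: (scalerI padic_p_num_neq0).
  rewrite scalerA -exprS prednK // yE zE map_mxZ rmorph_nat //.
by move=> /jmin; rewrite -ltnS prednK // ltnn.
Qed.

End HeckeEigen.

Section HeckeEhrhart.
Context {p : nat} {pp : prime p} {n : nat}.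
Variable k : 'I_n.+2.
Local Notation Zp := (padic_int pp).
Local Notation Qp := (padic_num pp).
Local Notation toQp := (map_mx (@tofrac Zp)).
Local Notation ratQ := (map_mx (ratr : rat -> Qp)).
Local Notation d := (hecke_deg k).
Local Notation A := 'Z_(p ^ d.+1).
Local Notation redm := (map_mx (@red p pp d)).
Local Notation pd := (p%:R ^+ d.+1).
Local Notation H := (dcoset (hecke_mx pp k)).
Local Notation Lag := (lagrangians p d n.+1 k).
Local Notation V := 'rV[Qp]_(n.+1 + n.+1).

Lemma flip_lattice (g h : 'M[Qp]_(n.+1 + n.+1)) (v : V) : g \in unitmx -> H h ->
  row_lattice (invmx (g *m h)) v <-> row_lattice (flip k h) (pd *: (v *m g)).
Proof.
move=> gu Hh; have hu := hecke_unit Hh; rewrite (invmx_mul gu hu).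
split=> /row_latticeP[c cE]; apply/row_latticeP; exists c.
  by rewrite cE mulmxA (mulmxKV gu) /flip -scalemxAr.
apply: (can_inj (mulmxK gu)); apply: (scalerI (pd_neq0 k)).
by rewrite cE mulmxA (mulmxKV gu) /flip -scalemxAr.
Qed.

(** The lattice that contains the row lattice of [g^-1] and whose image under
    [v |-> p ^ d.+1 v g] has reduction [L]. *)
Definition overlattice (g : 'M[Qp]_(n.+1 + n.+1)) (L : {set 'rV[A]_(n.+1 + n.+1)}) : set V :=
  [set v | exists2 w, pd *: (v *m g) = toQp w & redm w \in L].

Lemma overlattice_flip (g h : 'M[Qp]_(n.+1 + n.+1)) : g \in unitmx -> H h ->
  row_lattice (invmx (g *m h)) = overlattice g (lattice_red k (flip k h)).
Proof.
move=> gu Hh; have HF := hecke_flip Hh; apply/seteqP; split => v.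
  move=> /(flip_lattice _ gu Hh) vF; have [w wE] := hecke_lattice_int HF vF.
  by exists w => //; apply/(mem_lattice_red _ HF); rewrite -wE.
move=> [w wE /(mem_lattice_red _ HF) wF]; apply/(flip_lattice _ gu Hh).
by rewrite wE.
Qed.

Variables (R : realType) (P : set 'rV[R]_(n.+1 + n.+1)).
Hypothesis P_polytope : lattice_polytope P.
Variable g : 'M[Qp]_(n.+1 + n.+1).
Hypothesis Gg : Gplus pp n.+1 g.
Local Notation E := (ehrhart_act pp P g).

Lemma Gplus_hecke h : H h -> Gplus pp n.+1 (g *m h).
Proof.
move=> Hh; have [u uu hS] := hecke_similitude Hh.
have Gh : GSp Qp n.+1 h.
  by apply/GSpP; exists (pd * tofrac u) => //; exact: hecke_mu_unit.
split; first exact: (GSpM (proj1 Gg) Gh).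
have [_ [N ->]] := GplusP Gg.
have /heckeP[x [y [_ _ ->]]] := Hh.
by exists (N *m (x *m elem_mx p d Zp n.+1 k *m y)); rewrite // map_mxM.
Qed.

Lemma hecke_ehrhartE : hecke_ehrhart pp P k g =
  \sum_(L in Lag) ehrhart (rat_lattice (overlattice g L)) P.
Proof.
have [gu _] := GplusP Gg.
apply: sum_left_cosets => X _ HX.
by rewrite /ehrhart_act (overlattice_flip gu HX).
Qed.

Lemma overlattice_ehrhart L : L \in Lag ->
  is_ehrhart (rat_lattice (overlattice g L)) P (ehrhart (rat_lattice (overlattice g L)) P).
Proof.
move=> /(@lattice_red_surj p pp)[M HM <-]; have [gu _] := GplusP Gg.
have HF := hecke_flip HM.
have := overlattice_flip gu HF; rewrite (flipK k (hecke_unit HM)) => <-.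
exact: ehrhart_act_spec (Gplus_hecke HF) P_polytope.
Qed.

Definition points m j : set 'rV[rat]_(n.+1 + n.+1) :=
  [set v | dilate m P (map_mx ratr v) /\
           rat_lattice [set x | integral (p%:R ^+ j *: (x *m g))] v].

(** Scaling by [p ^ j] identifies these points with the points of [p ^ j m P] in
    the lattice of [g]. *)
Lemma points_card m j : (0 < m)%N -> exists2 N : nat, (points m j #= `I_N)%card &
  E.[p%:R ^+ j * m%:R] = N%:R.
Proof.
move=> m0; have pj0 : (0 < p ^ j)%N by rewrite expn_gt0 prime_gt0.
have [gu _] := GplusP Gg.
have pjr : (p%:R ^+ j : rat) != 0 by rewrite -natrX pnatr_eq0 -lt0n.
have pjR : (p%:R ^+ j : R) != 0 by rewrite -natrX pnatr_eq0 -lt0n.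
have [|N NP EN] := ehrhart_act_spec Gg P_polytope (m := (p ^ j * m)%N).
  by rewrite muln_gt0 pj0.
exists N; last by rewrite -EN natrM natrX.
have f_inj : {in points m j &, injective ( *:%R (p%:R ^+ j) : 'rV[rat]_(n.+1 + n.+1) -> _)}.
  by move=> x y _ _; apply: scalerI.
apply: card_eq_trans NP; rewrite card_eq_sym.
apply: card_eq_trans (inj_card_eq f_inj).
have -> // : [set v | dilate (p ^ j * m) P (map_mx ratr v) /\
    rat_lattice (row_lattice (invmx g)) v] = ( *:%R (p%:R ^+ j)) @` points m j.
have dil v : dilate (p ^ j * m) P (map_mx ratr (p%:R ^+ j *: v)) <-> dilate m P (map_mx ratr v).
  have -> : map_mx (ratr : rat -> R) (p%:R ^+ j *: v) = p%:R ^+ j *: map_mx ratr v.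
    by apply/rowP => i; rewrite !mxE rmorphM rmorphXn /= ratr_nat.
  rewrite /dilate natrM natrX; split=> -[y Py yE]; exists y => //.
    by apply: (scalerI pjR); rewrite scalerA.
  by rewrite -scalerA yE.
have lat v : rat_lattice (row_lattice (invmx g)) (p%:R ^+ j *: v) <->
    rat_lattice [set x | integral (p%:R ^+ j *: (x *m g))] v.
  split=> -[vp vg]; split.
  - move=> i; have [s] := vp i; rewrite !mxE mulrA -exprD => ?; by exists (s + j)%N.
  - move/(row_lattice_inv _ gu): vg; rewrite ratQZ ratr_p -scalemxAl; exact.
  - move=> i; have [s si] := vp i; exists s; rewrite !mxE mulrCA rpredM //.
    by rewrite -natrX rpred_nat.
  - by apply/(row_lattice_inv _ gu); rewrite ratQZ ratr_p -scalemxAl.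
apply/seteqP; split=> [v [vd vl]|_ [v [vd vl] <-]]; last by split; [exact/dil | exact/lat].
exists ((p%:R ^+ j)^-1 *: v); last by rewrite scalerA divff // scale1r.
by split; [apply/dil | apply/lat]; rewrite scalerA divff // scale1r.
Qed.

Definition scaled_vector (v : 'rV[rat]_(n.+1 + n.+1)) : 'rV[Zp]_(n.+1 + n.+1) :=
  xget 0 [set w | pd *: (ratQ v *m g) = toQp w].

Lemma scaled_vectorP v : integral (pd *: (ratQ v *m g)) ->
  pd *: (ratQ v *m g) = toQp (scaled_vector v).
Proof.
move=> [w wE].
exact: (@xgetPex _ 0 [set w | pd *: (ratQ v *m g) = toQp w] (ex_intro _ w wE)).
Qed.

(** All the lattices attached to [g] and to a Lagrangian lie in the one that
    defines [points m d.+1], so that their points are among a common finite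
    set. *)
Lemma ehrhart_overlattice m L : (0 < m)%N -> L \in Lag ->
  (ehrhart (rat_lattice (overlattice g L)) P).[m%:R] =
  \sum_(v <- fset_set (points m d.+1)) (redm (scaled_vector v) \in L)%:R.
Proof.
move=> m0 LL; have [N NP ->] := overlattice_ehrhart LL m0.
have [N' fin _] := points_card d.+1 m0.
have {}fin : finite_set (points m d.+1) by exists N'.
have setE : [set v | dilate m P (map_mx ratr v) /\ rat_lattice (overlattice g L) v] =
    [set` [fset v in fset_set (points m d.+1) | redm (scaled_vector v) \in L]%fset].
  apply/seteqP; split=> v /=.
    move=> [vd [vp [w wE wL]]]; rewrite !inE /=; apply/andP; split.
      rewrite in_fset_set // inE; split => //; split => //.
      by exists w.
    have wv := scaled_vectorP (ex_intro _ w wE).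
    by have -> : scaled_vector v = w by apply: toQp_inj; rewrite -wv.
  rewrite !inE /= => /andP[]; rewrite in_fset_set // inE => -[vd [vp vi]] vL.
  by split => //; split => //; exists (scaled_vector v) => //; exact: scaled_vectorP.
move: NP; rewrite setE => /card_eq_fsetP <-.
by rewrite card_fset_sum1 -big_fset_condE natr_sum big_mkcond /=; apply: eq_bigr => v _; case: ifP.
Qed.

(** The Hecke operator acts on the Ehrhart polynomial by rescalings of its
    argument, which act on each coefficient by a scalar. *)
Theorem hecke_ehrhart_scale :
  hecke_ehrhart pp P k g = \sum_(j < d.+2) (depth_count (p := p) k j)%:R *:
    (scale_arg (p%:R ^+ j) E -
     (if (j : nat) is i.+1 then scale_arg (p%:R ^+ i) E else 0)).
Proof.
apply: poly_eq_nat => m m0.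
rewrite hecke_ehrhartE horner_sum (eq_bigr _ (fun L LL => ehrhart_overlattice m0 LL)).
rewrite exchange_big /= horner_sum.
have fin j : finite_set (points m j) by have [N NP _] := points_card j m0; exists N.
have getP j v : v \in fset_set (points m j) -> points m j v.
  by rewrite (in_fset_set (fin j)) => /set_mem.
have putP j v : points m j v -> v \in fset_set (points m j).
  by rewrite (in_fset_set (fin j)); exact: mem_set.
have inP j v : (v \in fset_set (points m d.+1)) ->
    integral_at (ratQ v *m g) j = (v \in fset_set (points m j)).
  move=> /getP[vd [vp _]]; apply/asboolP/idP => [h|/getP[_ [_ h]]]; last exact: h.
  by apply: putP; split; [exact: vd|split; [exact: vp|exact: h]].
have sub j : (j <= d.+1)%N -> (fset_set (points m j) `<=` fset_set (points m d.+1))%fset.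
  move=> jd; apply/fsubsetP => v /getP[vd [vp vi]]; apply: putP.
  split; [exact: vd|split; [exact: vp|]].
  by rewrite /= -(subnK jd) exprD -scalerA; exact: integral_pZ.
have Epoints j : E.[p%:R ^+ j * m%:R] = \sum_(v <- fset_set (points m j)) 1.
  have [N NP ->] := points_card j m0.
  by rewrite -(card_fset_set NP) card_fset_sum1 natr_sum.
have Eat j : (j <= d.+1)%N -> E.[p%:R ^+ j * m%:R] =
    \sum_(v <- fset_set (points m d.+1)) (integral_at (ratQ v *m g) j)%:R.
  move=> jd; rewrite Epoints.
  have -> : fset_set (points m j) = [fset v in fset_set (points m d.+1) | v \in fset_set (points m j)]%fset.
    apply/fsetP => v; rewrite !inE /=; apply/idP/andP => [h|[_ h]]; last exact: h.
    by split; [exact: (fsubsetP (sub _ jd)) | exact: h].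
  rewrite -big_fset_condE big_mkcond /= !big_seq; apply: eq_bigr => v vS.
  by rewrite (inP _ _ vS); case: ifP.
transitivity (\sum_(v <- fset_set (points m d.+1)) \sum_(j < d.+2)
    (depth_count (p := p) k j)%:R *
    ((integral_at (ratQ v *m g) j)%:R - (integral_before (ratQ v *m g) j)%:R) : rat).
  rewrite !big_seq; apply: eq_bigr => v; rewrite (in_fset_set (fin _)) => /set_mem[vd [vp vi]].
  rewrite -(depth_count_sum (scaled_vectorP vi)) -sum1_card natr_sum.
  rewrite [RHS](eq_bigl (fun L => (L \in Lag) && (redm (scaled_vector v) \in L))); last first.
    by move=> L; rewrite inE.
  by rewrite big_mkcondr /=; apply: eq_bigr => L _; case: ifP.
rewrite exchange_big /=; apply: eq_bigr => j _; rewrite hornerZ -mulr_sumr; congr (_ * _).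
have jd : (j <= d.+1)%N by rewrite -ltnS ltn_ord.
rewrite sumrB hornerD hornerN horner_scale_arg (Eat _ jd); congr (_ - _).
case: (j : nat) jd => [|i] id; first by rewrite horner0 big1_eq.
by rewrite horner_scale_arg (Eat _ (ltnW id)).
Qed.

Corollary hecke_ehrhart_coefE l :
  (hecke_ehrhart pp P k g)`_l = (\sum_(j < d.+2) (depth_count (p := p) k j)%:R *
     (p%:R ^+ (j * l) - (if (j : nat) is i.+1 then p%:R ^+ (i * l) else 0))) * E`_l.
Proof.
rewrite hecke_ehrhart_scale coef_sum mulr_suml; apply: eq_bigr => j _.
rewrite coefZ coefB coef_scale_arg -exprM -mulrA mulrBl; congr (_ * (_ - _)).
by case: j => [[|j] jd] /=; rewrite ?coef0 ?mul0r // coef_scale_arg -exprM.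
Qed.

End HeckeEhrhart.

(** * The Iwasawa decomposition *)

Lemma exprz_sub (F : fieldType) (x : F) (j s : nat) : x != 0 ->
  x ^+ j = x ^+ s * x ^ (j%:Z - s%:Z).
Proof. by move=> x0; rewrite !exprnP -expfzDr // addrC subrK. Qed.

Section TriangularFactor.
Context {p : nat} {pp : prime p}.
Local Notation Zp := (padic_int pp).
Local Notation Qp := (padic_num pp).
Local Notation toQp := (map_mx (@tofrac Zp)).

Lemma padic_row_content w (r : 'rV[Zp]_w) : r != 0 ->
  exists j, exists2 x : 'rV[Zp]_w, r = p%:R ^+ j *: x & exists i, x 0 i \is a GRing.unit.
Proof.
move=> r0; have [i ri] : exists i, r 0 i != 0.
  apply: contrapT => h; case/eqP: r0; apply/rowP => i; rewrite mxE.
  by apply: contrapT => ri; apply: h; exists i; apply/eqP.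
have [k [u [uu rE]]] := padic_valuation ri.
elim: k r {r0 ri} rE => [|k IH] r rE.
  by exists 0%N, r; [rewrite expr0 scale1r | exists i; rewrite rE mul1r].
have [rp|[r' r'E]] := padic_primitive_or_dvd r.
  by exists 0%N, r => //; rewrite expr0 scale1r.
have [|j [x xE xp]] := IH r'.
  by apply: (mulfI padic_p_neq0); rewrite mulrA -exprS -rE r'E mxE.
by exists j.+1, x => //; rewrite r'E xE scalerA exprS.
Qed.

Lemma padic_row_primitive w (r : 'rV[Qp]_w) (z : 'cV[Qp]_w) : r *m z = 1%:M ->
  exists (t : int) (x : 'rV[Zp]_w) (y : 'cV[Zp]_w),
    r = p%:R ^ t *: toQp x /\ x *m y = 1%:M.
Proof.
move=> rz; have [s [r' r'E]] := padic_denominator_mx r.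
have ps0 j : (p%:R ^+ j : Qp) != 0 by rewrite expf_neq0 // padic_p_num_neq0.
have r'0 : r' != 0.
  apply/eqP => r'0; move: r'E; rewrite r'0 map_mx0 => /eqP.
  rewrite scaler_eq0 (negPf (ps0 s)) /= => /eqP rr.
  by move: rz; rewrite rr mul0mx => /matrixP/(_ 0 0)/eqP; rewrite !mxE eq_sym oner_eq0.
have [j [x xE [i xi]]] := padic_row_content r'0.
exists (j%:Z - s%:Z), x, ((x 0 i)^-1 *: delta_mx i 0); split.
  apply: (scalerI (ps0 s)); rewrite r'E xE map_mxZ rmorphXn /= rmorph_nat scalerA.
  by rewrite -(exprz_sub _ _ (@padic_p_num_neq0 p pp)).
by rewrite -scalemxAr -colE; apply/matrixP => a b; rewrite !ord1 !mxE mulVr.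
Qed.

(** The last row of [N] is a power of [p] times a primitive row [x]. Clearing
    the component of the other rows along [x] reduces to one row less. *)
Lemma triangular_factor m w (N : 'M[Qp]_(m, w)) (W : 'M[Qp]_(w, m)) :
  N *m W = 1%:M ->
  exists (D : 'M[Qp]_m) (X : 'M[Zp]_(m, w)) (Z : 'M[Zp]_(w, m)) (e : 'I_m -> int),
  [/\ D *m N = toQp X, X *m Z = 1%:M, forall i j : 'I_m, (j < i)%N -> D i j = 0 &
      forall i, D i i = p%:R ^ e i].
Proof.
elim: m N W => [|m IH] N W.
  move=> _; exists 0, 0, 0, (fun=> 0); split; try by case.
    by apply/matrixP; case.
  by apply/matrixP; case.
move: N W; rewrite -addn1 => N W.
rewrite -[N]vsubmxK -[W]hsubmxK; move: (usubmx N) (dsubmx N) (lsubmx W) (rsubmx W).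
move=> {N W} N r W1 W2; rewrite mul_col_row scalar_mx_block => /eq_block_mx[NW1 _ rW1 rW2].
have [t [x [y [rE xy]]]] := padic_row_primitive rW2.
have pt0 : (p%:R ^ t : Qp) != 0 by rewrite expfz_neq0 // padic_p_num_neq0.
pose N' := N - N *m toQp y *m toQp x.
have xr : toQp x = p%:R ^ (- t) *: r.
  by rewrite rE scalerA -expfzDr ?padic_p_num_neq0 // addNr expr0z scale1r.
have N'W : N' *m W1 = 1%:M.
  by rewrite mulmxBl NW1 xr -scalemxAr -!scalemxAl -mulmxA rW1 mulmx0 scaler0 subr0.
have [D [X [Z [e [DN XZ Dt De]]]]] := IH _ _ N'W.
have xyQ : toQp x *m toQp y = 1%:M by rewrite -map_mxM xy map_mx1.
have Xy : X *m y = 0.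
  apply: toQp_inj; rewrite map_mxM -DN map_mx0 -mulmxA mulmxBl -!mulmxA xyQ mulmx1.
  by rewrite subrr mulmx0.
pose e2 (i : 'I_(m + 1)) := match fintype.split i with inl j => e j | inr _ => - t end.
have e2l i : e2 (lshift 1 i) = e i by rewrite /e2 (unsplitK (inl i)).
have e2r i : e2 (rshift m i) = - t by rewrite /e2 (unsplitK (inr i)).
exists (block_mx D (- (p%:R ^ (- t) *: (D *m N *m toQp y))) 0 (p%:R ^ (- t))%:M).
exists (col_mx X x), (row_mx ((1%:M - y *m x) *m Z) y).
exists e2; split.
- rewrite mul_block_col map_col_mx mul0mx add0r mul_scalar_mx -xr; congr col_mx.
  by rewrite -DN mulNmx -scalemxAl scalemxAr -xr mulmxBr !mulmxA.
- have XZ' : X *m ((1%:M - y *m x) *m Z) = 1%:M.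
    by rewrite mulmxA mulmxBr mulmx1 mulmxA Xy mul0mx subr0.
  have xZ' : x *m ((1%:M - y *m x) *m Z) = 0.
    by rewrite mulmxA mulmxBr mulmx1 mulmxA xy mul1mx subrr mul0mx.
  by rewrite mul_col_row XZ' xZ' Xy xy scalar_mx_block.
- move=> i j; case: (split_ordP i) => i' ->; case: (split_ordP j) => j' ->.
  + by rewrite block_mxEul; exact: Dt.
  + by move=> /= h; have := ltn_ord i'; lia.
  + by rewrite block_mxEdl mxE.
  + by rewrite !ord1 ltnn.
- move=> i; case: (split_ordP i) => i' iE; rewrite iE.
    by rewrite block_mxEul De e2l.
  by rewrite block_mxEdr !ord1 e2r mxE.
Qed.

End TriangularFactor.

Section Iwasawa.
Context {p : nat} {pp : prime p} {n : nat}.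
Variable k : 'I_n.+1.
Local Notation Zp := (padic_int pp).
Local Notation Qp := (padic_num pp).
Local Notation toQp := (map_mx (@tofrac Zp)).
Local Notation d := (hecke_deg k).
Local Notation pd := (p%:R ^+ d.+1).
Local Notation H := (dcoset (hecke_mx pp k)).

Lemma mul_rsub_inv (K : comUnitRingType) (M : 'M[K]_(n + n)) : M \in unitmx ->
  dsubmx (invmx M) *m M = row_mx 0 1%:M.
Proof.
move=> Mu; have := mulVmx Mu; rewrite -{1}[invmx M]vsubmxK mul_col_mx.
rewrite scalar_mx_block block_mxEv => /eq_col_mx[_ ->] //.
Qed.

(** The Iwasawa decomposition. The triangular factor [D] makes the lower half of
    [M^-1] primitive, and an isotropic primitive family is the lower half of a
    symplectic matrix. *)
Lemma iwasawa M : H M -> exists e, satake_exponents (rcoset M) e.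
Proof.
move=> HM; have Mu := hecke_unit HM; have [u uu hM] := hecke_similitude HM.
have muu := hecke_mu_unit k uu.
pose N := dsubmx (invmx M).
have NM : N *m M = row_mx 0 1%:M := mul_rsub_inv Mu.
have NW : N *m rsubmx M = 1%:M.
  by have := NM; rewrite -{1}[M]hsubmxK mul_mx_row => /eq_row_mx[].
have NJN : N *m symp_form Qp n *m N^T = 0.
  have := similitudeV muu hM; rewrite -[invmx M]submxK => /similitude_blockP[_ _ e].
  rewrite /N -[invmx M]submxK block_mxEv col_mxKd mul_block_form e.
  by rewrite subrr.
have [D [X [Z [e [DN XZ Dt De]]]]] := triangular_factor NW.
have XJX : X *m symp_form Zp n *m X^T = 0.
  apply: toQp_inj; rewrite map_mx0 !map_mxM map_symp_form -map_trmx -DN.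
  by rewrite trmx_mul -!mulmxA (mulmxA N) (mulmxA (N *m _)) NJN mul0mx mulmx0.
have [Y hY] := isotropic_extend XZ XJX.
pose G := col_mx Y X.
have GM : toQp G *m M = block_mx (lsubmx (toQp Y *m M)) (rsubmx (toQp Y *m M)) 0 D.
  rewrite /G map_col_mx mul_col_mx block_mxEv hsubmxK -DN -mulmxA NM.
  by rewrite mul_mx_row mulmx0 mulmx1.
have hG : similitude (pd * tofrac u) (toQp G *m M).
  by have := similitudeM (similitude_map (@tofrac Zp) hY) hM; rewrite rmorph1 mul1r.
have Dunit : D \in unitmx.
  have : D *m (N *m toQp Z) = 1%:M by rewrite mulmxA DN -map_mxM XZ map_mx1.
  by move=> h; have [Du _] := mulmx1_unit h; exact: Du.
have AE : lsubmx (toQp Y *m M) = (pd * tofrac u) *: invmx D^T.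
  move: hG; rewrite GM => /similitude_blockP[_ + _].
  rewrite trmx0 mulmx0 subr0 => AD.
  have DTu : D^T \in unitmx by rewrite unitmx_tr.
  by rewrite -[LHS](mulmxK DTu) AD mul_scalar_mx.
(* The similitude factor of [toQp G *m M] is a power of [p] times the unit [u],
   which is divided out here. *)
pose S : 'M[Zp]_(n + n) := block_mx (u^-1)%:M 0 0 1%:M.
have GS : GSp Zp n S.
  by apply/GSpP; exists u^-1; [rewrite unitrV | exact: similitude_scale].
exists (d.+1%:Z, e), ((tofrac u^-1)%:M *m rsubmx (toQp Y *m M)), D; split => //.
apply/rcosetP; exists (S *m G); first by apply: GSpM => //; exact: GSp_similitude1 hY.
rewrite map_mxM -mulmxA GM /S map_block_mx map_mx0 map_mx1 map_scalar_mx mulmx_block.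
rewrite !mul0mx !mulmx0 !addr0 !add0r !mul1mx AE mul_scalar_mx scalerA.
congr (block_mx (_ *: _) _ _ _).
rewrite mulrCA -rmorphM mulVr // rmorph1 mulr1 //.
Qed.

End Iwasawa.

(** * The Satake image at the parameters *)

Lemma unitmx_scale_inv (F : fieldType) m (c : F) (M : 'M[F]_m) : c != 0 ->
  M \in unitmx -> c *: invmx M \in unitmx.
Proof. by move=> c0 Mu; rewrite unitmxZ ?unitmx_inv // unitfE. Qed.

Lemma exprz_quotient (F : fieldType) (x c : F) (a : int) (s : nat) : x != 0 ->
  x ^ a = x ^+ s * c -> x ^ (a - s%:Z) = c /\ x ^ (- (a - s%:Z)) = c^-1.
Proof.
move=> x0 xa; have e : x ^ (a - s%:Z) = c.
  by rewrite expfzDr // -exprnN xa mulrAC divff ?mul1r // expf_neq0.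
by split; [exact: e | rewrite -invr_expz e].
Qed.

Section SatakeTerms.
Context {p : nat} {pp : prime p} {n : nat}.
Variable k : 'I_n.+2.
Local Notation Zp := (padic_int pp).
Local Notation Qp := (padic_num pp).
Local Notation toQp := (map_mx (@tofrac Zp)).
Local Notation d := (hecke_deg k).
Local Notation redm := (map_mx (@red p pp d)).
Local Notation pd := (p%:R ^+ d.+1).
Local Notation H := (dcoset (hecke_mx pp k)).

Definition f_vec : 'rV[Zp]_(n.+1 + n.+1) := delta_mx 0 (rshift n.+1 ord_max).

Lemma triangular_unit (K : fieldType) m (D : 'M[K]_m) :
  (forall i j : 'I_m, (j < i)%N -> D i j = 0) -> (forall i, D i i != 0) -> D \in unitmx.
Proof.
move=> Dt Dd; rewrite -unitmx_tr unitmxE det_trig.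
  by rewrite unitfE; apply/prodf_neq0 => i _; rewrite mxE.
by apply/is_trig_mxP => i j ij; rewrite mxE Dt.
Qed.

Lemma last_row_triangular (K : fieldType) m (D : 'M[K]_m.+1) c :
  (forall i j : 'I_m.+1, (j < i)%N -> D i j = 0) -> D ord_max ord_max = c ->
  (delta_mx 0 ord_max : 'rV[K]_m.+1) *m D = c *: delta_mx 0 ord_max.
Proof.
move=> Dt Dc; rewrite -rowE; apply/rowP => j; rewrite !mxE eqxx /=.
have [->|jm] := eqVneq j ord_max; first by rewrite Dc mulr1.
by rewrite mulr0 Dt // ltn_neqAle jm -ltnS ltn_ord.
Qed.

(** The last row of a block triangular matrix is the only one that contributes to
    a combination of the rows lying on the last coordinate line. *)
Lemma last_coordinate (K : fieldType) m (B A D : 'M[K]_m.+1) (a t : K) (v : 'rV[K]_(m.+1 + m.+1)) :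
  A \in unitmx -> D \in unitmx ->
  (delta_mx 0 ord_max : 'rV[K]_m.+1) *m D = a *: delta_mx 0 ord_max -> a != 0 ->
  v *m block_mx A B 0 D = t *: delta_mx 0 (rshift m.+1 ord_max) ->
  t = v 0 (rshift m.+1 ord_max) * a.
Proof.
move=> Au Du De a0; rewrite -[v]hsubmxK; move: (lsubmx v) (rsubmx v) => {v} v1 v2.
have -> : delta_mx 0 (rshift m.+1 ord_max) = row_mx 0 (delta_mx 0 ord_max) :> 'rV[K]_(m.+1 + m.+1).
  by rewrite -[LHS]hsubmxK; congr row_mx; apply/rowP => i; rewrite !mxE ?eq_lrshift ?eq_rshift.
rewrite mul_row_block mulmx0 addr0 scale_row_mx scaler0 => /eq_row_mx[vA vD].
have v10 : v1 = 0 by rewrite -[v1](mulmxK Au) vA mul0mx.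
move: vD; rewrite v10 mul0mx add0r => vD.
have DV : (delta_mx 0 ord_max : 'rV[K]_m.+1) *m invmx D = a^-1 *: delta_mx 0 ord_max.
  apply: (can_inj (mulmxK Du)); rewrite mulmxKV // -scalemxAl De scalerA mulVf //.
  by rewrite scale1r.
have v2E : v2 = (t * a^-1) *: delta_mx 0 ord_max.
  by rewrite -[v2](mulmxK Du) vD -scalemxAl DV scalerA.
by rewrite row_mxEr v2E !mxE !eqxx mulr1 mulfVK.
Qed.

Lemma redm_pZ j (w : 'rV[Zp]_(n.+1 + n.+1)) : redm (p%:R ^+ j *: w) = p%:R ^+ j *: redm w.
Proof. by rewrite map_mxZ rmorphXn /= rmorph_nat. Qed.

Lemma toQp_pZ j (w : 'rV[Zp]_(n.+1 + n.+1)) : toQp (p%:R ^+ j *: w) = p%:R ^+ j *: toQp w.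
Proof. by rewrite map_mxZ rmorphXn /= rmorph_nat. Qed.

(** The similitude factor is [p ^ e.1] up to a unit of [Z_p], and the last
    diagonal exponent is read off from the multiples of the last unit vector in
    the row lattice, which is the same for all representatives. *)
Lemma exponents_last M e : H M -> satake_exponents (rcoset M) e ->
  e.1 = d.+1%:Z /\ exists2 t : nat, e.2 ord_max = t%:Z & (t <= d.+1)%N /\
    forall j, (p%:R ^+ j *: redm f_vec \in lattice_red k M) = (t <= j)%N.
Proof.
move=> HM [B [D [Dt De /rcosetP[x Gx NE]]]].
set N := block_mx _ _ _ _ in NE.
have HN : H N by rewrite NE; exact: hecke_mull.
have p0 : (p%:R : Qp) != 0 := padic_p_num_neq0.
have Du : D \in unitmx by apply: triangular_unit Dt _ => i; rewrite De expfz_neq0.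
have DTu : D^T \in unitmx by rewrite unitmx_tr.
have [u uu hN] := hecke_similitude HN.
have e1E : p%:R ^ e.1 = pd * tofrac u :> Qp.
  move: hN => /similitude_blockP[_ + _].
  rewrite trmx0 mulmx0 subr0 -scalemxAl (mulVmx DTu).
  by move=> /matrixP/(_ 0 0); rewrite !mxE !mulr1n mulr1.
have [e1l e1r] := exprz_quotient p0 e1E.
have e1 : e.1 = d.+1%:Z.
  have ge := exp_p_int e1l.
  rewrite -rmorphV // in e1r; have le := exp_p_int e1r.
  by apply/eqP; lia.
split; first exact: e1.
have Dlast := last_row_triangular Dt (De ord_max).
have fN : toQp f_vec *m N = p%:R ^ e.2 ord_max *: toQp f_vec.
  have -> : toQp f_vec = row_mx 0 (delta_mx 0 ord_max) :> 'rV[Qp]_(n.+1 + n.+1).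
    rewrite /f_vec map_delta_mx -[LHS]hsubmxK; congr row_mx; apply/rowP => i;
      by rewrite !mxE ?eq_lrshift ?eq_rshift.
  by rewrite mul_row_block !mul0mx !add0r mulmx0 Dlast scale_row_mx scaler0.
have Nf : row_lattice N (p%:R ^ e.2 ord_max *: toQp f_vec).
  by apply/row_latticeP; exists f_vec; rewrite fN.
have t0 : 0 <= e.2 ord_max.
  have [w wE] := hecke_lattice_int HN Nf.
  apply: (@exp_p_int p pp _ (w 0 (rshift n.+1 ord_max))).
  have /rowP/(_ (rshift n.+1 ord_max)) := wE; rewrite !mxE !eqxx /= rmorph1 mulr1.
  exact.
have [t tE] : exists t : nat, e.2 ord_max = t%:Z by exists `|e.2 ord_max|%N; rewrite gez0_abs.
have Nj j : row_lattice N (toQp (p%:R ^+ j *: f_vec)) <-> (t <= j)%N.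
  split=> [/row_latticeP[c cE]|tj].
    have := @last_coordinate _ _ B (p%:R ^ e.1 *: invmx D^T) D _ (p%:R ^+ j) (toQp c) _ Du Dlast.
    have Au := unitmx_scale_inv (expfz_neq0 e.1 p0) DTu.
    have a0 := expfz_neq0 (e.2 ord_max) p0.
    move=> /(_ Au a0); rewrite -/N -cE toQp_pZ /f_vec map_delta_mx => /(_ erefl).
    rewrite tE mxE => pj.
    rewrite mulrC in pj; have [jt _] := exprz_quotient (a := j%:Z) p0 pj.
    have := exp_p_int jt; lia.
  apply/row_latticeP; exists (p%:R ^+ (j - t) *: f_vec).
  by rewrite !toQp_pZ -scalemxAl fN tE scalerA -[_ ^ t%:Z]/(_ ^+ t) -exprD subnK.
exists t; first exact: tE; split.
  by apply/Nj; exact: hecke_lattice_pd.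
have LE : lattice_red k M = lattice_red k N.
  by rewrite NE /lattice_red (row_lattice_mull _ Gx).
move=> j; rewrite LE -redm_pZ; apply/idP/idP => [h|h].
  by apply/Nj/(mem_lattice_red _ HN).
by apply/(mem_lattice_red _ HN)/Nj.
Qed.

End SatakeTerms.

(** Splits a power [c ^+ J] into contributions that depend on [J] only through
    the indicators of [j <= J]. *)
Lemma telescope_indicator (K : pzRingType) (c : K) N J : (J <= N)%N ->
  \sum_(j < N.+1) (j <= J)%N%:R * (c ^+ j - (if (j : nat) is i.+1 then c ^+ i else 0)) = c ^+ J.
Proof.
elim: N J => [|N IH] J JN.
  by move: JN; rewrite leqn0 => /eqP ->; rewrite big_ord1 /= mul1r subr0.
rewrite big_ord_recr /=; move: JN; rewrite leq_eqVlt => /predU1P[->|JN].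
  rewrite leqnn mul1r -[X in _ + X](addrC (- c ^+ N)) addrA.
  rewrite -[X in _ = X]add0r; congr (_ + _); apply/eqP; rewrite subr_eq0; apply/eqP.
  rewrite -(IH N (leqnn N)); apply: eq_bigr => j _.
  have jN : (j <= N)%N by rewrite -ltnS; exact: ltn_ord.
  by rewrite jN (leqW jN).
by rewrite IH // leqNgt JN mul0r addr0.
Qed.

Section SatakeValue.
Context {p : nat} {pp : prime p} {n : nat}.
Variable k : 'I_n.+2.
Variables (K : fieldType) (l : nat).
Hypothesis pK : (p%:R : K) != 0.
Local Notation d := (hecke_deg k).
Local Notation redm := (map_mx (@red p pp d)).
Local Notation H := (dcoset (hecke_mx pp k)).
Local Notation Lag := (lagrangians p d n.+1 k).

(** At these parameters only the last diagonal exponent survives. *)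
Lemma satake_monomial (e : int * ('I_n.+1 -> int)) :
  @satake_param K p n.+1 l ord0 ^ e.1 *
    \prod_(j < n.+1) (p%:R ^- j.+1 * @satake_param K p n.+1 l (lift ord0 j)) ^ e.2 j
  = p%:R ^ (l%:Z * (e.1 - e.2 ord_max)).
Proof.
rewrite big_ord_recr /= big1 ?mul1r => [|j _]; last first.
  have jn : (j < n)%N := ltn_ord j.
  rewrite /satake_param /= /bump /= add1n eqSS (ltn_eqF jn).
  by rewrite mulVf ?exp1rz // expf_neq0.
rewrite /satake_param /= /bump /= add1n eqxx.
rewrite exprnN -expfzDr // addKr exprnP !exprz_exp -expfzDr //.
by rewrite mulrBr mulNr.
Qed.

Lemma satake_term_lattice M : H M ->
  satake_term (satake_param K p l) (rcoset M) =
  \sum_(j < d.+2) (p%:R ^+ (d.+1 - j) *: redm f_vec \in lattice_red k M)%:R *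
     (p%:R ^+ (j * l) - (if (j : nat) is i.+1 then p%:R ^+ (i * l) else 0)).
Proof.
move=> HM; rewrite /satake_term; set e := xget _ _.
have eP : satake_exponents (rcoset M) e.
  by have [e' e'P] := iwasawa HM; exact: (@xgetPex _ _ _ (ex_intro _ e' e'P)).
clearbody e; have [e1 [t tE [td tP]]] := exponents_last HM eP.
rewrite satake_monomial e1 tE subzn // -PoszM -exprnP exprM.
rewrite -(telescope_indicator _ (leq_subr t d.+1)); apply: eq_bigr => j _.
have jd : (j <= d.+1)%N by rewrite -ltnS; exact: ltn_ord.
have -> : (j <= d.+1 - t)%N = (t <= d.+1 - j)%N by lia.
rewrite tP; congr (_ * (_ - _)); first by rewrite -exprM mulnC.
by case: (j : nat) => // i; rewrite -exprM mulnC.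
Qed.

(** The number of Lagrangians that contain a multiple of the last unit vector is
    the one for [e_vec], both vectors being primitive. *)
Lemma satake_valueE :
  satake_value pp (hecke_mx pp k) (satake_param K p l) =
  \sum_(j < d.+2) (depth_count (p := p) k j)%:R *
     (p%:R ^+ (j * l) - (if (j : nat) is i.+1 then p%:R ^+ (i * l) else 0)).
Proof.
pose G (L : {set 'rV['Z_(p ^ d.+1)]_(n.+1 + n.+1)}) := \sum_(j < d.+2)
  (p%:R ^+ (d.+1 - j) *: redm f_vec \in L)%:R *
     (p%:R ^+ (j * l) - (if (j : nat) is i.+1 then p%:R ^+ (i * l) else 0)) : K.
rewrite /satake_value (sum_right_cosets (G := G) satake_term_lattice) /G.
rewrite exchange_big /=; apply: eq_bigr => j _; rewrite -mulr_suml; congr (_ * _).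
have f1 : f_vec (n := n) 0 (rshift n.+1 ord_max) \is a @GRing.unit (padic_int pp).
  by rewrite mxE !eqxx unitr1.
rewrite /depth_count -(incident_primitive k _ f1) -sum1_card natr_sum.
rewrite [RHS](eq_bigl (fun L => (L \in Lag) && (p%:R ^+ (d.+1 - j) *: redm f_vec \in L))).
  by rewrite big_mkcondr /=; apply: eq_bigr => L _; case: ifP.
by move=> L; rewrite inE.
Qed.

End SatakeValue.

(** * The eigenvalues *)

(** The equality is needed over [rat] for the Ehrhart coefficients and over the
    complex numbers for the Satake image, whence the arbitrary ring. *)
Lemma hecke_eigenvalue_poly n l (k : 'I_n.+2) : exists nu : {poly int},
  forall p, prime p -> forall K : pzRingType, (nu.[p%:Z])%:~R =
    \sum_(j < (hecke_deg k).+2) (depth_count (p := p) k j)%:R *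
      (p%:R ^+ (j * l) - (if (j : nat) is i.+1 then p%:R ^+ (i * l) else 0)) :> K.
Proof.
have /choice[Q QP] (j : 'I_(hecke_deg k).+2) :=
  incident_poly (hecke_deg_le1 k) n (@hecke_deg0 _ k) (leq_subr j (hecke_deg k).+1).
exists (\sum_j Q j * ('X^(j * l) - (if (j : nat) is i.+1 then 'X^(i * l) else 0))).
move=> p pp K; rewrite horner_sum rmorph_sum; apply: eq_bigr => j _.
have hX i : ('X^(i * l) : {poly int}).[p%:Z]%:~R = p%:R ^+ (i * l) :> K.
  by rewrite hornerXn rmorphXn.
rewrite hornerM -QP // rmorphM hornerD hornerN rmorphB /= hX; congr (_ * (_ - _)).
by case: (j : nat) => [|i]; rewrite ?hX // horner0.
Qed.

Section Cosets.
Context {p : nat} {pp : prime p} {n : nat}.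
Local Notation Zp := (padic_int pp).
Local Notation Qp := (padic_num pp).
Local Notation toQp := (map_mx (@tofrac Zp)).

Lemma Gplus_coset_repr (X : set 'M[Qp]_(n + n)) :
  Gplus_cosets pp n X -> Gplus pp n (coset_repr X).
Proof.
move=> [g Gg <-].
have /lcosetP[x Gx ->] : lcoset g (coset_repr (lcoset g)).
  by apply: (@xgetPex _ _ (lcoset g)); exists g; exact: lcoset_refl.
have [_ [N gN]] := GplusP Gg; have /GSpP[mu muu hx] := Gx; split.
  have Gx' : GSp Qp n (toQp x).
    by apply/GSpP; exists (tofrac mu); [exact: rmorph_unit | exact: similitude_map].
  exact: (GSpM (proj1 Gg) Gx').
by exists (N *m x) => //; rewrite gN map_mxM.
Qed.

Lemma Gplus1 : Gplus pp n 1%:M.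
Proof.
split; last by exists 1%:M => //; rewrite map_mx1.
exact/GSp_similitude1/similitude1.
Qed.

(** A rational number with denominator a power of [p] that is a [p]-adic integer
    is an integer. *)
Lemma rat_lattice1 :
  rat_lattice (row_lattice (invmx (1%:M : 'M[Qp]_(n + n)))) = int_lattice.
Proof.
apply/seteqP; split=> [v [vp /(row_lattice_inv _ (unitmx1 _ _))]|_ [w _ <-]].
  rewrite mulmx1 => -[w wE].
  have /choice[u uE] i : exists u : int, v 0 i = u%:~R.
    have [s si] := vp i; apply/intrP; apply: (@rat_int_of_padic p pp _ s (w 0 i) si).
    by move/rowP/(_ i): wE; rewrite !mxE.
  by exists (\row_i u i) => //; apply/rowP => i; rewrite !mxE uE.
split; first by move=> i; exists 0%N; rewrite !mxE expr0 mul1r intr_int.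
by apply/(row_lattice_inv _ (unitmx1 _ _)); rewrite mulmx1; exact: integral_int.
Qed.

End Cosets.

Theorem theorem1 (n l : nat) (n_gt0 : (0 < n)%N) (le_l_2n : (l <= 2 * n)%N) :
  exists nu : 'I_n.+1 -> {poly int},
    forall (p : nat) (pp : prime p) (R : realType),
      (forall P : set 'rV[R]_(n + n),
         lattice_polytope P -> full_dimensional P ->
         (forall (k : 'I_n.+1) (X : set 'M[padic_num pp]_(n + n)),
            Gplus_cosets pp n X ->
            hecke_ehrhart_coef pp P k l X
              = ((nu k).[p%:Z])%:~R * ehrhart_coef pp P l X) /\
         ((ehrhart int_lattice P)`_l != 0 ->
          forall k : 'I_n.+1,
            ((nu k).[p%:Z])%:~R
              = (hecke_ehrhart pp P k 1%:M)`_l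
                  / (ehrhart int_lattice P)`_l)) /\
      (forall k : 'I_n.+1,
         ((nu k).[p%:Z])%:~R
           = satake_value pp (hecke_mx pp k) (satake_param R[i] p l)).
Proof.
case: n n_gt0 le_l_2n => // n _ _.
have /choice[nu nuE] := hecke_eigenvalue_poly l (n := n); exists nu => p pp R.
split=> [P PP _|k]; last first.
  rewrite (nuE _ _ pp) satake_valueE //.
  by rewrite pnatr_eq0 -lt0n prime_gt0.
have eigen k g : Gplus pp n.+1 g ->
    (hecke_ehrhart pp P k g)`_l = ((nu k).[p%:Z])%:~R * (ehrhart_act pp P g)`_l.
  by move=> Gg; rewrite (hecke_ehrhart_coefE k PP Gg) (nuE _ _ pp).
split=> [k X /Gplus_coset_repr GX|c0 k].
  by rewrite /hecke_ehrhart_coef (eigen _ _ GX) rmorphM /= ratr_int.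
rewrite (eigen _ _ Gplus1) /ehrhart_act rat_lattice1.
by rewrite (mulfK c0).
Qed.
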